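(* There exists a weakly fan-planar graph that does not admit a strongly fan-planar drawing.
   Context: Graphs are simple. A drawing of a graph maps vertices to distinct points of the plane and edges to Jordan arcs between their endpoints that pass through no other vertex; drawings are simple: two edges share at most one point, which is either a common endpoint or a proper crossing, and adjacent edges do not cross. For an edge $e$ and two edges $e_1,e_2$ crossing $e$ at points $x_1,x_2$, the following patterns are considered. Pattern (I): $e_1$ and $e_2$ do not share an endpoint. If $e_1,e_2$ share an endpoint $u$, let $C$ be the closed curve formed by the part of $e_1$ from $u$ to $x_1$, the part of $e$ between $x_1$ and $x_2$, and the part of $e_2$ from $x_2$ to $u$; Pattern (II): exactly one endpoint of $e$ lies in the bounded region of $C$; Pattern (III): both endpoints of $e$ lie in the bounded region of $C$. A drawing is weakly fan-planar if no triple of edges forms Pattern (I) or (II), and strongly fan-planar if no triple forms Pattern (I), (II) or (III). A graph is weakly (strongly) fan-planar if it admits a weakly (strongly) fan-planar drawing. *)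

(* Defs.v *)
From HB Require Import structures.
From mathcomp Require Import all_boot all_order all_algebra.
From mathcomp Require Import all_classical all_reals all_analysis.

Set Implicit Arguments.
Unset Strict Implicit.
Unset Printing Implicit Defensive.

Import Order.TTheory GRing.Theory Num.Theory.
Import numFieldNormedType.Exports.

Local Open Scope classical_set_scope.
Local Open Scope ring_scope.

Record sgraph := SGraph {
  vertex :> finType;
  adj : rel vertex;
  adj_sym : symmetric adj;
  adj_irrefl : irreflexive adj }.

(* Edges are unordered: an edge is the set of its two endpoints. *)
Definition is_edge (G : sgraph) (e : {set G}) : Prop :=
  exists u v : G, adj u v /\ e = [set u; v]%SET.

Definition share_endpoint (G : sgraph) (e f : {set G}) : Prop :=
  exists u : G, u \in e /\ u \in f.

Section Plane.
Variable R : realType.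

Definition plane := (R * R)%type.

Definition jordan_arc (g : R -> plane) : Prop :=
  {within `[0, 1], continuous g} /\ {in `[0, 1] &, injective g}.

Definition curve (g : R -> plane) : set plane := g @` `[0, 1].

(* For a Jordan arc g through p and q, the parameters s and t are unique. *)
Definition part (g : R -> plane) (p q : plane) : set plane :=
  [set z | exists s t r : R,
     [/\ s \in `[0, 1], t \in `[0, 1], g s = p, g t = q &
         Num.min s t <= r <= Num.max s t /\ z = g r]].

Definition homeomorphism (U V : set plane) (h k : plane -> plane) : Prop :=
  [/\ forall z, U z -> V (h z) /\ k (h z) = z,
      forall w, V w -> U (k w) /\ h (k w) = w,
      {within U, continuous h} &
      {within V, continuous k}].

(* Locally at x, the pair (A, B) looks like the two coordinate axes at the
   origin; in particular x is not an end of A or B, and A and B do not merely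
   touch at x. *)
Definition proper_crossing (A B : set plane) (x : plane) : Prop :=
  exists (U : set plane) (h k : plane -> plane),
    [/\ open U, U x, h x = 0, homeomorphism U (ball (0 : plane) 1) h k &
        forall z, U z -> (A z <-> (h z).2 = 0) /\ (B z <-> (h z).1 = 0)].

(* For a simple closed curve Z, the points in the bounded component of the
   complement of Z. *)
Definition bounded_region (Z : set plane) : set plane :=
  [set p | ~ Z p /\ bounded_set (connected_component (~` Z) p)].

Section Drawing.
Variable G : sgraph.

(* The value of arc on a set that is not an edge is irrelevant. *)
Record drawing := Drawing {
  pos : G -> plane;
  arc : {set G} -> R -> plane;
  pos_inj : injective pos;
  arc_jordan : forall e, is_edge e -> jordan_arc (arc e);
  arc_ends : forall e, is_edge e ->
    exists u v : G, [/\ e = [set u; v]%SET, arc e 0 = pos u & arc e 1 = pos v];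
  arc_vertex : forall e, is_edge e ->
    forall v : G, curve (arc e) (pos v) -> v \in e;
  arcs_meet_once : forall e f, is_edge e -> is_edge f -> e != f ->
    forall p q, (curve (arc e) `&` curve (arc f)) p ->
                (curve (arc e) `&` curve (arc f)) q -> p = q;
  arcs_meet : forall e f, is_edge e -> is_edge f -> e != f ->
    forall p, (curve (arc e) `&` curve (arc f)) p ->
      (exists v : G, [/\ v \in e, v \in f & p = pos v]) \/
      proper_crossing (curve (arc e)) (curve (arc f)) p;
  adjacent_no_cross : forall e f, is_edge e -> is_edge f -> e != f ->
    share_endpoint e f ->
    forall p, ~ proper_crossing (curve (arc e)) (curve (arc f)) p }.

Variable D : drawing.

Definition crosses_at (e f : {set G}) (x : plane) : Prop :=
  [/\ is_edge e, is_edge f, e != f &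
      proper_crossing (curve (arc D e)) (curve (arc D f)) x].

Definition pattern_I (e e1 e2 : {set G}) : Prop :=
  [/\ exists x1, crosses_at e1 e x1,
      exists x2, crosses_at e2 e x2 &
      ~ share_endpoint e1 e2].

Definition closed_curve (e e1 e2 : {set G}) (u : G) (x1 x2 : plane) :
    set plane :=
  part (arc D e1) (pos D u) x1 `|` part (arc D e) x1 x2 `|`
  part (arc D e2) x2 (pos D u).

Definition pattern_II (e e1 e2 : {set G}) : Prop :=
  exists (u : G) (x1 x2 : plane),
    [/\ e1 != e2, crosses_at e1 e x1, crosses_at e2 e x2,
        u \in e1 /\ u \in e2 &
        exists! v : G,
          v \in e /\ bounded_region (closed_curve e e1 e2 u x1 x2) (pos D v)].

Definition pattern_III (e e1 e2 : {set G}) : Prop :=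
  exists (u : G) (x1 x2 : plane),
    [/\ e1 != e2, crosses_at e1 e x1, crosses_at e2 e x2,
        u \in e1 /\ u \in e2 &
        forall v : G,
          v \in e -> bounded_region (closed_curve e e1 e2 u x1 x2) (pos D v)].

Definition weakly_fan_planar_drawing : Prop :=
  forall e e1 e2, ~ pattern_I e e1 e2 /\ ~ pattern_II e e1 e2.

Definition strongly_fan_planar_drawing : Prop :=
  forall e e1 e2,
    [/\ ~ pattern_I e e1 e2, ~ pattern_II e e1 e2 & ~ pattern_III e e1 e2].

End Drawing.

Definition weakly_fan_planar (G : sgraph) : Prop :=
  exists D : drawing G, weakly_fan_planar_drawing D.

Definition strongly_fan_planar (G : sgraph) : Prop :=
  exists D : drawing G, strongly_fan_planar_drawing D.

End Plane.

(* Main.v *)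
From HB Require Import structures.
From Stdlib Require Import ZArith Btauto.
From mathcomp Require Import all_boot all_order all_algebra.
From mathcomp Require Import all_classical all_reals all_analysis.
From mathcomp Require Import lra ring ssrZ zify.
Require Import Defs.

(** The graph has a vertex [0] and two disjoint sides, each with a hub [o], a pentagon [u a c d b] around it whose
    edges are thick, thick edges from [o] to the pentagon and from [u] to [0], and thin edges
    [uc ud ab ad bc 0a 0b]; a thick edge is a K7 through its ends.

    Weak drawing: the thick edges are drawn straight as thin lenses, with the thin edges outside the pentagons.
    Coordinates are integers, so that simplicity and Pattern (I) are decided by orientation signs.  Pattern (II) is
    excluded by polylines that join the two ends of [e] without meeting the closed curve.

    No strong drawing: the number of crossings mod 2 is computed by a winding parity, which gives that every K5 has
    an odd number of independent crossings and that two disjoint triangles cross an even number of times.  Together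
    with the exclusion of Pattern (I) these force, by a finite search, that the crossed edges of a K7 connect all its
    vertices; hence each thick edge contains a path that no edge away from the K7 can cross.  Parity then forces [uc]
    to cross [0a], [ab] and [ad], and [ud] to cross [0b], [ab] and [bc], with [0a] before [ab] on [uc].  By the
    absence of Patterns (II) and (III), [a] lies outside the closed curve formed by [uc], [ab] and [ud], so that [0],
    which is separated from [a] by one crossing, lies inside.  The thick edges through [0] then place the closed curve
    of each side inside that of the other, which is absurd. *)

Set Implicit Arguments.
Unset Strict Implicit.
Unset Printing Implicit Defensive.

Import Order.TTheory GRing.Theory Num.Theory.
Import numFieldNormedType.Exports.

Local Open Scope classical_set_scope.
Local Open Scope ring_scope.

Lemma addb_xorb b c : b (+) c = xorb b c.
Proof. by case: b; case: c. Qed.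

Ltac xor_ring := rewrite ?addb_xorb; btauto.

Lemma xor_cancel h x y : h = false -> x (+) h = y -> x = y.
Proof. by move=> ->; rewrite addbF. Qed.

Section WithinContinuity.
Variable R : realType.
Implicit Types T U V : topologicalType.

Lemma within_continuousP T U (D : set T) (f : T -> U) :
  {within D, continuous f} <-> forall p, D p -> f @ within D (nbhs p) --> f p.
Proof. exact: subspace_continuousP. Qed.

Lemma within_continuous_near T U (D : set T) (f : T -> U) p (A : set U) :
  {within D, continuous f} -> D p -> nbhs (f p) A ->
  \forall q \near p, D q -> A (f q).
Proof. by move=> /within_continuousP cf Dp /(cf p Dp). Qed.

Lemma within_continuous_compose T U V (D : set T) (E : set U) (f : T -> U) (g : U -> V) :
  (forall p, D p -> E (f p)) -> {within D, continuous f} -> {within E, continuous g} ->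
  {within D, continuous (fun p => g (f p))}.
Proof.
move=> DE cf /within_continuousP cg; apply/within_continuousP => p Dp A gA.
have := within_continuous_near cf Dp (cg (f p) (DE p Dp) A gA).
by apply: filterS => q fq Dq; apply: fq => //; exact: DE.
Qed.

Lemma within_continuous_cst T U (D : set T) (u : U) : {within D, continuous (fun=> u)}.
Proof. by move=> p; exact: cvg_cst. Qed.

Lemma within_continuous_id T (D : set T) : {within D, continuous id}.
Proof. by apply: continuous_subspaceT => p; exact: cvg_id. Qed.

Lemma within_continuous_fst T U V (D : set T) (f : T -> U * V) :
  {within D, continuous f} -> {within D, continuous (fun p => (f p).1)}.
Proof. by move=> cf p; apply: cvg_comp (cf p) _; exact: cvg_fst. Qed.

Lemma within_continuous_snd T U V (D : set T) (f : T -> U * V) :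
  {within D, continuous f} -> {within D, continuous (fun p => (f p).2)}.
Proof. by move=> cf p; apply: cvg_comp (cf p) _; exact: cvg_snd. Qed.

Lemma within_continuous_pair T U V (D : set T) (f : T -> U) (g : T -> V) :
  {within D, continuous f} -> {within D, continuous g} ->
  {within D, continuous (fun p => (f p, g p))}.
Proof.
move=> cf cg p.
by apply: (@cvg_pair _ _ _ _ (nbhs (f p)) (nbhs (g p))); [exact: cf|exact: cg].
Qed.

Lemma within_continuousN T (V : normedModType R) (D : set T) (f : T -> V) :
  {within D, continuous f} -> {within D, continuous (fun p => - f p)}.
Proof. by move=> cf p; apply: cvgN; exact: cf. Qed.

Lemma within_continuousM T (D : set T) (f g : T -> R) :
  {within D, continuous f} -> {within D, continuous g} ->
  {within D, continuous (fun p => f p * g p)}.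
Proof. by move=> cf cg p; apply: cvgM; [exact: cf|exact: cg]. Qed.

Lemma within_continuousZ T (V : normedModType R) (D : set T) (f : T -> R) (g : T -> V) :
  {within D, continuous f} -> {within D, continuous g} ->
  {within D, continuous (fun p => f p *: g p)}.
Proof. by move=> cf cg p; apply: cvgZ; [exact: cf|exact: cg]. Qed.

End WithinContinuity.

(** * Parity of plane paths *)

Section Cousin.
Variable R : realType.
Implicit Types a b c d e s t x y : R.

Definition near_subinterval a b x e s t : Prop :=
  [/\ a <= s <= x, x <= t <= b, x - e < s & t < x + e].

Lemma interval_gluing (Q : R -> R -> Prop) a b : a <= b ->
  (forall x, a <= x <= b ->
     exists2 e, 0 < e & forall s t, near_subinterval a b x e s t -> Q s t) ->
  (forall s m t, a <= s <= m -> m <= t <= b -> Q s m -> Q m t -> Q s t) ->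
  Q a b.
Proof.
move=> ab loc glue.
pose S := [set t | a <= t <= b /\ Q a t].
have Sb : ubound S b by move=> t [/andP[]].
have Sa : S a.
  split; first by rewrite lexx.
  have [|e e0] := loc a; first by rewrite lexx.
  by apply; split; rewrite ?lexx //; lra.
have am : a <= sup S by apply: ub_le_sup => //; exists b.
have mb : sup S <= b by apply: ge_sup => //; exists a.
have [|e e0 H] := loc (sup S); first by rewrite am.
have [|t St tm] := sup_adherent e0 (E := S); first by split; [exists a|exists b].
have tS : t <= sup S by apply: ub_le_sup => //; exists b.
have [/andP[at_ tb] Qat] := St.
pose m := Num.min b (sup S + e / 2).
have [Sm mb' me] : [/\ sup S <= m, m <= b & m < sup S + e].
  by rewrite /m le_min ge_min gt_min lexx mb; split=> //; [lra|apply/orP; right; lra].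
have Qam : Q a m.
  apply: (glue a t m) Qat _; [lra|lra|].
  by apply: H; split=> //; lra.
have : m <= sup S by apply: ub_le_sup; [exists b|split=> //; rewrite (le_trans am Sm)].
rewrite ge_min => /orP[bS|]; last by move=> ?; lra.
suff -> : b = m by [].
by apply/eqP; rewrite eq_le mb' (le_trans bS Sm).
Qed.

Lemma rectangle_gluing (Q : R -> R -> R -> R -> Prop) a b c d : a <= b -> c <= d ->
  (forall x y, a <= x <= b -> c <= y <= d -> exists2 e, 0 < e & forall s s' t t',
     near_subinterval a b x e s s' -> near_subinterval c d y e t t' -> Q s s' t t') ->
  (forall s m s' t t', a <= s <= m -> m <= s' <= b -> c <= t <= t' -> t' <= d ->
     Q s m t t' -> Q m s' t t' -> Q s s' t t') ->
  (forall s s' t m t', a <= s <= s' -> s' <= b -> c <= t <= m -> m <= t' <= d ->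
     Q s s' t m -> Q s s' m t' -> Q s s' t t') ->
  Q a b c d.
Proof.
move=> ab cd loc glue1 glue2.
apply: (interval_gluing (Q := fun s s' => Q s s' c d)) => //; last first.
  by move=> s m s' ? ?; apply: glue1; rewrite ?lexx.
move=> x xI; apply: (interval_gluing (Q := fun t t' => exists2 e, 0 < e &
  forall s s', near_subinterval a b x e s s' -> Q s s' t t')) => //.
  move=> y yI; have [e e0 H] := loc x y xI yI.
  by exists e => // t t' tt'; exists e => // s s' ss'; exact: H.
move=> t m t' tm mt' [e1 e10 H1] [e2 e20 H2].
have [le1 le2] : Num.min e1 e2 <= e1 /\ Num.min e1 e2 <= e2 by rewrite !ge_min !lexx orbT.
exists (Num.min e1 e2); first by rewrite lt_min e10.
move=> s s' [sx xs' es es']; apply: (glue2 s s' t m t') => //.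
- by lra.
- by lra.
- by apply: H1; split=> //; lra.
- by apply: H2; split=> //; lra.
Qed.

Lemma near_interval (P : R -> Prop) x : (\forall t \near x, P t) ->
  exists2 e, 0 < e & forall t, x - e < t < x + e -> P t.
Proof.
move=> /nbhs_ballP[e /= e0 H]; exists e => // t tI; apply: H.
by rewrite /ball /= ltr_norml; lra.
Qed.

End Cousin.

Section PathParity.
Variable R : realType.
Local Notation plane := (plane R).
Implicit Types (z w : plane) (a b c d s t : R) (g : R -> plane) (sheet : R -> bool).

Definition upper z : bool := (0 < z.2) || ((z.2 == 0) && (0 < z.1)).

(* Whether the segment from [z] to [w] crosses the negative axis, when [`|z - w| < `|z|]. *)
Definition crosses_cut z w : bool := (upper z (+) upper w) && (z.1 < 0).

Lemma upperN z : z != 0 -> upper (- z) = ~~ upper z.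
Proof.
case: z => x y; rewrite /upper /= => nz.
rewrite oppr_gt0 oppr_eq0 oppr_gt0.
have [//|//|y0] := ltgtP y 0.
have [//|//|x0] := ltgtP x 0.
by move: nz; rewrite x0 y0 eqxx.
Qed.

Lemma ltr_dist_mulr_gt0 (x y : R) : `|x - y| < `|x| -> 0 < x * y.
Proof.
have [x0|x0|->] := ltgtP x 0; last by rewrite normr0 normr_lt0.
- by rewrite (ltr0_norm x0) ltr_norml nmulr_rgt0 // => /andP[]; lra.
- by rewrite (gtr0_norm x0) ltr_norml pmulr_rgt0 // => /andP[]; lra.
Qed.

Lemma upper_neq_close z w : `|z - w| < `|z| -> upper z != upper w ->
  z.1 != 0 /\ (z.1 < 0) = (w.1 < 0).
Proof.
case: z w => [x y] [x' y']; rewrite !prod_normE /= => zw uzw.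
have {zw} : `|x - x'| < `|x|.
  have [xy|yx] := leP `|x| `|y|; last by move: zw; rewrite (max_l (ltW yx)) gt_max => /andP[].
  move: zw; rewrite (max_r xy) gt_max => /andP[_ /ltr_dist_mulr_gt0 yy'].
  move: uzw; rewrite /upper /=.
  by have [y0|y0|y0] := ltgtP y 0; have [y1|y1|y1] := ltgtP y' 0 => //; move: yy'; nra.
move=> /ltr_dist_mulr_gt0.
by have [x0|x0|->] := ltgtP x 0; have [x1|x1|x1] := ltgtP x' 0 => //; nra.
Qed.

Lemma crosses_cut_cocycle z w v :
  `|z - w| < `|z| -> `|z - v| < `|z| -> `|w - v| < `|w| ->
  crosses_cut z w (+) crosses_cut z v = crosses_cut w v.
Proof.
move=> /upper_neq_close + /upper_neq_close + /upper_neq_close; rewrite /crosses_cut.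
case: (upper z); case: (upper w); case: (upper v) => //=.
- by move=> _ /(_ isT)[_ ->] /(_ isT)[_ ->].
- by move=> /(_ isT)[_ ->] _ /(_ isT)[_ ->]; rewrite addbF.
- by move=> /(_ isT)[_ ->] /(_ isT)[_ <-]; rewrite addbb.
- by move=> /(_ isT)[_ ->] /(_ isT)[_ <-]; rewrite addbb.
- by move=> /(_ isT)[_ ->] _ /(_ isT)[_ ->]; rewrite addbF.
- by move=> _ /(_ isT)[_ ->] /(_ isT)[_ ->].
Qed.

Lemma crosses_cutN z w : z != 0 -> w != 0 -> `|z - w| < `|z| ->
  crosses_cut (- z) (- w) = crosses_cut z w (+) upper z (+) upper w.
Proof.
move=> z0 w0 /upper_neq_close; rewrite /crosses_cut !upperN // oppr_lt0.
by case: (upper z) (upper w) => [] [] //= /(_ isT)[+ _]; case: (ltgtP z.1 0).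
Qed.

Definition nonvanishing (T : topologicalType) (D : set T) (F : T -> plane) : Prop :=
  {within D, continuous F} /\ forall p, D p -> F p != 0.

Section Nonvanishing.
Variables (T U : topologicalType).
Implicit Types (D : set T) (F : T -> plane).

Lemma nonvanishing_sub D (E : set T) F : D `<=` E -> nonvanishing E F -> nonvanishing D F.
Proof.
by move=> DE [cF nF]; split; [exact: continuous_subspaceW cF|move=> p /DE/nF].
Qed.

Lemma nonvanishing_compose D (E : set U) (f : T -> U) (F : U -> plane) :
  (forall p, D p -> E (f p)) -> {within D, continuous f} -> nonvanishing E F ->
  nonvanishing D (fun p => F (f p)).
Proof.
move=> DE cf [cF nF]; split; first exact: within_continuous_compose cf cF.
by move=> p /DE/nF.
Qed.

Lemma nonvanishingN D F : nonvanishing D F -> nonvanishing D (fun p => - F p).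
Proof.
by move=> [cF nF]; split; [exact: within_continuousN|move=> p /nF; rewrite oppr_eq0].
Qed.

Lemma nonvanishing_near D F p : nonvanishing D F -> D p ->
  \forall q \near p, D q -> `|F p - F q| < `|F p|.
Proof.
move=> [cF nF] Dp.
apply: (within_continuous_near (A := [set w | `|F p - w| < `|F p|]) cF Dp).
have Fp0 : 0 < `|F p| by rewrite normr_gt0 nF.
by have := nbhsx_ballx (F p) _ Fp0; rewrite -ball_normE.
Qed.

End Nonvanishing.

(* A lift to the double cover of the punctured plane, cut along the negative axis. *)
Definition lift g a b sheet : Prop :=
  forall t, a <= t <= b -> \forall t' \near t, a <= t' <= b ->
    sheet t (+) sheet t' = crosses_cut (g t) (g t').

Lemma lift_sub g a b c d sheet : lift g a b sheet -> a <= c -> d <= b -> lift g c d sheet.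
Proof.
move=> L ac db t tI; have /L : a <= t <= b by lra.
by apply: filterS => s H sI; apply: H; lra.
Qed.

Lemma lift_unique g a b sheet sheet' : a <= b -> lift g a b sheet -> lift g a b sheet' ->
  sheet a (+) sheet b = sheet' a (+) sheet' b.
Proof.
move=> ab L L'.
suff : sheet a (+) sheet' a = sheet b (+) sheet' b.
  by case: (sheet a) (sheet' a) (sheet b) (sheet' b) => [] [] [] [].
apply: (interval_gluing (Q := fun s t => sheet s (+) sheet' s = sheet t (+) sheet' t)) => //.
  move=> x xI; have [e e0 H] := near_interval (filterI (L x xI) (L' x xI)).
  exists e => // s t [sx xt es et].
  suff agree r : a <= r <= b -> x - e < r < x + e -> sheet x (+) sheet' x = sheet r (+) sheet' r.
    by rewrite -agree -?agree //; lra.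
  move=> rI /H[/(_ rI) + /(_ rI) L'r]; rewrite -L'r.
  by case: (sheet x) (sheet' x) (sheet r) (sheet' r) => [] [] [] [].
by move=> s m t _ _ -> ->.
Qed.

Lemma lift_close g a b c d z : nonvanishing `[a, b] g -> a <= c -> d <= b ->
  (forall t, c <= t <= d -> `|z - g t| < `|z|) -> lift g c d (fun t => crosses_cut z (g t)).
Proof.
move=> ng ac db zg t tI; have tab : a <= t <= b by lra.
apply: filterS (nonvanishing_near ng tab) => s gts sI.
apply: crosses_cut_cocycle; [exact: zg|exact: zg|].
by apply: gts; change (is_true (a <= s <= b)); lra.
Qed.

Lemma lift_cat g a m b sheet sheet' : lift g a m sheet -> lift g m b sheet' ->
  lift g a b (fun t => if t <= m then sheet t else sheet m (+) sheet' m (+) sheet' t).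
Proof.
move=> L L' t /andP[at_ tb]; have [tm|mt|tm] := ltgtP t m.
- have tI : a <= t <= m by rewrite at_ ltW.
  apply: filterS2 (lt_nbhsl tm) (L t tI) => r rm H /andP[ar _].
  by rewrite (ltW rm) H // ar ltW.
- have tI : m <= t <= b by rewrite tb ltW.
  apply: filterS2 (lt_nbhsr mt) (L' t tI) => r mr H /andP[_ rb].
  by rewrite leNgt mr /= -H ?(ltW mr) //; xor_ring.
- have tI : a <= t <= m by rewrite at_ tm lexx.
  have tI' : m <= t <= b by rewrite tb tm lexx.
  apply: filterS2 (L t tI) (L' t tI') => r H H' /andP[ar rb].
  have [rm|mr] := leP r m; first by rewrite H ?ar.
  by rewrite -H' ?(ltW mr) // tm; xor_ring.
Qed.

Lemma lift_exists g a b : a <= b -> nonvanishing `[a, b] g -> exists sheet, lift g a b sheet.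
Proof.
move=> ab ng; apply: (interval_gluing (Q := fun s t => exists sheet, lift g s t sheet)) => //.
  move=> x xI; have [e e0 H] := near_interval (nonvanishing_near ng xI).
  exists e => // s t [sx xt es et]; exists (fun t => crosses_cut (g x) (g t)).
  apply: (lift_close ng); [lra|lra|move=> r rI].
  by apply: H; [lra|change (is_true (a <= r <= b)); lra].
by move=> s m t _ _ [sheet L] [sheet' L']; eexists; exact: lift_cat L L'.
Qed.

(* The number of times, mod 2, that the path [g] crosses the negative axis. *)
Definition path_parity g a b : bool :=
  `[< exists sheet, lift g a b sheet /\ sheet a (+) sheet b >].

Lemma path_parityE g a b sheet : a <= b -> lift g a b sheet ->
  path_parity g a b = sheet a (+) sheet b.
Proof.
move=> ab L; apply/asboolP/idP => [[sheet' [L' H]]|H]; last by exists sheet.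
by rewrite (lift_unique ab L L').
Qed.

Lemma path_parity_cat g a m b : a <= m -> m <= b -> nonvanishing `[a, b] g ->
  path_parity g a b = path_parity g a m (+) path_parity g m b.
Proof.
move=> am mb ng; have ab := le_trans am mb; have [sheet L] := lift_exists ab ng.
rewrite (path_parityE ab L) (path_parityE am (lift_sub L (lexx _) mb)).
by rewrite (path_parityE mb (lift_sub L am (lexx _))); xor_ring.
Qed.

Lemma eq_path_parity g g' a b : (forall t, a <= t <= b -> g t = g' t) ->
  path_parity g a b = path_parity g' a b.
Proof.
have ext h h' sheet : (forall t, a <= t <= b -> h t = h' t) -> lift h a b sheet -> lift h' a b sheet.
  move=> E L t tI; apply: filterS (L t tI) => s H sI.
  by rewrite -!E // H.
move=> E; apply/asboolP/asboolP => -[sheet [L H]]; exists sheet; split=> //.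
  exact: ext L.
by apply: ext L => t /E.
Qed.

Lemma path_parityN g a b : a <= b -> nonvanishing `[a, b] g ->
  path_parity (fun t => - g t) a b = path_parity g a b (+) upper (g a) (+) upper (g b).
Proof.
move=> ab ng; have [sheet L] := lift_exists ab ng.
rewrite (path_parityE ab L) (path_parityE (sheet := fun t => sheet t (+) upper (g t)) ab).
  by xor_ring.
move=> t tI; apply: filterS2 (L t tI) (nonvanishing_near ng tI) => s H gts sI.
by rewrite crosses_cutN ?(ng.2 _ tI) ?(ng.2 _ sI) ?gts // -H //; xor_ring.
Qed.

Lemma path_parity_rev g a b : a <= b -> nonvanishing `[a, b] g ->
  path_parity (fun t => g (a + b - t)) a b = path_parity g a b.
Proof.
move=> ab ng; have [sheet L] := lift_exists ab ng.
rewrite (path_parityE ab L) (path_parityE (sheet := fun t => sheet (a + b - t)) ab).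
  by rewrite addrAC subrr add0r addrK addbC.
move=> t tI; have /L/near_interval[e e0 H] : a <= a + b - t <= b by lra.
apply/nbhs_ballP; exists e => //= s; rewrite /ball /= ltr_norml => st sI.
by apply: H; lra.
Qed.

Lemma path_parity_cst z a b : a <= b -> path_parity (fun=> z) a b = false.
Proof.
move=> ab; rewrite (path_parityE (sheet := fun=> false) ab) // => t _.
by apply/nbhs_ballP; exists 1 => //= s _ _; rewrite /crosses_cut addbb.
Qed.

Lemma path_parity_right_half g a b : a <= b -> (forall t, a <= t <= b -> 0 <= (g t).1) ->
  path_parity g a b = false.
Proof.
move=> ab H; rewrite (path_parityE (sheet := fun=> false) ab) // => t tI.
by apply/nbhs_ballP; exists 1 => //= s _ _; rewrite /crosses_cut ltNge H ?andbF.
Qed.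

Definition rectangle a b c d : set (R * R) := `[a, b] `*` `[c, d].

Definition boundary_parity (F : R * R -> plane) a b c d : bool :=
  path_parity (fun s => F (s, c)) a b (+) path_parity (fun s => F (s, d)) a b (+)
  path_parity (fun t => F (a, t)) c d (+) path_parity (fun t => F (b, t)) c d.

Lemma eq_boundary_parity F F' a b c d : a <= b -> c <= d ->
  (forall s t, a <= s <= b -> c <= t <= d -> F (s, t) = F' (s, t)) ->
  boundary_parity F a b c d = boundary_parity F' a b c d.
Proof.
move=> ab cd E; congr (_ (+) _ (+) _ (+) _); apply: eq_path_parity => r rI; apply: E => //.
all: by rewrite lexx ?ab ?cd.
Qed.

Lemma nonvanishing_row F a b c d t : c <= t <= d -> nonvanishing (rectangle a b c d) F ->
  nonvanishing `[a, b] (fun s => F (s, t)).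
Proof.
move=> tI; apply: (nonvanishing_compose (f := fun s => (s, t))); first by [].
by apply: within_continuous_pair; [exact: within_continuous_id|exact: within_continuous_cst].
Qed.

Lemma nonvanishing_column F a b c d s : a <= s <= b -> nonvanishing (rectangle a b c d) F ->
  nonvanishing `[c, d] (fun t => F (s, t)).
Proof.
move=> sI; apply: (nonvanishing_compose (f := fun t => (s, t))); first by [].
by apply: within_continuous_pair; [exact: within_continuous_cst|exact: within_continuous_id].
Qed.

Lemma boundary_parity_cat_row F a m b c d : a <= m -> m <= b ->
  nonvanishing `[a, b] (fun s => F (s, c)) -> nonvanishing `[a, b] (fun s => F (s, d)) ->
  boundary_parity F a b c d = boundary_parity F a m c d (+) boundary_parity F m b c d.
Proof.
move=> am mb Fc Fd.
by rewrite /boundary_parity (path_parity_cat am mb Fc) (path_parity_cat am mb Fd); xor_ring.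
Qed.

Lemma boundary_parity_cat_column F a b c m d : c <= m -> m <= d ->
  nonvanishing `[c, d] (fun t => F (a, t)) -> nonvanishing `[c, d] (fun t => F (b, t)) ->
  boundary_parity F a b c d = boundary_parity F a b c m (+) boundary_parity F a b m d.
Proof.
move=> cm md Fa Fb.
by rewrite /boundary_parity (path_parity_cat cm md Fa) (path_parity_cat cm md Fb); xor_ring.
Qed.

Lemma boundary_parity_close F a b c d z : a <= b -> c <= d ->
  nonvanishing (rectangle a b c d) F ->
  (forall s t, a <= s <= b -> c <= t <= d -> `|z - F (s, t)| < `|z|) ->
  boundary_parity F a b c d = false.
Proof.
move=> ab cd nF zF.
have aI : a <= a <= b by rewrite lexx.
have bI : a <= b <= b by rewrite lexx ab.
have cI : c <= c <= d by rewrite lexx.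
have dI : c <= d <= d by rewrite lexx cd.
have row t (tI : c <= t <= d) :=
  lift_close (nonvanishing_row tI nF) (lexx a) (lexx b) (fun s sI => zF s t sI tI).
have column s (sI : a <= s <= b) :=
  lift_close (nonvanishing_column sI nF) (lexx c) (lexx d) (fun t tI => zF s t sI tI).
rewrite /boundary_parity (path_parityE ab (row c cI)) (path_parityE ab (row d dI)).
by rewrite (path_parityE cd (column a aI)) (path_parityE cd (column b bI)); xor_ring.
Qed.

Lemma boundary_parity_eq0 F a b c d : a <= b -> c <= d ->
  nonvanishing (rectangle a b c d) F -> boundary_parity F a b c d = false.
Proof.
move=> ab cd nF.
have sub s s' t t' : a <= s -> s' <= b -> c <= t -> t' <= d ->
    nonvanishing (rectangle s s' t t') F.
  move=> ? ? ? ?; apply: nonvanishing_sub nF => -[x y] [/=].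
  by rewrite !in_itv /= => ? ?; split; rewrite /= in_itv /=; lra.
apply: (rectangle_gluing (Q := fun s s' t t' => boundary_parity F s s' t t' = false)) => //.
- move=> x y xI yI; have /nbhs_ballP[e /= e0 H] := nonvanishing_near nF (conj xI yI : _ (x, y)).
  exists e => // s s' t t' [sx xs' es es'] [ty yt' et et'].
  apply: (boundary_parity_close (z := F (x, y))); [lra|lra|apply: sub; lra|].
  move=> q r qI rI; apply: H; first by split; rewrite /ball /= ltr_norml; lra.
  by split; rewrite /= in_itv /=; lra.
- move=> s m s' t t' /andP[as_ sm] /andP[ms' s'b] /andP[ct tt'] t'd H H'.
  have nF' := sub s s' t t' as_ s'b ct t'd.
  rewrite (boundary_parity_cat_row sm ms') ?H ?H' //.
  + by apply: nonvanishing_row nF'; rewrite lexx.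
  + by apply: nonvanishing_row nF'; rewrite lexx tt'.
- move=> s s' t m t' /andP[as_ ss'] s'b /andP[ct tm] /andP[mt' t'd] H H'.
  have nF' := sub s s' t t' as_ s'b ct t'd.
  rewrite (boundary_parity_cat_column tm mt') ?H ?H' //.
  + by apply: nonvanishing_column nF'; rewrite lexx.
  + by apply: nonvanishing_column nF'; rewrite lexx ss'.
Qed.

Lemma boundary_parity_homotopy (H : R -> R * R -> plane) a b c d : a <= b -> c <= d ->
  nonvanishing (rectangle 0 1 a b) (fun p => H p.1 (p.2, c)) ->
  nonvanishing (rectangle 0 1 a b) (fun p => H p.1 (p.2, d)) ->
  nonvanishing (rectangle 0 1 c d) (fun p => H p.1 (a, p.2)) ->
  nonvanishing (rectangle 0 1 c d) (fun p => H p.1 (b, p.2)) ->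
  boundary_parity (H 0) a b c d = boundary_parity (H 1) a b c d.
Proof.
have l01 : 0 <= 1 :> R := ler01.
move=> ab cd /(boundary_parity_eq0 l01 ab) + /(boundary_parity_eq0 l01 ab) +
  /(boundary_parity_eq0 l01 cd) + /(boundary_parity_eq0 l01 cd).
rewrite /boundary_parity /= => bottom top left right.
by apply: (xor_cancel bottom); apply: (xor_cancel top); apply: (xor_cancel left);
  apply: (xor_cancel right); xor_ring.
Qed.

Lemma boundary_parity_odd F a b c d : a <= b -> c <= d ->
  (forall s t, F (a + b - s, c + d - t) = - F (s, t)) ->
  nonvanishing `[a, b] (fun s => F (s, c)) -> nonvanishing `[c, d] (fun t => F (a, t)) ->
  boundary_parity F a b c d = true.
Proof.
move=> ab cd oddF Fc Fa.
have top : path_parity (fun s => F (s, d)) a b =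
    path_parity (fun s => F (s, c)) a b (+) upper (F (a, c)) (+) upper (F (b, c)).
  rewrite -path_parityN // -[RHS]path_parity_rev //; last exact: nonvanishingN.
  by apply: eq_path_parity => s _; rewrite -oddF subKr addrAC subrr add0r.
have right : path_parity (fun t => F (b, t)) c d =
    path_parity (fun t => F (a, t)) c d (+) upper (F (a, c)) (+) upper (F (a, d)).
  rewrite -path_parityN // -[RHS]path_parity_rev //; last exact: nonvanishingN.
  by apply: eq_path_parity => t _; rewrite -oddF subKr addrAC subrr add0r.
have corner : upper (F (b, c)) = ~~ upper (F (a, d)).
  rewrite -upperN; last by apply: Fa.2; change (is_true (c <= d <= d)); rewrite lexx cd.
  by rewrite -oddF addrAC subrr add0r addrK.
by rewrite /boundary_parity top right corner; xor_ring.
Qed.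

End PathParity.

(** * Crossing numbers mod 2 *)

Record piece (R : realType) := Piece { trace :> R -> plane R; tmin : R; tmax : R }.

HB.instance Definition _ (R : realType) := gen_eqMixin (piece R).
HB.instance Definition _ (R : realType) := gen_choiceMixin (piece R).

Section Pieces.
Variable R : realType.
Local Notation plane := (plane R).
Implicit Types (p q : piece R) (x y z : plane) (a b c d s t u : R).

Definition source p : plane := p (tmin p).
Definition target p : plane := p (tmax p).
Definition piece_image p : set plane := p @` `[tmin p, tmax p].
Definition valid_piece p : Prop :=
  tmin p <= tmax p /\ {within `[tmin p, tmax p], continuous p}.

Lemma mem_piece_image p t : tmin p <= t <= tmax p -> piece_image p (p t).
Proof. by move=> tI; exists t. Qed.

Lemma piece_imageP p z : piece_image p z -> exists2 t, tmin p <= t <= tmax p & z = p t.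
Proof. by move=> [t tI <-]; exists t. Qed.

Lemma source_in_image p : valid_piece p -> piece_image p (source p).
Proof. by move=> [st _]; apply: mem_piece_image; rewrite lexx. Qed.

Lemma target_in_image p : valid_piece p -> piece_image p (target p).
Proof. by move=> [st _]; apply: mem_piece_image; rewrite lexx st. Qed.

Lemma valid_subpiece p a b : valid_piece p -> tmin p <= a -> a <= b -> b <= tmax p ->
  valid_piece (Piece p a b).
Proof.
move=> [_ cp] pa ab bp; split=> //; apply: continuous_subspaceW cp => t.
by rewrite /= !in_itv /=; lra.
Qed.

Definition winding p z : bool := path_parity (fun t => z - p t) (tmin p) (tmax p).

Definition crossing_parity p q : bool :=
  boundary_parity (fun st => p st.1 - q st.2) (tmin p) (tmax p) (tmin q) (tmax q).

Definition above x y : bool := upper (x - y).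

Lemma aboveN x y : x != y -> above y x = ~~ above x y.
Proof. by move=> xy; rewrite /above -opprB upperN // subr_eq0. Qed.

Lemma nonvanishing_rsub p z : valid_piece p -> ~ piece_image p z ->
  nonvanishing `[tmin p, tmax p] (fun t => z - p t).
Proof.
move=> [_ cp] nz; split.
  by apply: within_continuousD; [exact: within_continuous_cst|exact: within_continuousN].
by move=> t tI; rewrite subr_eq0; apply/eqP => E; apply: nz; exists t.
Qed.

Lemma nonvanishing_subr p z : valid_piece p -> ~ piece_image p z ->
  nonvanishing `[tmin p, tmax p] (fun t => p t - z).
Proof.
move=> vp nz; have := nonvanishingN (nonvanishing_rsub vp nz).
by congr nonvanishing; apply/funext => t; rewrite opprB.
Qed.

Lemma crossing_parity_disjoint p q : valid_piece p -> valid_piece q ->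
  (forall z, piece_image p z -> ~ piece_image q z) -> crossing_parity p q = false.
Proof.
move=> [vp cp] [vq cq] disj; apply: boundary_parity_eq0 => //; split.
  apply: within_continuousD; last apply: within_continuousN.
    apply: within_continuous_compose cp => [st []//|].
    by apply: within_continuous_fst; exact: within_continuous_id.
  apply: within_continuous_compose cq => [st []//|].
  by apply: within_continuous_snd; exact: within_continuous_id.
move=> [s t] [/= sI tI]; rewrite subr_eq0; apply/eqP => E; apply: (disj (p s)); first exact: mem_piece_image.
by rewrite E; exact: mem_piece_image.
Qed.

Lemma crossing_parity_star p q : valid_piece p ->
  ~ piece_image p (source q) -> ~ piece_image p (target q) ->
  crossing_parity p q =
    winding q (source p) (+) winding q (target p) (+) winding p (source q) (+) winding p (target q) (+)
    (above (source q) (source p) (+) above (source q) (target p) (+)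
     above (target q) (source p) (+) above (target q) (target p)).
Proof.
move=> vp ns nt.
have flip z : ~ piece_image p z -> path_parity (fun s => p s - z) (tmin p) (tmax p) =
    winding p z (+) above z (source p) (+) above z (target p).
  move=> nz; rewrite -(path_parityN vp.1 (nonvanishing_rsub vp nz)).
  by apply: eq_path_parity => s _; rewrite opprB.
rewrite /crossing_parity /boundary_parity /= (flip (source q)) // (flip (target q)) //.
by rewrite /winding /source /target; xor_ring.
Qed.

Lemma crossing_parityC p q : valid_piece p -> valid_piece q ->
  ~ piece_image p (source q) -> ~ piece_image p (target q) ->
  ~ piece_image q (source p) -> ~ piece_image q (target p) ->
  crossing_parity p q = crossing_parity q p.
Proof.
move=> vp vq ps pt qs qt; rewrite !crossing_parity_star //.
have flip x y : piece_image p x -> ~ piece_image p y -> above y x = ~~ above x y.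
  by move=> px py; rewrite aboveN //; apply: contra_not_neq py => <-.
have [p_source p_target] := (source_in_image vp, target_in_image vp).
rewrite (flip (source p) (source q)) // (flip (target p) (source q)) //.
by rewrite (flip (source p) (target q)) // (flip (target p) (target q)) //; xor_ring.
Qed.

Lemma crossing_parity_trim p q s1 s2 : valid_piece p -> valid_piece q ->
  tmin p <= s1 -> s1 <= s2 -> s2 <= tmax p ->
  (forall s t, tmin p <= s <= tmax p -> tmin q <= t <= tmax q -> p s = q t ->
     s1 < s < s2 /\ tmin q < t < tmax q) ->
  crossing_parity p q = crossing_parity (Piece p s1 s2) q.
Proof.
move=> vp vq ps1 s12 s2p meet.
have outside a b : tmin p <= a -> a <= b -> b <= tmax p -> (b <= s1) || (s2 <= a) ->
    crossing_parity (Piece p a b) q = false.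
  move=> pa ab bp out; apply: crossing_parity_disjoint => //; first exact: valid_subpiece.
  move=> z /piece_imageP[s /= sI ->] /piece_imageP[t tI E].
  have [|] := meet s t _ tI E; first by lra.
  by case/orP: out; lra.
have row a : tmin p <= a -> a <= tmax p -> nonvanishing `[a, tmax p] (fun s => p s - source q)
    /\ nonvanishing `[a, tmax p] (fun s => p s - target q).
  move=> pa ap; have va := valid_subpiece vp pa ap (lexx _).
  split; apply: (nonvanishing_subr va) => /piece_imageP[s /= sI /esym E].
    by have [||_] := meet s (tmin q) _ _ E; rewrite ?lexx ?vq.1 ?ltxx //; lra.
  by have [||_] := meet s (tmax q) _ _ E; rewrite ?lexx ?vq.1 ?ltxx ?andbF //; lra.
have [src tgt] := row (tmin p) (lexx _) vp.1.
have [src1 tgt1] := row s1 ps1 (le_trans s12 s2p).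
rewrite /crossing_parity (boundary_parity_cat_row ps1 (le_trans s12 s2p)) //.
rewrite (boundary_parity_cat_row s12 s2p) //.
rewrite -/(crossing_parity (Piece p (tmin p) s1) q) -/(crossing_parity (Piece p s2 (tmax p)) q).
by rewrite !outside ?lexx ?orbT ?addbF //; lra.
Qed.

Lemma crossing_parity_localize p q s1 s2 t1 t2 : valid_piece p -> valid_piece q ->
  tmin p < s1 -> s1 <= s2 -> s2 < tmax p -> tmin q < t1 -> t1 <= t2 -> t2 < tmax q ->
  (forall s t, tmin p <= s <= tmax p -> tmin q <= t <= tmax q -> p s = q t ->
     s1 < s < s2 /\ t1 < t < t2) ->
  crossing_parity p q = crossing_parity (Piece p s1 s2) (Piece q t1 t2).
Proof.
move=> vp vq ps1 s12 s2p qt1 t12 t2q meet.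
have vp' : valid_piece (Piece p s1 s2) by apply: valid_subpiece => //; lra.
have vq' : valid_piece (Piece q t1 t2) by apply: valid_subpiece => //; lra.
have off_p t : tmin q <= t <= tmax q -> ~~ (t1 < t < t2) -> ~ piece_image (Piece p s1 s2) (q t).
  move=> tI /negP nt /piece_imageP[s /= sI /esym E].
  by have [|_ ?] := meet s t _ tI E; [lra|].
have off_q s : tmin p <= s <= tmax p -> ~~ (s1 < s < s2) -> ~ piece_image q (p s).
  move=> sI /negP ns /piece_imageP[t tI E].
  by have [|? _] := meet s t _ tI E; [lra|].
have off_q' s : tmin p <= s <= tmax p -> ~~ (s1 < s < s2) -> ~ piece_image (Piece q t1 t2) (p s).
  move=> sI ns /piece_imageP[t /= tI E]; apply: (off_q s sI ns).
  by rewrite E; apply: mem_piece_image; lra.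
rewrite (crossing_parity_trim vp vq (s1 := s1) (s2 := s2)); [|lra..|]; last first.
  by move=> s t sI tI /(meet s t sI tI)[]; lra.
rewrite crossing_parityC //; rewrite ?/source ?/target /=.
2-5: by [apply: off_p; lra|apply: off_q; lra].
rewrite (crossing_parity_trim vq vp' (s1 := t1) (s2 := t2)) /=; [|lra..|]; last first.
  by move=> t s tI sI /esym E; have [|] := meet s t _ tI E; lra.
rewrite crossing_parityC //; rewrite ?/source ?/target /=.
all: by [apply: off_p; lra|apply: off_q'; lra].
Qed.

End Pieces.

Section AxesCrossing.
Variables (R : realType) (k : plane R -> plane R).
Local Notation plane := (plane R).
Local Notation unit_ball := (ball (0 : plane) 1).
Hypothesis k_continuous : {within unit_ball, continuous k}.
Hypothesis k_injective : forall z w, unit_ball z -> unit_ball w -> k z = k w -> z = w.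

Lemma unit_ballP (x y : R) : `|x| < 1 -> `|y| < 1 -> unit_ball (x, y).
Proof. by move=> x1 y1; split; rewrite /ball /= sub0r normrN. Qed.

Lemma nonvanishing_chart_difference (T : topologicalType) (D : set T) (x1 y1 x2 y2 : T -> R) :
  {within D, continuous x1} -> {within D, continuous y1} ->
  {within D, continuous x2} -> {within D, continuous y2} ->
  (forall p, D p -> [/\ `|x1 p| < 1, `|y1 p| < 1, `|x2 p| < 1 & `|y2 p| < 1]) ->
  (forall p, D p -> (x1 p != x2 p) || (y1 p != y2 p)) ->
  nonvanishing D (fun p => k (x1 p, y1 p) - k (x2 p, y2 p)).
Proof.
move=> cx1 cy1 cx2 cy2 small distinct; split.
  apply: within_continuousD; last apply: within_continuousN;
    apply: within_continuous_compose k_continuous => [p /small[*]|];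
    by [exact: unit_ballP|exact: within_continuous_pair].
move=> p Dp; rewrite subr_eq0; apply: contraL (distinct p Dp) => /eqP.
have [x1p y1p x2p y2p] := small p Dp.
move=> /(k_injective (unit_ballP x1p y1p) (unit_ballP x2p y2p)) [-> ->].
by rewrite !eqxx.
Qed.

Section Sides.
Variables (al be : R -> R) (a b c d : R).
Hypotheses (ab : a <= b) (cd : c <= d).
Hypothesis al_continuous : {within `[a, b], continuous al}.
Hypothesis be_continuous : {within `[c, d], continuous be}.
Hypothesis al_small : forall s, a <= s <= b -> `|al s| < 1.
Hypothesis be_small : forall t, c <= t <= d -> `|be t| < 1.

(* At [u = 1] the two chart points are exchanged by the symmetry of the rectangle about its centre. *)
Definition axes_homotopy (u : R) (st : R * R) : plane :=
  k ((1 - u / 2) * al st.1, u / 2 * be (c + d - st.2)) -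
  k (u / 2 * al (a + b - st.1), (1 - u / 2) * be st.2).

Lemma axes_homotopy_odd s t :
  axes_homotopy 1 (a + b - s, c + d - t) = - axes_homotopy 1 (s, t).
Proof.
have half : 1 - 1 / 2 = 1 / 2 :> R by field.
by rewrite /axes_homotopy /= [RHS]opprB !subKr half.
Qed.

Lemma nonvanishing_axes_homotopy (T : topologicalType) (D : set T) (u s t : T -> R) :
  {within D, continuous u} -> {within D, continuous s} -> {within D, continuous t} ->
  (forall p, D p -> [/\ 0 <= u p <= 1, a <= s p <= b & c <= t p <= d]) ->
  (forall p, D p -> (al (s p) * al (a + b - s p) < 0) || (be (t p) * be (c + d - t p) < 0)) ->
  nonvanishing D (fun p => axes_homotopy (u p) (s p, t p)).
Proof.
move=> cu cs ct range opposite.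
have c_half : {within D, continuous (fun p => u p / 2)}.
  by apply: within_continuousM => //; exact: within_continuous_cst.
have c_cohalf : {within D, continuous (fun p => 1 - u p / 2)}.
  by apply: within_continuousD; [exact: within_continuous_cst|exact: within_continuousN].
have c_opp (r : R) (f : T -> R) : {within D, continuous f} -> {within D, continuous (fun p => r - f p)}.
  by move=> cf; apply: within_continuousD; [exact: within_continuous_cst|exact: within_continuousN].
apply: nonvanishing_chart_difference.
- apply: within_continuousM => //; apply: within_continuous_compose al_continuous => // p Dp.
  by have [] := range p Dp.
- apply: within_continuousM => //; apply: within_continuous_compose be_continuous; last exact: c_opp.
  by move=> p Dp; have [_ _ tI] := range p Dp; rewrite /= in_itv /=; lra.
- apply: within_continuousM => //; apply: within_continuous_compose al_continuous; last exact: c_opp.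
  by move=> p Dp; have [_ sI _] := range p Dp; rewrite /= in_itv /=; lra.
- apply: within_continuousM => //; apply: within_continuous_compose be_continuous => // p Dp.
  by have [] := range p Dp.
- move=> p /range[uI sI tI].
  have shrink (r x : R) : 0 <= r <= 1 -> `|x| < 1 -> `|r * x| < 1.
    by move=> rI x1; rewrite normrM ger0_norm; have := normr_ge0 x; nra.
  by split=> /=; apply: shrink; by [lra|apply: al_small; lra|apply: be_small; lra].
- move=> p Dp; have [uI _ _] := range p Dp; rewrite /=.
  have neq (x y : R) : x * y < 0 -> (1 - u p / 2) * x != u p / 2 * y.
    move=> xy; apply/eqP => E; have : (1 - u p / 2) * (x * y) < 0 by rewrite pmulr_rlt0 //; lra.
    have -> : (1 - u p / 2) * (x * y) = u p / 2 * y ^+ 2 by rewrite mulrA E; ring.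
    by rewrite ltNge mulr_ge0 ?sqr_ge0 //; lra.
  by rewrite [_ * be _ == _]eq_sym; case/orP: (opposite p Dp) => /neq ->; rewrite ?orbT.
Qed.

Lemma crossing_parity_axes (e f : R -> plane) : al a * al b < 0 -> be c * be d < 0 ->
  (forall s, a <= s <= b -> e s = k (al s, 0)) ->
  (forall t, c <= t <= d -> f t = k (0, be t)) ->
  crossing_parity (Piece e a b) (Piece f c d) = true.
Proof.
move=> al_opp be_opp eE fE.
have -> : crossing_parity (Piece e a b) (Piece f c d) = boundary_parity (axes_homotopy 0) a b c d.
  apply: eq_boundary_parity => // s t sI tI; rewrite /axes_homotopy /= eE // fE //.
  by rewrite !mul0r subr0 !mul1r.
have [ra rb rc rd] : [/\ a + b - a = b, a + b - b = a, c + d - c = d & c + d - d = c].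
  by split; ring.
have aI : a <= a <= b by rewrite lexx.
have bI : a <= b <= b by rewrite lexx ab.
have cI : c <= c <= d by rewrite lexx.
have dI : c <= d <= d by rewrite lexx cd.
have cfst (D : set (R * R)) : {within D, continuous fst}.
  by apply: within_continuous_fst; exact: within_continuous_id.
have csnd (D : set (R * R)) : {within D, continuous snd}.
  by apply: within_continuous_snd; exact: within_continuous_id.
have row t : c <= t <= d -> be t * be (c + d - t) < 0 ->
    nonvanishing (rectangle 0 1 a b) (fun p => axes_homotopy p.1 (p.2, t)).
  move=> tI opp; apply: nonvanishing_axes_homotopy => //; first exact: within_continuous_cst.
    by move=> p [].
  by move=> p _; rewrite opp orbT.
have column s : a <= s <= b -> al s * al (a + b - s) < 0 ->
    nonvanishing (rectangle 0 1 c d) (fun p => axes_homotopy p.1 (s, p.2)).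
  move=> sI opp; apply: nonvanishing_axes_homotopy => //; first exact: within_continuous_cst.
    by move=> p [].
  by move=> p _; rewrite opp.
have bottom : nonvanishing (rectangle 0 1 a b) (fun p => axes_homotopy p.1 (p.2, c)).
  by apply: row; rewrite // rc.
have left : nonvanishing (rectangle 0 1 c d) (fun p => axes_homotopy p.1 (a, p.2)).
  by apply: column; rewrite // ra.
rewrite (boundary_parity_homotopy ab cd bottom _ left).
- apply: boundary_parity_odd => //; first exact: axes_homotopy_odd.
    by apply: nonvanishing_column bottom; rewrite ler01 lexx.
  by apply: nonvanishing_column left; rewrite ler01 lexx.
- by apply: row; rewrite // rd mulrC.
- by apply: column; rewrite // rb mulrC.
Qed.

End Sides.

End AxesCrossing.

Section ProperCrossing.
Variable R : realType.
Local Notation plane := (plane R).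
Local Notation unit_ball := (ball (0 : plane) 1).
Implicit Types (p q : piece R) (s t : R).

Lemma injective_sign_change (f : R -> R) (a x b : R) : a < x < b ->
  {within `[a, b], continuous f} -> {in `[a, b] &, injective f} -> f x = 0 -> f a * f b < 0.
Proof.
move=> /andP[ax xb] cf inj fx.
have aI : a \in `[a, b] by rewrite bound_itvE; lra.
have bI : b \in `[a, b] by rewrite bound_itvE; lra.
have xI : x \in `[a, b] by rewrite in_itv /=; lra.
have [mono|mono] := itv_continuous_inj_mono cf inj.
  by rewrite nmulr_rlt0 -fx; [exact: mono xb|exact: mono ax].
by rewrite pmulr_rlt0 -fx; [exact: mono xb|exact: mono ax].
Qed.

Definition injective_piece p : Prop := {in `[tmin p, tmax p] &, injective p}.

Lemma crossing_parity_chart p q s0 t0 (A B U : set plane) (h k : plane -> plane) :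
  valid_piece p -> valid_piece q -> injective_piece p -> injective_piece q ->
  tmin p < s0 < tmax p -> tmin q < t0 < tmax q -> h (p s0) = 0 -> h (q t0) = 0 ->
  homeomorphism U unit_ball h k ->
  (forall z, U z -> (A z <-> (h z).2 = 0) /\ (B z <-> (h z).1 = 0)) ->
  piece_image p `<=` U `&` A -> piece_image q `<=` U `&` B ->
  crossing_parity p q = true.
Proof.
move=> [vp cp] [vq cq] injp injq s0I t0I hp0 hq0 [hk kh ch ck] axes pUA qUB.
have hp s : tmin p <= s <= tmax p -> h (p s) = ((h (p s)).1, 0).
  move=> sI; have [Up /(axes _ Up).1] := pUA _ (mem_piece_image sI).
  by case: (h (p s)) => x y /= ->.
have hq t : tmin q <= t <= tmax q -> h (q t) = (0, (h (q t)).2).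
  move=> tI; have [Uq /(axes _ Uq).2] := qUB _ (mem_piece_image tI).
  by case: (h (q t)) => x y /= ->.
have chp : {within `[tmin p, tmax p], continuous (fun s => h (p s))}.
  by apply: within_continuous_compose ch => // s sI; have [] := pUA _ (mem_piece_image sI).
have chq : {within `[tmin q, tmax q], continuous (fun t => h (q t))}.
  by apply: within_continuous_compose ch => // t tI; have [] := qUB _ (mem_piece_image tI).
have khp s : tmin p <= s <= tmax p -> unit_ball (h (p s)) /\ k (h (p s)) = p s.
  by move=> sI; have [Up _] := pUA _ (mem_piece_image sI); exact: hk.
have khq t : tmin q <= t <= tmax q -> unit_ball (h (q t)) /\ k (h (q t)) = q t.
  by move=> tI; have [Uq _] := qUB _ (mem_piece_image tI); exact: hk.
case: p q vp cp vq cq injp injq s0I t0I hp0 hq0 pUA qUB hp hq chp chq khp khq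
  => [e a b] [f c d] /= ab ce cd cf inje injf s0I t0I he0 hf0 _ _ he hf che chf khe khf.
apply: (crossing_parity_axes ck _ (al := fun s => (h (e s)).1) (be := fun t => (h (f t)).2)) => //.
- by move=> z w Bz Bw E; rewrite -(kh _ Bz).2 -(kh _ Bw).2 E.
- exact: within_continuous_fst.
- exact: within_continuous_snd.
- by move=> s /khe[[]]; rewrite /ball /= sub0r normrN.
- by move=> t /khf[[]]; rewrite /ball /= !sub0r !normrN.
- apply: (@injective_sign_change (fun s => (h (e s)).1) _ s0) => //; last by rewrite he0.
    exact: within_continuous_fst.
  move=> s s' sI s'I E; apply: inje => //=.
  by rewrite -(khe _ sI).2 -(khe _ s'I).2 he // E -he.
- apply: (@injective_sign_change (fun t => (h (f t)).2) _ t0) => //; last by rewrite hf0.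
    exact: within_continuous_snd.
  move=> t t' tI t'I E; apply: injf => //=.
  by rewrite -(khf _ tI).2 -(khf _ t'I).2 hf // E -hf.
- by move=> s sI; rewrite -he // (khe _ sI).2.
- by move=> t tI; rewrite -hf // (khf _ tI).2.
Qed.

Lemma subinterval_into_open p s0 (U : set plane) : valid_piece p -> tmin p < s0 < tmax p ->
  open U -> U (p s0) -> exists s1 s2,
  [/\ tmin p < s1, s1 < s0 < s2, s2 < tmax p & forall s, s1 <= s <= s2 -> U (p s)].
Proof.
move=> [vp cp] /andP[ps0 s0p] oU Us0.
have s0I : tmin p <= s0 <= tmax p by lra.
have [e e0 H] := near_interval (within_continuous_near cp s0I (open_nbhs_nbhs (conj oU Us0))).
pose r := Num.min e (Num.min (s0 - tmin p) (tmax p - s0)).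
have r0 : 0 < r by rewrite !lt_min e0; lra.
have [re rp pr] : [/\ r <= e, r <= s0 - tmin p & r <= tmax p - s0].
  by rewrite /r !ge_min !lexx !orbT.
exists (s0 - r / 2), (s0 + r / 2); split; [lra|lra|lra|].
by move=> s sI; apply: H; [lra|change (is_true (tmin p <= s <= tmax p)); lra].
Qed.

Lemma crossing_parity_proper p q s0 t0 (A B : set plane) :
  valid_piece p -> valid_piece q -> injective_piece p -> injective_piece q ->
  tmin p < s0 < tmax p -> tmin q < t0 < tmax q ->
  piece_image p `<=` A -> piece_image q `<=` B ->
  p s0 = q t0 -> proper_crossing A B (p s0) ->
  (forall s t, tmin p <= s <= tmax p -> tmin q <= t <= tmax q -> p s = q t -> s = s0 /\ t = t0) ->
  crossing_parity p q = true.
Proof.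
move=> vp vq injp injq s0I t0I pA qB pq [U [h [k [oU Us hs hom axes]]]] meet.
have [s1 [s2 [ps1 s0J s2p sU]]] := subinterval_into_open vp s0I oU Us.
have [t1 [t2 [qt1 t0J t2q tU]]] : exists t1 t2,
    [/\ tmin q < t1, t1 < t0 < t2, t2 < tmax q & forall t, t1 <= t <= t2 -> U (q t)].
  by apply: subinterval_into_open => //; rewrite -pq.
rewrite (crossing_parity_localize vp vq ps1 _ s2p qt1 _ t2q); [|lra|lra|]; last first.
  by move=> s t sI tI /(meet s t sI tI)[-> ->].
have sub (r : piece R) a b : tmin r < a -> b < tmax r -> injective_piece r -> injective_piece (Piece r a b).
  move=> ra br inj x y xI yI; apply: inj; rewrite in_itv /=.
    by move: xI; rewrite in_itv /=; lra.
  by move: yI; rewrite in_itv /=; lra.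
apply: (crossing_parity_chart (s0 := s0) (t0 := t0) _ _ _ _ _ _ _ _ hom axes) => //=.
- by apply: valid_subpiece => //; lra.
- by apply: valid_subpiece => //; lra.
- exact: sub.
- exact: sub.
- by rewrite -pq.
- move=> z /piece_imageP[s /= sI ->]; split; first exact: sU.
  by apply: pA; apply: mem_piece_image; lra.
- move=> z /piece_imageP[t /= tI ->]; split; first exact: tU.
  by apply: qB; apply: mem_piece_image; lra.
Qed.

End ProperCrossing.

(** * Chains and winding numbers mod 2 *)

Section Segments.
Variable R : realType.
Local Notation plane := (plane R).
Implicit Types (x y z : plane) (s t e : R).

Definition lerp x y t : plane := (x.1 + t * (y.1 - x.1), x.2 + t * (y.2 - x.2)).

Lemma lerp0 x y : lerp x y 0 = x.
Proof. by case: x => a b; rewrite /lerp /= !mul0r !addr0. Qed.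

Lemma lerp1 x y : lerp x y 1 = y.
Proof. by case: y => a b; rewrite /lerp /= !mul1r ![_ + (_ - _)]addrC !subrK. Qed.

Lemma lerp_continuous x y (D : set R) : {within D, continuous (lerp x y)}.
Proof.
apply: within_continuous_pair; apply: within_continuousD; try exact: within_continuous_cst.
all: by apply: within_continuousM; [exact: within_continuous_id|exact: within_continuous_cst].
Qed.

Lemma ball_lerp x e y t : ball x e y -> 0 <= t <= 1 -> ball x e (lerp x y t).
Proof.
have scale (u v : R) : ball u e v -> 0 <= t <= 1 -> ball u e (u + t * (v - u)).
  rewrite /ball /= opprD addrA subrr sub0r normrN normrM distrC => uv /andP[t0 t1].
  rewrite (ger0_norm t0); apply: le_lt_trans uv.
  by rewrite ler_piMl.
by case=> b1 b2 tI; split; exact: scale.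
Qed.

Definition segment x y : piece R := Piece (lerp x y) 0 1.

Lemma valid_segment x y : valid_piece (segment x y).
Proof. by split; [exact: ler01|exact: lerp_continuous]. Qed.

Lemma source_segment x y : source (segment x y) = x.
Proof. exact: lerp0. Qed.

Lemma target_segment x y : target (segment x y) = y.
Proof. exact: lerp1. Qed.

End Segments.

Section Chains.
Variable R : realType.
Local Notation plane := (plane R).
Implicit Types (p q : piece R) (K L : seq (piece R)) (x y z : plane) (A : set plane).

Definition valid_chain L : Prop := {in L, forall q, valid_piece q}.
Definition chain_support L : set plane := \bigcup_(q in [set` L]) piece_image q.
Definition chain_winding L x : bool := \big[addb/false]_(q <- L) winding q x.
Definition chain_parity K L : bool :=
  \big[addb/false]_(p <- K) \big[addb/false]_(q <- L) crossing_parity p q.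

(* The boundary of [L] mod 2 consists of [x] and [y]. *)
Definition joins L x y : Prop := forall phi : plane -> bool,
  \big[addb/false]_(q <- L) (phi (source q) (+) phi (target q)) = phi x (+) phi y.
Definition closed_chain L : Prop := forall x, joins L x x.

Definition avoids_ends K L : Prop :=
  {in K & L, forall p q, ~ piece_image p (source q) /\ ~ piece_image p (target q)}.

Lemma joins_piece p : joins [:: p] (source p) (target p).
Proof. by move=> phi; rewrite big_seq1. Qed.

Lemma joins_cat K L x y z : joins K x y -> joins L y z -> joins (K ++ L) x z.
Proof. by move=> jK jL phi; rewrite big_cat /= jK jL; xor_ring. Qed.

Lemma joins_closed L x : joins L x x -> closed_chain L.
Proof. by move=> jL y phi; rewrite jL !addbb. Qed.

Lemma chain_parity_star K L x x' y y' : valid_chain K -> avoids_ends K L ->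
  joins K x x' -> joins L y y' ->
  chain_parity K L =
    chain_winding L x (+) chain_winding L x' (+) chain_winding K y (+) chain_winding K y' (+)
    (above y x (+) above y x' (+) above y' x (+) above y' x').
Proof.
move=> vK KL jK jL.
have inner p : p \in K -> \big[addb/false]_(q <- L) crossing_parity p q =
    (chain_winding L (source p) (+) chain_winding L (target p)) (+)
    (winding p y (+) winding p y') (+)
    ((above y (source p) (+) above y' (source p)) (+) (above y (target p) (+) above y' (target p))).
  move=> pK; have expand q : q \in L -> crossing_parity p q =
      (winding q (source p) (+) winding q (target p)) (+)
      (winding p (source q) (+) winding p (target q)) (+)
      ((above (source q) (source p) (+) above (source q) (target p)) (+)
       (above (target q) (source p) (+) above (target q) (target p))).
    by move=> qL; have [ns nt] := KL p q pK qL; rewrite (crossing_parity_star (vK p pK) ns nt); xor_ring.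
  have /= above_ends := jL (fun z => above z (source p) (+) above z (target p)).
  rewrite (eq_big_seq _ expand) big_split /= above_ends big_split /= (jL (winding p)) big_split /=.
  by rewrite -!/(chain_winding L _); xor_ring.
have /= above_ends := jK (fun z => above y z (+) above y' z).
rewrite /chain_parity (eq_big_seq _ inner) big_split /= above_ends big_split /=.
rewrite (jK (chain_winding L)) big_split /= -!/(chain_winding K _).
by xor_ring.
Qed.

Lemma chain_parity_closed K L x x' : valid_chain K -> avoids_ends K L ->
  joins K x x' -> closed_chain L ->
  chain_parity K L = chain_winding L x (+) chain_winding L x'.
Proof. by move=> vK KL jK cL; rewrite (chain_parity_star vK KL jK (cL 0)); xor_ring. Qed.

Lemma closed_chain_parity K L : valid_chain K -> avoids_ends K L ->
  closed_chain K -> closed_chain L -> chain_parity K L = false.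
Proof. by move=> vK KL cK cL; rewrite (chain_parity_closed vK KL (cK 0) cL) addbb. Qed.

Lemma chain_parity_eq0 K L : {in K & L, forall p q, crossing_parity p q = false} ->
  chain_parity K L = false.
Proof.
move=> H; rewrite /chain_parity big1_seq // => p /andP[_ pK].
by rewrite big1_seq // => q /andP[_ qL]; exact: H.
Qed.

Lemma chain_winding_disjoint_piece L p : valid_chain L -> closed_chain L -> valid_piece p ->
  (forall z, piece_image p z -> ~ chain_support L z) ->
  chain_winding L (source p) = chain_winding L (target p).
Proof.
move=> vL cL vp disj; have vp' : valid_chain [:: p] by move=> q; rewrite mem_seq1 => /eqP ->.
have pL : avoids_ends [:: p] L.
  move=> r q; rewrite mem_seq1 => /eqP -> qL; have vq := vL q qL.
  by split=> /disj; apply; exists q => //; [exact: source_in_image|exact: target_in_image].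
have := chain_parity_closed vp' pL (@joins_piece p) cL.
rewrite chain_parity_eq0; first by case: (chain_winding _ _) (chain_winding _ _) => [] [].
move=> r q; rewrite mem_seq1 => /eqP -> qL; apply: crossing_parity_disjoint => //; first exact: vL.
by move=> z /disj nz zq; apply: nz; exists q.
Qed.

Lemma piece_image_compact p : valid_piece p -> compact (piece_image p).
Proof. by move=> [_ cp]; apply: continuous_compact => //; exact: segment_compact. Qed.

Lemma piece_image_connected p : valid_piece p -> connected (piece_image p).
Proof. by move=> [_ cp]; apply: connected_continuous_connected => //; exact: segment_connected. Qed.

Lemma chain_support_compact L : valid_chain L -> compact (chain_support L).
Proof.
move=> vL; rewrite /chain_support bigcup_seq big_seq; apply: bigsetU_compact => q qL.
exact/piece_image_compact/vL.
Qed.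

Lemma chain_winding_locally_constant L x : valid_chain L -> closed_chain L -> ~ chain_support L x ->
  \forall y \near x, ~ chain_support L y /\ chain_winding L y = chain_winding L x.
Proof.
move=> vL cL nx; have clL : closed (chain_support L).
  by apply: compact_closed (chain_support_compact vL); exact: norm_hausdorff.
have /nbhs_ballP[e /= e0 disj] : nbhs x (~` chain_support L).
  by apply: open_nbhs_nbhs; split=> //; exact: closed_openC.
apply/nbhs_ballP; exists e => //= y xy; split; first exact: disj.
rewrite -{1}(target_segment x y) -{2}(source_segment x y); apply/esym.
apply: chain_winding_disjoint_piece => //; first exact: valid_segment.
by move=> z /piece_imageP[t tI ->]; apply: disj; exact: ball_lerp.
Qed.

Lemma chain_winding_connected L A x y : valid_chain L -> closed_chain L ->
  connected A -> (forall z, A z -> ~ chain_support L z) -> A x -> A y ->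
  chain_winding L x = chain_winding L y.
Proof.
move=> vL cL cA disj Ax Ay.
pose level b := [set z | ~ chain_support L z /\ chain_winding L z = b].
have level_open b : open (level b).
  rewrite openE => z [nz <-]; exact: chain_winding_locally_constant.
suff E : A `&` level (chain_winding L x) = A by move: Ay; rewrite -E => -[_ [_ ->]].
apply: cA.
- by exists x; split=> //; split=> //; exact: disj.
- by exists (level (chain_winding L x)).
- exists (~` level (~~ chain_winding L x)); first exact: open_closedC.
  apply/seteqP; split=> z [Az].
    by move=> [nz wz]; split=> // -[_]; rewrite wz; case: (chain_winding _ _).
  move=> nw; split=> //; split; first exact: disj.
  apply: contrapT => wz; apply: nw; split; first exact: disj.
  by move: wz; case: (chain_winding L z); case: (chain_winding L x).
Qed.

(* The homotopy [x - u *: q t] contracts [q] to the origin without meeting [x]. *)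
Lemma chain_winding_far L x : valid_chain L -> closed_chain L ->
  (forall z, chain_support L z -> `|z| < `|x|) -> chain_winding L x = false.
Proof.
move=> vL cL far; pose phi z := path_parity (fun u => x - u *: z) 0 1.
transitivity (\big[addb/false]_(q <- L) (phi (source q) (+) phi (target q))); last first.
  by rewrite (cL 0) addbb.
apply: eq_big_seq => q qL; have [ab cq] := vL q qL.
have : boundary_parity (fun ut => x - ut.1 *: q ut.2) 0 1 (tmin q) (tmax q) = false.
  apply: boundary_parity_eq0 => //; split.
    apply: within_continuousD; [exact: within_continuous_cst|apply: within_continuousN].
    apply: within_continuousZ; first by apply: within_continuous_fst; exact: within_continuous_id.
    apply: within_continuous_compose cq => [ut []//|].
    by apply: within_continuous_snd; exact: within_continuous_id.
  move=> [u t] [/= + tI]; rewrite in_itv /= => /andP[u0 u1]; rewrite subr_eq0.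
  have qx : `|q t| < `|x| by apply: far; exists q => //; exact: mem_piece_image.
  apply: contraTneq qx => ->; rewrite -leNgt normrZ (ger0_norm u0).
  by rewrite ler_piMl.
rewrite /boundary_parity /= -/(phi (source q)) -/(phi (target q)).
have -> : path_parity (fun t => x - 0 *: q t) (tmin q) (tmax q) = false.
  rewrite (@eq_path_parity _ _ (fun=> x)) ?path_parity_cst // => t _.
  by rewrite scale0r subr0.
have -> : path_parity (fun t => x - 1 *: q t) (tmin q) (tmax q) = winding q x.
  by apply: eq_path_parity => t _; rewrite scale1r.
by case: (phi _) (phi _) (winding _ _) => [] [] [].
Qed.

Lemma chain_winding_unbounded L x A : valid_chain L -> closed_chain L -> chain_support L `<=` A ->
  ~ A x -> ~ bounded_set (connected_component (~` A) x) -> chain_winding L x = false.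
Proof.
move=> vL cL LA nx unbounded.
have [M [_ bound]] := compact_bounded (chain_support_compact vL).
have [y Ey far] : exists2 y, connected_component (~` A) x y & M + 1 < `|y|.
  apply: contrapT => none; apply: unbounded; exists (M + 1); split; first exact: num_real.
  move=> N MN z Ez; apply: contrapT => zN; apply: none; exists z => //.
  by rewrite (lt_trans MN) // ltNge; apply/negP.
have -> : chain_winding L x = chain_winding L y.
  apply: (chain_winding_connected vL cL (@component_connected _ (~` A) x)) => //.
  - by move=> z /connected_component_sub nz /LA.
  - exact: connected_component_refl.
apply: chain_winding_far => // z Lz; apply: le_lt_trans far.
by apply: bound Lz; rewrite ltrDl ltr01.
Qed.

Lemma winding_left_of p x : valid_piece p -> (forall z, piece_image p z -> z.1 <= x.1) ->
  winding p x = false.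
Proof.
move=> [ab _] left; apply: path_parity_right_half => // t tI.
by rewrite [(_ - _).1]/= subr_ge0; apply: left; exact: mem_piece_image.
Qed.

Lemma chain_winding_not_nested K L : valid_chain K -> valid_chain L -> K != [::] ->
  ~ ((forall z, chain_support K z -> chain_winding L z) /\
     (forall z, chain_support L z -> chain_winding K z)).
Proof.
move=> vK vL K0 [KL LK].
have vKL : valid_chain (K ++ L) by move=> q; rewrite mem_cat => /orP[/vK|/vL].
have nonempty : chain_support (K ++ L) !=set0.
  case: K K0 vK {KL LK vKL} => // p K _ vK; exists (source p), p; first exact: mem_head.
  by apply/source_in_image/vK; exact: mem_head.
have cfst : {within chain_support (K ++ L), continuous (fun z : plane => z.1)}.
  by apply: within_continuous_fst; exact: within_continuous_id.
have [z + rightmost] := compact_EVT_max nonempty (chain_support_compact vKL) cfst.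
have outside M : {subset M <= K ++ L} -> valid_chain M -> chain_winding M z = false.
  move=> MKL vM; rewrite /chain_winding big1_seq // => q /andP[_ qM].
  apply: winding_left_of; first exact: vM.
  by move=> w qw; apply: rightmost; rewrite inE; exists q => //; exact: MKL.
have [subK subL] : {subset K <= K ++ L} /\ {subset L <= K ++ L}.
  by split=> p pM; rewrite mem_cat pM ?orbT.
rewrite inE => -[q]; rewrite /= mem_cat => /orP[qK|qL] qz.
  by have := outside L subL vL; rewrite KL //; exists q.
by have := outside K subK vK; rewrite LK //; exists q.
Qed.

End Chains.

(** * Crossing parities in a drawing *)

Definition K5_pairs (T : Type) (a b c d e : T) : seq ((T * T) * (T * T)) :=
  [:: ((a, b), (c, d)); ((a, b), (c, e)); ((a, b), (d, e));
      ((a, c), (b, d)); ((a, c), (b, e)); ((a, c), (d, e));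
      ((a, d), (b, c)); ((a, d), (b, e)); ((a, d), (c, e));
      ((a, e), (b, c)); ((a, e), (b, d)); ((a, e), (c, d));
      ((b, c), (d, e)); ((b, d), (c, e)); ((b, e), (c, d))].

Lemma K5_chain_parity (R : realType) (z : nat -> plane R) (P : nat -> nat -> seq (piece R)) :
  (forall i j, i < j < 5 -> z i != z j)%N ->
  (forall i j, i < j < 5 -> valid_chain (P i j) /\ joins (P i j) (z i) (z j))%N ->
  {in K5_pairs 0 1 2 3 4, forall ef, avoids_ends (P ef.1.1 ef.1.2) (P ef.2.1 ef.2.2)}%N ->
  \big[addb/false]_(ef <- K5_pairs 0 1 2 3 4) chain_parity (P ef.1.1 ef.1.2) (P ef.2.1 ef.2.2) = true.
Proof.
move=> z_neq chains avoid.
have star ef : ef \in K5_pairs 0%N 1%N 2%N 3%N 4%N ->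
    chain_parity (P ef.1.1 ef.1.2) (P ef.2.1 ef.2.2) =
    let: ((i, j), (k, l)) := ef in
    chain_winding (P k l) (z i) (+) chain_winding (P k l) (z j) (+)
    chain_winding (P i j) (z k) (+) chain_winding (P i j) (z l) (+)
    (above (z k) (z i) (+) above (z k) (z j) (+) above (z l) (z i) (+) above (z l) (z j)).
  have : all (fun ef => (ef.1.1 < ef.1.2 < 5) && (ef.2.1 < ef.2.2 < 5))%N (K5_pairs 0 1 2 3 4)%N by [].
  move=> /allP range ef_in; have := avoid ef ef_in; have /andP[] := range ef ef_in.
  case: ef {ef_in} => [[i j] [k l]] /= /chains[vij jij] /chains[vkl jkl] av.
  exact: chain_parity_star.
have flip i j : (i < j < 5)%N -> above (z j) (z i) = ~~ above (z i) (z j).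
  by move=> ij; rewrite aboveN // z_neq.
rewrite (eq_big_seq _ star) !big_cons big_nil /=.
rewrite !(flip 0%N 1%N, flip 0%N 2%N, flip 0%N 3%N, flip 0%N 4%N, flip 1%N 2%N) //.
rewrite !(flip 1%N 3%N, flip 1%N 4%N, flip 2%N 3%N, flip 2%N 4%N, flip 3%N 4%N) //.
by xor_ring.
Qed.

Definition steps (T : Type) (x : T) (s : seq T) : seq (T * T) := pairmap pair x s.

Lemma path_steps (T : Type) (r : rel T) x s : path r x s = all (fun e => r e.1 e.2) (steps x s).
Proof. by elim: s x => //= y s IH x; rewrite IH. Qed.

Lemma mem_steps (T : eqType) (x : T) s e : e \in steps x s -> e.1 \in x :: s /\ e.2 \in x :: s.
Proof.
elim: s x => //= y s IH x; rewrite inE => /orP[/eqP -> /=|/IH[h1 h2]].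
  by rewrite !inE !eqxx orbT.
by rewrite !(in_cons x) h1 h2 !orbT.
Qed.

Lemma path_step (T : eqType) (r : rel T) x s e : path r x s -> e \in steps x s -> r e.1 e.2.
Proof. by rewrite path_steps => /allP H /H. Qed.

Lemma uniq_map_nth (T : eqType) x0 (s : seq T) (t : seq nat) :
  uniq s -> uniq t -> all (gtn (size s)) t -> uniq (map (nth x0 s) t).
Proof.
move=> us ut /allP ts; rewrite map_inj_in_uniq // => i j /ts i_lt /ts j_lt /eqP.
by rewrite nth_uniq // => /eqP.
Qed.

Lemma uniq4_symmetry (T : eqType) (u v p q : T) : uniq [:: u; v; p; q] ->
  uniq [:: p; q; u; v] /\ uniq [:: v; u; p; q].
Proof.
move=> uniq4; split; first by have := uniq_catC [:: u; v] [:: p; q]; rewrite /= => <-.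
by rewrite -(perm_uniq (s1 := [:: u; v; p; q])) // (perm_catCA [:: u] [:: v] [:: p; q]).
Qed.

Section Arcs.
Variables (R : realType) (G : sgraph) (D : drawing R G).
Local Notation plane := (plane R).
Local Notation edge u v := [set u; v]%SET.
Local Notation edge_curve u v := (curve (arc D (edge u v))).
Implicit Types (u v w p q x y : G) (r s t : R).

Lemma adj_neq u v : adj u v -> u != v.
Proof. by apply: contraTneq => ->; rewrite adj_irrefl. Qed.

Lemma adj_is_edge u v : adj u v -> is_edge (edge u v).
Proof. by move=> uv; exists u, v. Qed.

Definition oriented_arc u v : R -> plane :=
  let g := arc D (edge u v) in
  if g 0 == pos D u then g else fun t => g (1 - t).

Definition subarc u v s t : piece R := Piece (oriented_arc u v) s t.

Lemma oriented_arc_ends u v : adj u v ->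
  oriented_arc u v 0 = pos D u /\ oriented_arc u v 1 = pos D v.
Proof.
move=> uv; have [u' [v' [E g0 g1]]] := arc_ends D (adj_is_edge uv).
rewrite /oriented_arc; case: eqP => [e0|n0].
  split=> //; rewrite g1; congr pos.
  move: e0; rewrite g0 => /pos_inj eu.
  have : v \in edge u' v' by rewrite -E !inE eqxx orbT.
  by rewrite !inE eu eq_sym (negPf (adj_neq uv)) => /eqP.
rewrite subr0 subrr g1 g0.
have uu : u != u' by apply/eqP => eu; apply: n0; rewrite g0 eu.
have : u \in edge u' v' by rewrite -E !inE eqxx.
rewrite !inE (negPf uu) => /eqP <-; split=> //; congr pos.
have : u' \in edge u v by rewrite E !inE eqxx.
by rewrite !inE eq_sym (negPf uu) => /eqP.
Qed.

Lemma valid_subarc u v s t : adj u v -> 0 <= s -> s <= t -> t <= 1 -> valid_piece (subarc u v s t).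
Proof.
move=> uv s0 st t1; apply: (@valid_subpiece _ (subarc u v 0 1)) => //.
have [c _] := arc_jordan D (adj_is_edge uv); split; first exact: ler01.
rewrite /subarc /oriented_arc /=; case: (_ == _) => //; apply: within_continuous_compose c => [r|].
  by rewrite /= !in_itv /=; lra.
apply: within_continuousD; first exact: within_continuous_cst.
by apply: within_continuousN; exact: within_continuous_id.
Qed.

Lemma oriented_arc_inj u v s t : adj u v -> 0 <= s <= 1 -> 0 <= t <= 1 ->
  oriented_arc u v s = oriented_arc u v t -> s = t.
Proof.
move=> uv sI tI; have [_ inj] := arc_jordan D (adj_is_edge uv).
rewrite /oriented_arc; case: ifP => _; first by apply: inj; rewrite in_itv.
by move=> /inj; rewrite !in_itv /= => H; suff : 1 - s = 1 - t by [lra]; apply: H; lra.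
Qed.

Lemma oriented_arc_on_curve u v t : 0 <= t <= 1 -> edge_curve u v (oriented_arc u v t).
Proof.
move=> tI; rewrite /oriented_arc; case: ifP => _; first by exists t => //; rewrite /= in_itv.
by exists (1 - t) => //; rewrite /= in_itv /=; lra.
Qed.

Lemma edge_curveP u v z : edge_curve u v z -> exists2 t, 0 <= t <= 1 & z = oriented_arc u v t.
Proof.
move=> [t]; rewrite /= in_itv /= => tI <-; rewrite /oriented_arc; case: ifP => _.
  by exists t.
by exists (1 - t); [lra|rewrite subKr].
Qed.

Lemma subarc_on_curve u v s t : 0 <= s -> t <= 1 ->
  piece_image (subarc u v s t) `<=` edge_curve u v.
Proof. by move=> s0 t1 z /piece_imageP[r /= rI ->]; apply: oriented_arc_on_curve; lra. Qed.

Lemma vertex_on_edge_curve u v w : adj u v -> edge_curve u v (pos D w) -> (w == u) || (w == v).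
Proof. by move=> uv /(arc_vertex (adj_is_edge uv)); rewrite !inE. Qed.

Lemma vertex_notin_subarc u v w s t : adj u v -> w != u -> w != v -> 0 <= s -> t <= 1 ->
  ~ piece_image (subarc u v s t) (pos D w).
Proof.
move=> uv wu wv s0 t1 /(subarc_on_curve s0 t1)/(vertex_on_edge_curve uv).
by rewrite (negPf wu) (negPf wv).
Qed.

Lemma start_notin_subarc u v s t : adj u v -> 0 < s -> t <= 1 ->
  ~ piece_image (subarc u v s t) (pos D u).
Proof.
move=> uv s0 t1 /piece_imageP[r /= rI]; have [<- _] := oriented_arc_ends uv.
by move=> /(oriented_arc_inj uv) E; have : 0 = r by [apply: E; rewrite ?lexx ?ler01 //; lra]; lra.
Qed.

Lemma arc_params_unique u v p q s t s' t' : adj u v -> adj p q -> edge u v != edge p q ->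
  0 <= s <= 1 -> 0 <= t <= 1 -> 0 <= s' <= 1 -> 0 <= t' <= 1 ->
  oriented_arc u v s = oriented_arc p q t -> oriented_arc u v s' = oriented_arc p q t' ->
  s' = s /\ t' = t.
Proof.
move=> uv pq ne sI tI s'I t'I E E'.
have same : oriented_arc u v s' = oriented_arc u v s.
  apply: (arcs_meet_once (adj_is_edge uv) (adj_is_edge pq) ne).
    by split; [exact: oriented_arc_on_curve|rewrite E'; exact: oriented_arc_on_curve].
  by split; [exact: oriented_arc_on_curve|rewrite E; exact: oriented_arc_on_curve].
split; first exact: oriented_arc_inj same.
by apply: (oriented_arc_inj pq) => //; rewrite -E -E'.
Qed.

Lemma adjacent_arcs_meet u v w w' s t : adj u v -> adj w w' -> u \in [:: w; w'] -> v \notin [:: w; w'] ->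
  0 <= s <= 1 -> 0 <= t <= 1 -> oriented_arc u v s = oriented_arc w w' t -> s = 0.
Proof.
move=> uv ww' uw vw sI tI E.
have ne : edge u v != edge w w'.
  by apply: contraNneq vw => E'; move: (set22 u v); rewrite E' !inE.
have [e0 _] := oriented_arc_ends uv; have [f0 f1] := oriented_arc_ends ww'.
have zeroI : (0 : R) <= (0 : R) <= 1 by lra.
have oneI : (0 : R) <= (1 : R) <= 1 by lra.
move: uw; rewrite !inE => /orP[] /eqP uw.
  have E0 : oriented_arc u v 0 = oriented_arc w w' 0 by rewrite e0 f0 uw.
  by have [] := arc_params_unique uv ww' ne zeroI zeroI sI tI E0 E.
have E0 : oriented_arc u v 0 = oriented_arc w w' 1 by rewrite e0 f1 uw.
by have [] := arc_params_unique uv ww' ne zeroI oneI sI tI E0 E.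
Qed.

Lemma crossing_on_curves (A B : set plane) z : proper_crossing A B z -> A z /\ B z.
Proof.
move=> [U [h [k [_ Uz hz _ AB]]]].
by have [hA hB] := AB _ Uz; split; [apply/hA|apply/hB]; rewrite hz.
Qed.

Lemma uniq_edge_neq u v p q : uniq [:: u; v; p; q] -> edge u v != edge p q.
Proof.
rewrite /= !inE !negb_or => /and3P[/and3P[_ up uq] _ _].
by apply/eqP => /setP /(_ u); rewrite !inE eqxx (negPf up) (negPf uq).
Qed.

Section IndependentEdges.
Variables u v p q : G.
Hypotheses (uv : adj u v) (pq : adj p q) (indep : uniq [:: u; v; p; q]).

Lemma independent_arcs_cross z : edge_curve u v z -> edge_curve p q z ->
  proper_crossing (edge_curve u v) (edge_curve p q) z.
Proof.
move=> zu zp; have [[w []]|//] :=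
  arcs_meet (adj_is_edge uv) (adj_is_edge pq) (uniq_edge_neq indep) (conj zu zp).
move: indep; rewrite !inE /= !inE !negb_or => /and3P[/and3P[_ up uq] /andP[vp vq] _] w1 w2 _; exfalso.
by move: w1 w2 => /orP[] /eqP ->; rewrite ?(negPf up) ?(negPf uq) ?(negPf vp) ?(negPf vq).
Qed.

Lemma independent_arcs_interior s t : 0 <= s <= 1 -> 0 <= t <= 1 ->
  oriented_arc u v s = oriented_arc p q t -> 0 < s < 1.
Proof.
move=> sI tI E; have [e0 e1] := oriented_arc_ends uv.
have off w : w \in [:: u; v] -> oriented_arc u v s <> pos D w.
  move=> wuv wE; have : (w == p) || (w == q).
    by apply: (vertex_on_edge_curve pq); rewrite -wE E; exact: oriented_arc_on_curve.
  move: wuv indep; rewrite /= !inE !negb_or => wuv.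
  move=> /and3P[/and3P[_ /negPf up /negPf uq] /andP[/negPf vp /negPf vq] _].
  by case/orP: wuv => /eqP ->; rewrite ?up ?uq ?vp ?vq.
have [s0|s0] := eqVneq s 0; first by case: (off u); rewrite ?s0 // !inE eqxx.
have [s1|s1] := eqVneq s 1; first by case: (off v); rewrite ?s1 // !inE eqxx orbT.
by rewrite !lt_neqAle s1 eq_sym s0.
Qed.

End IndependentEdges.

Lemma subarc_parity_crossing u v p q s t a b c d : adj u v -> adj p q -> uniq [:: u; v; p; q] ->
  0 <= a -> a < s < b -> b <= 1 -> 0 <= c -> c < t < d -> d <= 1 ->
  oriented_arc u v s = oriented_arc p q t ->
  crossing_parity (subarc u v a b) (subarc p q c d) = true.
Proof.
move=> uv pq indep a0 sI b1 c0 tI d1 E.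
have inj x y r r' : adj x y -> 0 <= r -> r' <= 1 -> injective_piece (subarc x y r r').
  move=> xy r0 r1 r2 r3; rewrite !in_itv /= => rI rI'.
  by apply: (oriented_arc_inj xy); lra.
apply: (crossing_parity_proper (s0 := s) (t0 := t) (A := edge_curve u v) (B := edge_curve p q)) => //=.
- by apply: valid_subarc => //; lra.
- by apply: valid_subarc => //; lra.
- exact: inj.
- exact: inj.
- exact: subarc_on_curve.
- exact: subarc_on_curve.
- apply: independent_arcs_cross => //; first by apply: oriented_arc_on_curve; lra.
  by rewrite E; apply: oriented_arc_on_curve; lra.
- by move=> r r' rI rI'; apply: arc_params_unique => //; [exact: uniq_edge_neq|lra..].
Qed.

Definition edge_parity u v p q : bool := crossing_parity (subarc u v 0 1) (subarc p q 0 1).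

Lemma edge_parityP u v p q : adj u v -> adj p q -> uniq [:: u; v; p; q] ->
  reflect (edge_curve u v `&` edge_curve p q !=set0) (edge_parity u v p q).
Proof.
move=> uv pq indep; apply: (iffP idP) => [|[z [zu zp]]].
  apply: contraTP => disj; rewrite /edge_parity crossing_parity_disjoint //; [exact: valid_subarc..|].
  move=> z zu zp; apply: disj; exists z.
  by split; [exact: subarc_on_curve zu|exact: subarc_on_curve zp].
have [s sI zs] := edge_curveP zu; have [t tI zt] := edge_curveP zp.
have E : oriented_arc u v s = oriented_arc p q t by rewrite -zs.
apply: (subarc_parity_crossing (s := s) (t := t) uv pq indep) => //.
  exact: independent_arcs_interior E.
by apply: (independent_arcs_interior pq uv _ tI sI (esym E)); case: (uniq4_symmetry indep).
Qed.

Lemma edge_parity_meet u v p q : adj u v -> adj p q -> uniq [:: u; v; p; q] -> edge_parity u v p q ->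
  exists s t, [/\ 0 < s < 1, 0 < t < 1 & oriented_arc u v s = oriented_arc p q t].
Proof.
move=> uv pq indep /(edge_parityP uv pq indep)[z [zu zp]].
have [s sI zs] := edge_curveP zu; have [t tI zt] := edge_curveP zp.
have E : oriented_arc u v s = oriented_arc p q t by rewrite -zs.
exists s, t; split=> //; first exact: independent_arcs_interior E.
by apply: (independent_arcs_interior pq uv _ tI sI (esym E)); case: (uniq4_symmetry indep).
Qed.

Lemma edge_parityC u v p q : adj u v -> adj p q -> uniq [:: u; v; p; q] ->
  edge_parity u v p q = edge_parity p q u v.
Proof.
move=> uv pq indep; have [indep' _] := uniq4_symmetry indep.
by apply/edge_parityP/edge_parityP => //; rewrite setIC.
Qed.

Lemma edge_parity_swap u v p q : adj u v -> adj p q -> uniq [:: u; v; p; q] ->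
  edge_parity u v p q = edge_parity v u p q.
Proof.
move=> uv pq indep; have [_ indep'] := uniq4_symmetry indep.
have vu : adj v u by rewrite adj_sym.
by apply/edge_parityP/edge_parityP => //; rewrite finset.setUC.
Qed.

Lemma subarc_parity_uncrossed u v p q s t s' t' : adj u v -> adj p q -> uniq [:: u; v; p; q] ->
  edge_parity u v p q = false -> 0 <= s -> s <= t -> t <= 1 -> 0 <= s' -> s' <= t' -> t' <= 1 ->
  crossing_parity (subarc u v s t) (subarc p q s' t') = false.
Proof.
move=> uv pq indep uncrossed *; apply: crossing_parity_disjoint; [exact: valid_subarc..|].
move=> z zu zp; move/negP: uncrossed; apply; apply/edge_parityP => //; exists z.
by split; [apply: subarc_on_curve zu|apply: subarc_on_curve zp].
Qed.

Definition walk x (ps : seq G) : seq (piece R) := [seq subarc e.1 e.2 0 1 | e <- steps x ps].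

Lemma walkP x ps (k : piece R) : path (@adj G) x ps -> k \in walk x ps ->
  exists u v, [/\ (u, v) \in steps x ps, adj u v & k = subarc u v 0 1].
Proof. by move=> a /mapP[[u v] uv ->]; exists u, v; rewrite (path_step a uv). Qed.

Lemma valid_walk x ps : path (@adj G) x ps -> valid_chain (walk x ps).
Proof. by move=> a q /(walkP a)[u [v [_ uv ->]]]; exact: valid_subarc. Qed.

Lemma joins_walk x ps : path (@adj G) x ps -> joins (walk x ps) (pos D x) (pos D (last x ps)).
Proof.
elim: ps x => [|y ps IH] x /=; first by move=> _ phi; rewrite big_nil addbb.
move=> /andP[xy /IH]; apply: (@joins_cat _ [:: _]).
by have [<- <-] := oriented_arc_ends xy; exact: joins_piece.
Qed.

Lemma avoids_ends_walk K x ps : path (@adj G) x ps ->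
  {in K, forall k, {in x :: ps, forall w, ~ piece_image k (pos D w)}} -> avoids_ends K (walk x ps).
Proof.
move=> a off p q pK /(walkP a)[u [v [/mem_steps[/= ux vx] uv ->]]].
have [<- <-] : pos D u = source (subarc u v 0 1) /\ pos D v = target (subarc u v 0 1).
  by have [] := oriented_arc_ends uv.
by split; exact: off.
Qed.

Lemma walks_avoid_ends x ps y qs : path (@adj G) x ps -> path (@adj G) y qs ->
  ~~ has (mem (x :: ps)) (y :: qs) -> avoids_ends (walk x ps) (walk y qs).
Proof.
move=> ax ay /hasPn disj; apply: avoids_ends_walk => // p /(walkP ax)[u [v [/mem_steps[/= ux vx] uv ->]]].
move=> w /disj wx; apply: vertex_notin_subarc => //; by apply: contraNneq wx => ->.
Qed.

Definition walk_parity x ps y qs : bool := chain_parity (walk x ps) (walk y qs).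

Lemma walk_parityE x ps y qs : walk_parity x ps y qs =
  \big[addb/false]_(e <- steps x ps) \big[addb/false]_(f <- steps y qs) edge_parity e.1 e.2 f.1 f.2.
Proof. by rewrite /walk_parity /chain_parity big_map; apply: eq_bigr => e _; rewrite big_map. Qed.

Lemma triangle_edge_parity a b c a' b' c' : adj a b -> adj b c -> adj c a ->
  adj a' b' -> adj b' c' -> adj c' a' -> ~~ has (mem [:: a; b; c]) [:: a'; b'; c'] ->
  walk_parity a [:: b; c; a] a' [:: b'; c'; a'] = false.
Proof.
move=> ab bc ca a'b' b'c' c'a' disj.
have [W W'] : path (@adj G) a [:: b; c; a] /\ path (@adj G) a' [:: b'; c'; a'].
  by rewrite /= ab bc ca a'b' b'c' c'a'.
apply: closed_chain_parity; first exact: valid_walk.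
- have dup (x y z w : G) : (w \in [:: x; y; z; x]) = (w \in [:: x; y; z]).
    by rewrite !inE; case: (w == x); rewrite //= orbF.
  apply: walks_avoid_ends => //; apply/hasPn => w; rewrite dup => /(hasPn disj).
  by apply: contra; rewrite /= dup.
- exact: joins_closed (joins_walk W).
- exact: joins_closed (joins_walk W').
Qed.

Definition joined (x : G) ps y : Prop := path (@adj G) x ps /\ last x ps = y.

Lemma K5_walk_parity (v : nat -> G) (P : nat -> nat -> seq G) :
  (forall i j, i < j < 5 -> v i != v j)%N ->
  (forall i j, i < j < 5 -> joined (v i) (P i j) (v j))%N ->
  {in K5_pairs 0 1 2 3 4, forall ef, ~~ has (mem (v ef.1.1 :: P ef.1.1 ef.1.2))
                                           (v ef.2.1 :: P ef.2.1 ef.2.2)}%N ->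
  \big[addb/false]_(ef <- K5_pairs 0 1 2 3 4)
     walk_parity (v ef.1.1) (P ef.1.1 ef.1.2) (v ef.2.1) (P ef.2.1 ef.2.2) = true.
Proof.
move=> v_neq walks disj.
apply: (K5_chain_parity (z := fun i => pos D (v i)) (P := fun i j => walk (v i) (P i j))).
- by move=> i j /v_neq; apply: contra_neq => /pos_inj.
- by move=> i j /walks[a <-]; split; [exact: valid_walk|exact: joins_walk].
have : all (fun ef => (ef.1.1 < ef.1.2 < 5) && (ef.2.1 < ef.2.2 < 5))%N (K5_pairs 0 1 2 3 4)%N by [].
move=> /allP range ef ef_in; have /andP[/walks[ae _] /walks[af _]] := range ef ef_in.
by apply: walks_avoid_ends => //; exact: disj.
Qed.

Section Fan.
Hypothesis noI : forall e e1 e2, ~ pattern_I D e e1 e2.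

Lemma crossing_edges_adjacent u v p q x y : adj u v -> adj p q -> adj x y ->
  uniq [:: p; q; u; v] -> uniq [:: x; y; u; v] ->
  edge_parity p q u v -> edge_parity x y u v -> ~~ uniq [:: p; q; x; y].
Proof.
move=> uv pq xy i1 i2 /(edge_parityP pq uv i1)[z [zp zu]] /(edge_parityP xy uv i2)[z' [zx zu']].
apply/negP => i; apply: (@noI (edge u v) (edge p q) (edge x y)); split.
- exists z; split; [exact: adj_is_edge..|exact: uniq_edge_neq|exact: independent_arcs_cross].
- exists z'; split; [exact: adj_is_edge..|exact: uniq_edge_neq|exact: independent_arcs_cross].
move=> [w []]; move: i; rewrite !inE /= !inE !negb_or => /and3P[/and3P[_  px py] /andP[qx qy] _].
by move=> /orP[] /eqP ->; rewrite ?(negPf px) ?(negPf py) ?(negPf qx) ?(negPf qy).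
Qed.

End Fan.

Lemma strongly_fan_planar_outside e f g (a b : plane) u v : strongly_fan_planar_drawing D ->
  crosses_at D f e a -> crosses_at D g e b -> f != g -> u \in f -> u \in g -> v \in e ->
  ~ bounded_region (closed_curve D e f g u a b) (pos D v).
Proof.
move=> strong cf cg fg uf ug ve bv; have [_ noII noIII] := strong e f g.
have [[w [we nw]]|none] := pselect (exists w, w \in e /\
    ~ bounded_region (closed_curve D e f g u a b) (pos D w)); last first.
  apply: noIII; exists u, a, b; split=> // w we.
  by apply: contrapT => nw; apply: none; exists w.
apply: noII; exists u, a, b; split=> //; exists v; split=> // w' [w'e bw'].
have [_ [p [q [_ E]]] _ _] := cf; move: ve we w'e nw bv bw'; rewrite E !inE.
by do 3 case/orP => /eqP ->.
Qed.

End Arcs.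

(** * Crossings of a K7 *)

Section Search.

Local Open Scope nat_scope.

(* [((i, j), (k, l))] stands for the crossing parity of the edges [ij] and [kl] of a K7. *)
Definition edge_pair := ((nat * nat) * (nat * nat))%type.
Definition parity_constraint := (seq edge_pair * bool)%type.

Definition xor_all (s : seq bool) : bool := foldr addb false s.

Definition satisfies (f : edge_pair -> bool) (c : parity_constraint) : bool :=
  xor_all (map f c.1) == c.2.

Definition disjoint_edges (e f : nat * nat) : bool := uniq [:: e.1; e.2; f.1; f.2].

(* Two disjoint edges that cross a third one form Pattern (I). *)
Definition conflict (v w : edge_pair) : bool :=
  [|| (v.1 == w.1) && disjoint_edges v.2 w.2, (v.1 == w.2) && disjoint_edges v.2 w.1,
      (v.2 == w.1) && disjoint_edges v.1 w.2 | (v.2 == w.2) && disjoint_edges v.1 w.1].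

(* Each constraint is tested once its last pair is decided. *)
Fixpoint schedule (cs : seq parity_constraint) (decided undecided : seq edge_pair) :
    seq (edge_pair * seq parity_constraint) :=
  if undecided is v :: undecided' then
    (v, [seq c <- cs | (v \in c.1) && all (mem (v :: decided)) c.1])
      :: schedule cs (v :: decided) undecided'
  else [::].

Fixpoint refute (todo : seq (edge_pair * seq parity_constraint)) (crossing : seq edge_pair) : bool :=
  if todo is (v, cs) :: todo' then
    if (if all (satisfies [in crossing]) cs then refute todo' crossing else true) then
      if has (conflict v) crossing then true
      else if all (satisfies [in v :: crossing]) cs then refute todo' (v :: crossing) else true
    else false
  else false.

Lemma refute_sound (f : edge_pair -> bool) (cs : seq parity_constraint)
    (decided undecided : seq edge_pair) :
  {in cs, forall c, satisfies f c} ->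
  (forall v w, v \in undecided -> w \in decided ++ undecided -> f v -> f w -> ~~ conflict v w) ->
  ~~ refute (schedule cs decided undecided) [seq v <- decided | f v].
Proof.
move=> sat; elim: undecided decided => //= v undecided IH decided noconflict.
have ok : all (satisfies [in [seq w <- v :: decided | f w]])
    [seq c <- cs | (v \in c.1) && all (mem (v :: decided)) c.1].
  apply/allP => c; rewrite mem_filter => /andP[/andP[_ /allP c_decided] /sat].
  rewrite /satisfies; congr (xor_all _ == _); apply/eq_in_map => w /c_decided wd.
  by rewrite mem_filter [w \in _]wd andbT.
have next : ~~ refute (schedule cs (v :: decided) undecided) [seq w <- v :: decided | f w].
  apply: IH => w w' wu w'd; apply: noconflict; first by rewrite inE wu orbT.
  by move: w'd; rewrite !mem_cat !inE; case: (_ == v); case: (_ \in decided); case: (_ \in undecided).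
move: ok next => /=; case: ifP => fv ok next; last by rewrite ok (negPf next).
rewrite ok (negPf next); case: ifP => // _; case: ifP => // /hasP[w].
rewrite mem_filter => /andP[fw wd] vw.
by have := noconflict v w (mem_head _ _) _ fv fw; rewrite vw mem_cat wd => /(_ isT).
Qed.

Fixpoint subseqs_of_size (T : Type) (k : nat) (s : seq T) : seq (seq T) :=
  match k, s with
  | 0, _ => [:: [::]]
  | _.+1, [::] => [::]
  | k'.+1, x :: s' => subseqs_of_size k s' ++ [seq x :: t | t <- subseqs_of_size k' s']
  end.

Lemma subseqs_of_sizeP (T : eqType) k (s t : seq T) :
  t \in subseqs_of_size k s -> subseq t s /\ size t = k.
Proof.
elim: s k t => [|x s IH] [|k] t //=; try by rewrite mem_seq1 => /eqP ->.
rewrite mem_cat => /orP[/IH[ts <-]|/mapP[t' /IH[ts <-] ->]].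
  by split=> //; exact: subseq_trans ts (subseq_cons s x).
by rewrite /= eqxx.
Qed.

Definition K7_vertices : seq nat := rev (iota 0 7).

Lemma subseq_K7_vertices s : subseq s K7_vertices -> uniq s && all (gtn 7) s.
Proof.
move=> sK; rewrite (subseq_uniq sK) //=.
by apply/allP => i /(mem_subseq sK); rewrite mem_rev mem_iota.
Qed.

Definition K4_pairs (s : seq nat) : seq edge_pair :=
  if s is [:: a; b; c; d] then [:: ((a, b), (c, d)); ((a, c), (b, d)); ((a, d), (b, c))] else [::].

Definition K7_pairs : seq edge_pair := flatten (map K4_pairs (subseqs_of_size 4 K7_vertices)).

Definition independent_pair (v : edge_pair) : bool :=
  let s := [:: v.1.1; v.1.2; v.2.1; v.2.2] in uniq s && all (gtn 7) s.

Lemma independent_pairC e f : independent_pair (e, f) = independent_pair (f, e).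
Proof.
have p := permEl (perm_catC [:: e.1; e.2] [:: f.1; f.2]).
exact: (congr2 andb (perm_uniq p) (perm_all (gtn 7) p)).
Qed.

Lemma independent_pair_swap i j f : independent_pair ((i, j), f) = independent_pair ((j, i), f).
Proof.
have p := permEl (perm_catCA [:: i] [:: j] [:: f.1; f.2]).
exact: (congr2 andb (perm_uniq p) (perm_all (gtn 7) p)).
Qed.

Lemma K7_pairsP v : v \in K7_pairs -> independent_pair v.
Proof.
rewrite /independent_pair; case: v => [[i j] [k l]] /flattenP[_ /mapP[s /subseqs_of_sizeP[sK s4] ->]].
have /andP[us s7] := subseq_K7_vertices sK.
case: s s4 us s7 {sK} => [|a [|b [|c [|d []]]]] //= _.
rewrite !inE !negb_or => /and4P[/and3P[ab ac ad] /andP[bc bd] cd _] /and5P[a7 b7 c7 d7 _].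
have [cb db dc] : [/\ c != b, d != b & d != c] by rewrite !(eq_sym d) (eq_sym c).
by move=> /or3P[] /eqP[-> -> -> ->]; rewrite /= ?inE ?negb_or ?ab ?ac ?ad ?bc ?bd ?cd ?cb ?db ?dc a7 b7 c7 d7.
Qed.

Definition K5_constraint (s : seq nat) : parity_constraint :=
  (K5_pairs (nth 0 s 0) (nth 0 s 1) (nth 0 s 2) (nth 0 s 3) (nth 0 s 4), true).

Definition triangle_edges (s : seq nat) : seq (nat * nat) :=
  if s is [:: a; b; c] then [:: (a, b); (b, c); (c, a)] else [::].

Lemma triangle_edgesP s e : uniq s -> e \in triangle_edges s ->
  [/\ e.1 \in s, e.2 \in s & e.1 != e.2].
Proof.
case: s => [|a [|b [|c []]]] //=; rewrite !inE negb_or => /and3P[/andP[ab ac] bc _].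
by move=> /or3P[] /eqP -> /=; split; rewrite ?inE ?eqxx ?orbT // eq_sym.
Qed.

Lemma triangle_edges_independent s t e f :
  uniq s && all (gtn 7) s -> uniq t && all (gtn 7) t -> ~~ has (mem s) t ->
  e \in triangle_edges s -> f \in triangle_edges t -> independent_pair (e, f).
Proof.
move=> /andP[us /allP s7] /andP[ut /allP t7] /hasPn disj.
move=> /(triangle_edgesP us)[e1 e2 e12] /(triangle_edgesP ut)[f1 f2 f12].
apply/andP; split; last first.
  by apply/allP => x; rewrite !inE => /or4P[] /eqP ->; [exact: s7|exact: s7|exact: t7|exact: t7].
rewrite -[X in uniq X]/([:: e.1; e.2] ++ [:: f.1; f.2]) cat_uniq /= ?inE e12 f12 /= orbF negb_or.
have off x : x \in t -> ~~ ((x == e.1) || (x == e.2)).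
  by move=> /disj; apply: contra => /orP[] /eqP ->.
by rewrite !off.
Qed.

Definition decreasing (e : nat * nat) : nat * nat := if e.2 < e.1 then e else (e.2, e.1).

Definition canonical_pair (e f : nat * nat) : edge_pair :=
  if (decreasing f).1 < (decreasing e).1 then (decreasing e, decreasing f)
  else (decreasing f, decreasing e).

Definition triangle_constraint (s t : seq nat) : parity_constraint :=
  ([seq canonical_pair e f | e <- triangle_edges s, f <- triangle_edges t], false).

Definition K7_constraints : seq parity_constraint :=
  map K5_constraint (subseqs_of_size 5 K7_vertices) ++
  [seq triangle_constraint st.1 st.2 |
     st <- [seq (s, t) | s <- subseqs_of_size 3 K7_vertices, t <- subseqs_of_size 3 K7_vertices]
     & (head 0 st.2 < head 0 st.1) && ~~ has (mem st.1) st.2].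

Definition cut_pair (A : nat -> bool) (v : edge_pair) : bool :=
  (A v.1.1 != A v.1.2) || (A v.2.1 != A v.2.2).

Definition refute_cut (A : nat -> bool) : bool :=
  refute (schedule [seq ([seq v <- c.1 | ~~ cut_pair A v], c.2) | c <- K7_constraints]
            [::] [seq v <- K7_pairs | ~~ cut_pair A v]) [::].

Fixpoint bitseqs (n : nat) : seq bitseq :=
  if n is n'.+1 then [seq true :: s | s <- bitseqs n'] ++ [seq false :: s | s <- bitseqs n'] else [:: [::]].

Lemma mem_bitseqs (s : bitseq) : s \in bitseqs (size s).
Proof.
elim: s => // b s IH /=; rewrite mem_cat; case: b; first by rewrite map_f.
by rewrite orbC map_f.
Qed.

Lemma refute_cuts : all (fun s => all id s || refute_cut (nth false (true :: s))) (bitseqs 6).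
Proof. vm_cast_no_check isT. Qed.

Lemma K7_constraints_pairs : all (fun c => all (mem K7_pairs) c.1) K7_constraints.
Proof. by vm_compute. Qed.

Lemma satisfies_filter (f : edge_pair -> bool) (a : pred edge_pair) c :
  {in c.1, forall v, ~~ a v -> f v = false} ->
  satisfies f ([seq v <- c.1 | a v], c.2) = satisfies f c.
Proof.
case: c => s b /= H; congr (_ == _); elim: s H => //= v s IH H.
rewrite -IH => [|w ws]; last by apply: H; rewrite inE ws orbT.
by case: ifP => //= /negbT/(H v (mem_head _ _)) ->.
Qed.

Lemma crossing_over_cut (f : edge_pair -> bool) (A : nat -> bool) i j :
  {in K7_constraints, forall c, satisfies f c} ->
  {in K7_pairs &, forall v w, f v -> f w -> ~~ conflict v w} ->
  i < 7 -> j < 7 -> A i != A j -> exists2 v, v \in K7_pairs & f v && cut_pair A v.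
Proof.
move=> sat noconflict i7 j7 Aij.
apply/hasP; apply: contraT => /hasPn uncrossed.
pose s := [seq A i == A 0 | i <- iota 1 6].
have sA k : k < 7 -> nth false (true :: s) k = (A k == A 0).
  case: k => [|k] k7; first by rewrite eqxx.
  by rewrite /= (nth_map 0) ?size_iota // nth_iota.
have same_cut : {in K7_pairs, cut_pair (nth false (true :: s)) =1 cut_pair A}.
  move=> [[a b] [c d]] /K7_pairsP/andP[_ /and5P[/= a7 b7 c7 d7 _]].
  rewrite /cut_pair /= -!/(nth false (true :: s) _).
  by rewrite !sA //; case: (A a) (A b) (A c) (A d) (A 0) => [] [] [] [] [].
have := allP refute_cuts s (mem_bitseqs s).
have -> /= : all id s = false.
  apply/negP => /allP sT; have K k : k < 7 -> A k = A 0.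
    case: k => // k k7; apply/eqP/(sT (A k.+1 == A 0)).
    by apply: (map_f (fun i => A i == A 0)); rewrite mem_iota.
  by move: Aij; rewrite !K // eqxx.
rewrite /refute_cut; apply/contraLR => _.
apply: (@refute_sound f) => [c' /mapP[c cK ->]|v w].
  rewrite satisfies_filter; first exact: sat.
  move=> v vc; have vK : v \in K7_pairs by have /allP := allP K7_constraints_pairs c cK; exact.
  rewrite negbK (same_cut v vK) => cutv.
  by have := uncrossed v vK; rewrite cutv andbT => /negPf.
rewrite !mem_filter => /andP[_ vK] /andP[_ wK]; exact: noconflict.
Qed.

End Search.

Section K7.
Variables (R : realType) (G : sgraph) (D : drawing R G).
Hypothesis noI : forall e e1 e2, ~ pattern_I D e e1 e2.
Variable m : nat -> G.
Hypothesis m_adj : forall i j, (i < 7)%N -> (j < 7)%N -> i != j -> adj (m i) (m j).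

Let pair_parity (v : edge_pair) : bool := edge_parity D (m v.1.1) (m v.1.2) (m v.2.1) (m v.2.2).

Let m_uniq s : uniq s && all (gtn 7) s -> uniq (map m s).
Proof.
move=> /andP[us /allP s7]; rewrite map_inj_in_uniq // => i j /s7 i7 /s7 j7 E.
apply/eqP; apply: contraT => ij.
by have := m_adj i7 j7 ij; rewrite E adj_irrefl.
Qed.

Let pair_adj i j k l : independent_pair ((i, j), (k, l)) ->
  [/\ adj (m i) (m j), adj (m k) (m l) & uniq [:: m i; m j; m k; m l]].
Proof.
move=> indep; have := m_uniq indep; move: indep; rewrite /independent_pair /= !inE !negb_or.
move=> /andP[/and4P[/and3P[ij _ _] _ kl _] /and5P[i7 j7 k7 l7 _]].
by split; rewrite ?m_adj.
Qed.

Let pair_parityC e f : independent_pair (e, f) -> pair_parity (e, f) = pair_parity (f, e).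
Proof. by case: e f => [i j] [k l] /pair_adj[ij kl indep]; exact: edge_parityC. Qed.

Let pair_parity_decreasing e f : independent_pair (e, f) ->
  pair_parity (decreasing e, f) = pair_parity (e, f) /\ independent_pair (decreasing e, f).
Proof.
case: e f => [i j] [k l] indep; rewrite /decreasing; case: ifP => // _.
split; last by rewrite independent_pair_swap.
by have [ij kl u] := pair_adj indep; rewrite /pair_parity /= (edge_parity_swap D ij kl u).
Qed.

Let pair_parity_canonical e f : independent_pair (e, f) ->
  pair_parity (canonical_pair e f) = pair_parity (e, f).
Proof.
move=> indep; have [<- indep1] := pair_parity_decreasing indep.
have indep1C : independent_pair (f, decreasing e) by rewrite independent_pairC.
have [E indep2] := pair_parity_decreasing indep1C.
rewrite (pair_parityC indep1) -E /canonical_pair; case: ifP => // _.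
by rewrite -pair_parityC.
Qed.

Lemma K5_constraint_parity s : s \in subseqs_of_size 5 K7_vertices ->
  satisfies pair_parity (K5_constraint s).
Proof.
move=> /subseqs_of_sizeP[/subseq_K7_vertices/andP[us /allP s7] s5].
have s_lt i : (i < 5)%N -> (nth 0%N s i < 7)%N by move=> i5; apply: s7; rewrite mem_nth ?s5.
have s_neq i j : (i < 5)%N -> (j < 5)%N -> i != j -> nth 0%N s i != nth 0%N s j.
  by move=> i5 j5 ij; rewrite nth_uniq ?s5.
have := @K5_walk_parity _ _ D (fun i => m (nth 0%N s i)) (fun _ j => [:: m (nth 0%N s j)]).
rewrite /satisfies /xor_all /= !big_cons big_nil /walk_parity /chain_parity /= !big_seq1.
move=> K5; apply/eqP; apply: K5 => [i j /andP[ij j5]|i j /andP[ij j5]|].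
- have i5 := ltn_trans ij j5.
  by apply: adj_neq; rewrite m_adj ?s_lt // s_neq // ltn_eqF.
- have i5 := ltn_trans ij j5.
  by split=> //=; rewrite m_adj ?s_lt // s_neq // ltn_eqF.
have : all (fun ef => uniq [:: ef.1.1; ef.1.2; ef.2.1; ef.2.2] &&
                      all (gtn 5) [:: ef.1.1; ef.1.2; ef.2.1; ef.2.2])
  (K5_pairs 0 1 2 3 4)%N by [].
move=> /allP range [[i j] [k l]] /range /= /andP[].
rewrite !inE !negb_or => /and4P[/and3P[ij ik il] /andP[jk jl] kl _] /and5P[i5 j5 k5 l5 _].
have neq a b : (a < 5)%N -> (b < 5)%N -> a != b -> m (nth 0%N s b) != m (nth 0%N s a).
  by move=> a5 b5 ab; rewrite eq_sym; apply: adj_neq; rewrite m_adj ?s_lt ?s_neq.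
by rewrite !neq.
Qed.

Lemma triangle_constraint_parity s t :
  s \in subseqs_of_size 3 K7_vertices -> t \in subseqs_of_size 3 K7_vertices ->
  ~~ has (mem s) t -> satisfies pair_parity (triangle_constraint s t).
Proof.
move=> /subseqs_of_sizeP[/subseq_K7_vertices + s3] /subseqs_of_sizeP[/subseq_K7_vertices + t3].
case: s s3 => [|a [|b [|c []]]] // _; case: t t3 => [|a' [|b' [|c' []]]] // _.
move=> sK tK disj.
have adj_m (r : seq nat) i j : uniq r && all (gtn 7) r -> (i, j) \in triangle_edges r -> adj (m i) (m j).
  move=> /andP[ur /allP r7] /(triangle_edgesP ur)[/r7 i7 /r7 j7 ij].
  exact: m_adj.
rewrite /satisfies /= !pair_parity_canonical.
2-10: by apply: triangle_edges_independent sK tK disj _ _; rewrite !inE eqxx ?orbT.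
have := @triangle_edge_parity _ _ D (m a) (m b) (m c) (m a') (m b') (m c').
rewrite walk_parityE /= !big_cons !big_nil /= !addbF !addbA => -> //.
- by apply: adj_m sK _; rewrite !inE eqxx.
- by apply: adj_m sK _; rewrite !inE eqxx orbT.
- by apply: adj_m sK _; rewrite !inE eqxx !orbT.
- by apply: adj_m tK _; rewrite !inE eqxx.
- by apply: adj_m tK _; rewrite !inE eqxx orbT.
- by apply: adj_m tK _; rewrite !inE eqxx !orbT.
have : uniq (map m ([:: a; b; c] ++ [:: a'; b'; c'])).
  apply: m_uniq; rewrite cat_uniq all_cat disj.
  by move: sK tK => /andP[-> ->] /andP[-> ->].
by rewrite map_cat cat_uniq => /and3P[].
Qed.

Definition crossed i j : Prop := exists k l,
  independent_pair ((k, l), (i, j)) /\ edge_parity D (m k) (m l) (m i) (m j).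

Let no_conflict v w : independent_pair v -> independent_pair w ->
  pair_parity v -> pair_parity w -> ~~ conflict v w.
Proof.
have fan e f g : independent_pair (e, g) -> independent_pair (f, g) ->
    pair_parity (e, g) -> pair_parity (f, g) -> ~~ disjoint_edges e f.
  case: e f g => [i j] [k l] [p q] eg fg he hf.
  have [[ij pq u1] [kl _ u2]] := (pair_adj eg, pair_adj fg).
  apply: contra (crossing_edges_adjacent noI pq ij kl u1 u2 he hf) => disj.
  apply: (m_uniq (s := [:: i; j; k; l])); rewrite [uniq _]disj.
  by move: eg fg => /andP[_ /and5P[/= -> -> _ _ _]] /andP[_ /and5P[/= -> -> _ _ _]].
case: v w => [e f] [e' f'] vi wi vp wp.
have [vi' wi'] : independent_pair (f, e) /\ independent_pair (f', e').
  by split; rewrite independent_pairC.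
have [vp' wp'] : pair_parity (f, e) /\ pair_parity (f', e').
  by split; rewrite -pair_parityC.
rewrite /conflict /=; apply/negP => /or4P[] /andP[/eqP E]; apply/negP; subst.
- exact: fan vi' wi' vp' wp'.
- exact: fan vi' wi vp' wp.
- exact: fan vi wi' vp wp'.
- exact: fan vi wi vp wp.
Qed.

Lemma K7_cut_crossed (A : nat -> bool) i j : (i < 7)%N -> (j < 7)%N -> A i -> ~~ A j ->
  exists i' j', [/\ (i' < 7)%N, (j' < 7)%N, A i', ~~ A j' & crossed i' j'].
Proof.
move=> i7 j7 Ai Aj.
have [|||||[e f] /K7_pairsP indep /andP[ef cut]] := @crossing_over_cut pair_parity A i j.
- move=> c; rewrite mem_cat => /orP[/mapP[s sK ->]|/mapP[[s t]]]; first exact: K5_constraint_parity.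
  rewrite mem_filter => /andP[/andP[_ disj] /allpairsP[[s' t'] [/= sK tK [Es Et]]]] ->.
  by move: disj; rewrite Es Et; exact: triangle_constraint_parity.
- by move=> v w /K7_pairsP vi /K7_pairsP wi; exact: no_conflict.
- exact: i7.
- exact: j7.
- by rewrite Ai (negPf Aj).
have oriented e' f' : independent_pair (e', f') -> pair_parity (e', f') -> A e'.1 != A e'.2 ->
    exists i' j', [/\ (i' < 7)%N, (j' < 7)%N, A i', ~~ A j' & crossed i' j'].
  case: e' f' => [i' j'] [k l] indep' parity' /=.
  have [i'7 j'7] : (i' < 7)%N /\ (j' < 7)%N by move: indep' => /andP[_ /and5P[]].
  have [crossed_ij crossed_ji] : crossed i' j' /\ crossed j' i'.
    split; exists k, l; rewrite independent_pairC ?(independent_pair_swap j'); split=> //.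
      by rewrite -[edge_parity _ _ _ _ _]/(pair_parity ((k, l), (i', j'))) -pair_parityC.
    rewrite -[edge_parity _ _ _ _ _]/(pair_parity ((k, l), (j', i'))) -pair_parityC.
      by rewrite /pair_parity /= -edge_parity_swap //; have [] := pair_adj indep'.
    by rewrite -independent_pair_swap.
  case Ai' : (A i'); case Aj' : (A j') => // _; first by exists i', j'; rewrite Ai' Aj'.
  by exists j', i'; rewrite Ai' Aj'.
case/orP: cut; first exact: oriented ef.
have indepC : independent_pair (f, e) by rewrite independent_pairC.
by apply: (oriented _ _ indepC); rewrite -pair_parityC.
Qed.

Definition crossed_edge : rel 'I_7 := fun i j => (i != j) && `[< crossed i j >].

Lemma K7_crossed_connected i j : connect crossed_edge i j.
Proof.
apply: contrapT => /negP unconnected.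
pose A k := if insub k is Some o then connect crossed_edge i o else false.
have AE (o : 'I_7) : A o = connect crossed_edge i o by rewrite /A valK.
have [||i' [j' [i'7 j'7 Ai' Aj' c]]] := @K7_cut_crossed A _ _ (ltn_ord i) (ltn_ord j).
- by rewrite AE connect0.
- by rewrite AE.
move: (Ai') (Aj'); rewrite (AE (Ordinal i'7)) (AE (Ordinal j'7)) => ii' /negP; apply.
apply: connect_trans ii' (connect1 _); apply/andP; split; last exact/asboolP.
by apply: contraNneq Aj' => - [] <-.
Qed.

End K7.

Section Thick.
Variables (R : realType) (G : sgraph) (D : drawing R G).
Hypothesis noI : forall e e1 e2, ~ pattern_I D e e1 e2.
Implicit Types (u v w x y p q : G) (M ps qs : seq G) (s t : R).

(* By Pattern (I), an edge that crosses [uv] then shares an endpoint with [pq]. *)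
Definition protected M u v : Prop :=
  exists p q, [/\ p \in M, q \in M, adj p q, uniq [:: p; q; u; v] & edge_parity D p q u v].

Definition thick M x ps : Prop :=
  [/\ path (@adj G) x ps, all (mem M) (x :: ps) &
      {in steps x ps, forall e, protected M e.1 e.2}].

Definition linked M x y : Prop := exists2 ps, thick M x ps & last x ps = y.

Lemma K7_linked M x y : uniq M -> size M = 7%N -> {in M &, forall u v, u != v -> adj u v} ->
  x \in M -> y \in M -> linked M x y.
Proof.
move=> uM sM clique xM yM; pose m i := nth x M i.
have mM i : (i < 7)%N -> m i \in M by move=> i7; rewrite mem_nth // sM.
have m_adj i j : (i < 7)%N -> (j < 7)%N -> i != j -> adj (m i) (m j).
  by move=> i7 j7 ij; apply: clique; rewrite ?mM // nth_uniq // sM.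
have m_inj : {in gtn 7 &, injective m}.
  by move=> i j i7 j7 /eqP; rewrite nth_uniq ?sM // => /eqP.
have [ix iy] : (index x M < 7)%N /\ (index y M < 7)%N by rewrite -sM !index_mem.
pose vertex (i : 'I_7) := m i.
have vertexE z (iz : (index z M < 7)%N) : z \in M -> vertex (Ordinal iz) = z.
  by move=> zM; rewrite /vertex /m nth_index.
have vertex_adj i j : crossed_edge D m i j -> adj (vertex i) (vertex j) by move=> /andP[ij _]; exact: m_adj.
have vertex_protected i j : crossed_edge D m i j -> protected M (vertex i) (vertex j).
  move=> /andP[_ /asboolP[k [l [indep parity]]]]; exists (m k), (m l).
  move: (indep) => /andP[_ /and5P[/= k7 l7 _ _ _]].
  have [u /allP lt7] := andP indep.
  have kl : k != l by move: u; rewrite /= !inE !negb_or => /andP[/and3P[]].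
  have m_indep : uniq [:: m k; m l; vertex i; vertex j].
    rewrite -[X in uniq X]/(map m [:: k; l; i : nat; j : nat]) map_inj_in_uniq //.
    by move=> a b /lt7 a7 /lt7 b7; exact: m_inj.
  by split; [exact: mM k7|exact: mM l7|exact: m_adj k7 l7 kl|exact: m_indep|exact: parity].
have /connectP[c rc cy] := K7_crossed_connected noI m_adj (Ordinal ix) (Ordinal iy).
exists (map vertex c); last first.
  by rewrite -{1}(vertexE x ix xM) last_map -cy vertexE.
rewrite -{1}(vertexE x ix xM); split.
- by apply: homo_path rc => i j; exact: vertex_adj.
- by rewrite /= vertexE ?xM //; apply/allP => w /mapP[i _ ->]; exact: mM.
pose e u v := `[< protected M u v >].
have pe : path e (vertex (Ordinal ix)) (map vertex c).
  by apply: homo_path rc => i j rij; apply/asboolP; exact: vertex_protected.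
by move=> [u v] /(path_step pe)/asboolP.
Qed.

Lemma thick_cat M M' x ps qs : thick M x ps -> thick M' (last x ps) qs ->
  thick (M ++ M') x (ps ++ qs).
Proof.
have weaken N N' u v : {subset N <= N'} -> protected N u v -> protected N' u v.
  by move=> NN' [p [q [/NN' ? /NN' ? ? ? ?]]]; exists p, q.
move=> [a1 m1 p1] [a2 m2 p2]; split.
- by rewrite cat_path a1.
- rewrite -cat_cons all_cat; apply/andP; split.
    by apply: sub_all m1 => w /= wM; rewrite mem_cat wM.
  by case/andP: m2 => _; apply: sub_all => w /= wM; rewrite mem_cat wM orbT.
move=> e; rewrite /steps pairmap_cat mem_cat => /orP[/p1|/p2]; apply: weaken => w wM;
  by rewrite mem_cat wM ?orbT.
Qed.

Lemma linked_cat M M' x y z : linked M x y -> linked M' y z -> linked (M ++ M') x z.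
Proof.
move=> [ps tp <-] [qs tq <-]; exists (ps ++ qs); last by rewrite last_cat.
exact: thick_cat.
Qed.

Lemma notin_neq M u v : u \in M -> v \notin M -> u != v.
Proof. by move=> uM; apply: contraNneq => <-. Qed.

Lemma uniq4_notin M u v p q : u \in M -> v \in M -> p \notin M -> q \notin M -> u != v -> p != q ->
  uniq [:: u; v; p; q].
Proof.
by move=> uM vM pM qM uv pq; rewrite /= !inE !negb_or uv pq !(notin_neq (M := M)).
Qed.

Lemma thick_step M x ps u v : thick M x ps -> (u, v) \in steps x ps ->
  [/\ adj u v, u \in M, v \in M & protected M u v].
Proof.
move=> [a /allP m prot] uv; have [/= ux vx] := mem_steps uv.
by split; [exact: (path_step a uv)|exact: m|exact: m|exact: prot uv].
Qed.

Lemma thick_uncrossed M x ps u v p q : thick M x ps -> (u, v) \in steps x ps ->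
  adj p q -> p \notin M -> q \notin M -> edge_parity D u v p q = false.
Proof.
move=> T uvs pq pM qM; have [uv uM vM [y [z [yM zM yz indep yz_uv]]]] := thick_step T uvs.
have indep' := uniq4_notin uM vM pM qM (adj_neq uv) (adj_neq pq).
apply/negP; rewrite edge_parityC // => pq_uv.
have [indep'' _] := uniq4_symmetry indep'.
have := crossing_edges_adjacent noI uv pq yz indep'' indep pq_uv yz_uv => /negP; apply.
by have [] := uniq4_symmetry (uniq4_notin yM zM pM qM (adj_neq yz) (adj_neq pq)).
Qed.

Lemma thick_walk_uncrossed M x ps p q s t : thick M x ps -> adj p q -> p \notin M -> q \notin M ->
  0 <= s -> s <= t -> t <= 1 ->
  {in walk D x ps, forall k, crossing_parity k (subarc D p q s t) = false /\
                             crossing_parity (subarc D p q s t) k = false}.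
Proof.
move=> T pq pM qM s0 st t1 k kw; have [a _ _] := T.
have [u [v [uvs uv ->]]] := walkP a kw; have [_ uM vM _] := thick_step T uvs.
have indep := uniq4_notin uM vM pM qM (adj_neq uv) (adj_neq pq).
have uncrossed := thick_uncrossed T uvs pq pM qM.
split; first exact: subarc_parity_uncrossed.
apply: subarc_parity_uncrossed => //; first by case: (uniq4_symmetry indep).
by rewrite -edge_parityC.
Qed.

Lemma thick_walk_parity M M' x ps y qs : thick M x ps -> path (@adj G) y qs ->
  all (mem M') (y :: qs) -> ~~ has (mem M) M' ->
  walk_parity D x ps y qs = false /\ walk_parity D y qs x ps = false.
Proof.
move=> T a /allP M'qs /hasPn disj.
have uncrossed k l : k \in walk D x ps -> l \in walk D y qs ->
    crossing_parity k l = false /\ crossing_parity l k = false.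
  move=> kw /(walkP a)[u [v [/mem_steps[/= /M'qs/disj uM /M'qs/disj vM] uv ->]]].
  exact: thick_walk_uncrossed T uv uM vM _ _ _ _ kw.
by split; apply: chain_parity_eq0 => k l kw lw; [exact: (uncrossed k l kw lw).1|exact: (uncrossed l k lw kw).2].
Qed.

Local Open Scope nat_scope.

Lemma K5_walks_exist (v : nat -> G) (M : nat -> nat -> seq G) ps qs :
  joined (v 0) ps (v 1) -> all (mem (M 0 1)) (v 0 :: ps) ->
  joined (v 2) qs (v 3) -> all (mem (M 2 3)) (v 2 :: qs) ->
  (forall i j, i < j < 5 -> (i, j) \notin [:: (0, 1); (2, 3)] -> linked (M i j) (v i) (v j)) ->
  exists P : nat * nat -> seq G, [/\ P (0, 1) = ps, P (2, 3) = qs &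
    forall e, e.1 < e.2 < 5 ->
      [/\ joined (v e.1) (P e) (v e.2), all (mem (M e.1 e.2)) (v e.1 :: P e) &
          e \notin [:: (0, 1); (2, 3)] -> thick (M e.1 e.2) (v e.1) (P e)]].
Proof.
move=> jp pM jq qM links.
have /choice[P PP] : forall e : nat * nat, exists rs, e.1 < e.2 < 5 ->
    [/\ joined (v e.1) rs (v e.2), all (mem (M e.1 e.2)) (v e.1 :: rs),
        e \notin [:: (0, 1); (2, 3)] -> thick (M e.1 e.2) (v e.1) rs,
        e = (0, 1) -> rs = ps & e = (2, 3) -> rs = qs].
  move=> [i j]; have [[-> ->]|n01] := eqVneq (i, j) (0, 1); first by exists ps.
  have [[-> ->]|n23] := eqVneq (i, j) (2, 3); first by exists qs.
  have [/= ij|nij] := boolP (i < j < 5); last by exists [::] => ij; case/negP: nij.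
  have [|rs T <-] := links i j ij; first by rewrite !inE negb_or n01.
  have [a m _] := T; exists rs => _; split=> // E; first by rewrite E eqxx in n01.
  by rewrite E eqxx in n23.
have [[_ _ _ P01 _] [_ _ _ _ P23]] := (PP (0, 1) isT, PP (2, 3) isT).
by exists P; split=> [||e /PP[]//]; [exact: P01|exact: P23].
Qed.

Lemma linked_K5_parity (v : nat -> G) (M : nat -> nat -> seq G) ps qs :
  uniq (map v (iota 0 5)) ->
  joined (v 0) ps (v 1) -> all (mem (M 0 1)) (v 0 :: ps) ->
  joined (v 2) qs (v 3) -> all (mem (M 2 3)) (v 2 :: qs) ->
  (forall i j, i < j < 5 -> (i, j) \notin [:: (0, 1); (2, 3)] -> linked (M i j) (v i) (v j)) ->
  all (fun ef => ~~ has (mem (M ef.1.1 ef.1.2)) (M ef.2.1 ef.2.2)) (K5_pairs 0 1 2 3 4) ->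
  walk_parity D (v 0) ps (v 2) qs.
Proof.
move=> uv jp pM jq qM links /allP disj.
have [P [P01 P23 PP]] := K5_walks_exist jp pM jq qM links.
have /allP range : all (fun ef => (ef.1.1 < ef.1.2 < 5) && (ef.2.1 < ef.2.2 < 5)) (K5_pairs 0 1 2 3 4) by [].
have <- : \big[addb/false]_(ef <- K5_pairs 0 1 2 3 4)
    walk_parity D (v ef.1.1) (P (ef.1.1, ef.1.2)) (v ef.2.1) (P (ef.2.1, ef.2.2)) =
    walk_parity D (v 0) ps (v 2) qs.
  rewrite big_cons /= P01 P23 big1_seq ?addbF // => ef /andP[_ ef_rest].
  have /allP/(_ ef ef_rest) thick_pair : all (fun ef =>
      (ef.1 \notin [:: (0, 1); (2, 3)]) || (ef.2 \notin [:: (0, 1); (2, 3)]))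
      (behead (K5_pairs 0 1 2 3 4)) by [].
  have efK : ef \in K5_pairs 0 1 2 3 4 by rewrite inE ef_rest orbT.
  have /andP[e5 f5] := range ef efK; have nonadj := disj ef efK.
  have [[ae _] me Te] := PP _ e5; have [[af _] mf Tf] := PP _ f5.
  rewrite -!surjective_pairing.
  case/orP: thick_pair => [/Te|/Tf] T; first exact: (thick_walk_parity T af mf nonadj).1.
  by apply: (thick_walk_parity T ae me _).2; rewrite has_sym.
apply: (@K5_walk_parity _ _ D v (fun i j => P (i, j))).
- move=> i j /andP[ij j5]; have i5 := ltn_trans ij j5.
  have := nth_uniq (v 0) _ _ uv (i := i) (j := j).
  rewrite size_map size_iota !(nth_map 0) ?size_iota // !nth_iota // => -> //.
  by rewrite ltn_eqF.
- by move=> i j ij; have [] := PP (i, j) ij.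
move=> ef efK; have /andP[e5 f5] := range ef efK.
have [[_ /allP me _] [_ /allP mf _]] := (PP _ e5, PP _ f5).
rewrite -!surjective_pairing; apply/hasPn => w /mf wM.
by have /hasPn/(_ w wM) := disj ef efK; apply: contra => /me.
Qed.

End Thick.

(** * The two sides of the graph *)

Section EdgeCurves.
Variables (R : realType) (G : sgraph) (D : drawing R G).
Local Notation edge u v := [set u; v]%SET.
Local Notation edge_curve u v := (curve (arc D (edge u v))).
Implicit Types (u v x y p q : G) (r s t : R) (w : plane R) (L : seq (piece R)).

Lemma uncrossed_edge_curves u v p q w : adj u v -> adj p q -> uniq [:: u; v; p; q] ->
  edge_parity D u v p q = false -> edge_curve u v w -> ~ edge_curve p q w.
Proof.
by move=> uv pq indep uncrossed wu wp; move/negP: uncrossed; apply; apply/edge_parityP => //; exists w.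
Qed.

Lemma chain_winding_walk L x ps : valid_chain L -> closed_chain L -> path (@adj G) x ps ->
  (forall u v, (u, v) \in steps x ps -> forall w, edge_curve u v w -> ~ chain_support L w) ->
  chain_winding L (pos D x) = chain_winding L (pos D (last x ps)).
Proof.
move=> vL cL; elim: ps x => //= y ps IH x /andP[xy ys] disj; rewrite -IH //; last first.
  by move=> u v uv; apply: disj; rewrite inE uv orbT.
have [<- <-] := oriented_arc_ends D xy.
apply: (chain_winding_disjoint_piece vL cL (valid_subarc D xy (lexx _) ler01 (lexx _))).
move=> w /(subarc_on_curve (lexx _) (lexx _)); apply: disj; exact: mem_head.
Qed.

Lemma part_of_subarc u v s t : adj u v -> 0 <= s -> s <= t -> t <= 1 ->
  piece_image (subarc D u v s t) `<=` part (arc D (edge u v)) (oriented_arc D u v s) (oriented_arc D u v t).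
Proof.
move=> uv s0 st t1 _ /piece_imageP[r /= rI ->]; rewrite /oriented_arc; case: ifP => _.
  by exists s, t, r; rewrite !in_itv /= (min_l st) (max_r st); split=> //; lra.
exists (1 - s), (1 - t), (1 - r); rewrite !in_itv /= min_r ?max_l; [|lra..].
by split=> //; [lra|lra|split=> //; lra].
Qed.

Lemma partC (g : R -> plane R) (x y : plane R) : part g x y = part g y x.
Proof.
apply/seteqP; split=> z [s [t [r [sI tI gs gt rst]]]]; exists t, s, r; split=> //.
  by rewrite minC maxC.
by rewrite minC maxC.
Qed.

Lemma part_sub_curve (g : R -> plane R) (x y : plane R) : part g x y `<=` curve g.
Proof.
move=> z [s [t [r [sI tI _ _ [rI ->]]]]]; exists r => //=.
move: sI tI rI; rewrite !in_itv /= ge_min le_max => /andP[s0 s1] /andP[t0 t1].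
by move=> /andP[/orP[h1|h1] /orP[h2|h2]]; apply/andP; split; lra.
Qed.

Lemma part_end (g : R -> plane R) (x y : plane R) c : jordan_arc g -> c = 0 \/ c = 1 -> part g x y (g c) ->
  g c = x \/ g c = y.
Proof.
move=> [_ inj] c01 [s [t [r [sI tI gs gt [rst E]]]]].
have rI : r \in `[0, 1].
  move: sI tI rst; rewrite !in_itv /= ge_min le_max => sI tI.
  by move=> /andP[/orP[h1|h1] /orP[h2|h2]]; lra.
have cI : c \in `[0, 1] by rewrite in_itv /=; case: c01 => ->; lra.
rewrite -gs -gt; suff : s = c \/ t = c by case=> ->; [left|right].
have rc : r = c by apply: inj.
move: sI tI rst; rewrite !in_itv /= rc ge_min le_max.
by case: c01 => ->; case: (eqVneq s t) => [->|st];
  move=> ? ? /andP[/orP[h1|h1] /orP[h2|h2]]; (left; lra) || (right; lra).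
Qed.

Lemma start_notin_part u v s t : adj u v -> 0 < s <= 1 -> 0 < t <= 1 ->
  ~ part (arc D (edge u v)) (oriented_arc D u v s) (oriented_arc D u v t) (pos D u).
Proof.
move=> uv sI tI; have [<- _] := oriented_arc_ends D uv.
have [c c01 cE] : exists2 c, c = 0 \/ c = 1 & arc D (edge u v) c = oriented_arc D u v 0.
  rewrite /oriented_arc; case: ifP => _; first by exists 0; [left|].
  by exists 1; [right|rewrite subr0].
rewrite -cE => /(part_end (arc_jordan D (adj_is_edge uv)) c01); rewrite cE.
case=> E; [have : 0 = s|have : 0 = t]; try (by lra).
  by apply: (oriented_arc_inj uv) E; lra.
by apply: (oriented_arc_inj uv) E; lra.
Qed.

End EdgeCurves.

Section SideCurve.
Variables (R : realType) (G : sgraph) (D : drawing R G).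
Hypothesis strong : strongly_fan_planar_drawing D.
Local Notation edge u v := [set u; v]%SET.
Local Notation edge_curve u v := (curve (arc D (edge u v))).
Variables z u a b c d : G.
Hypothesis distinct : uniq [:: z; u; a; b; c; d].
Hypotheses (uc : adj u c) (ud : adj u d) (ab : adj a b) (az : adj a z).
Variables s1 t1 s2 t2 s3 t3 : R.
Hypotheses (s1I : 0 < s1 < 1) (t1I : 0 < t1 < 1) (s2I : 0 < s2 < 1) (t2I : 0 < t2 < 1)
  (s3I : 0 < s3 < 1) (t3I : 0 < t3 < 1).
Hypothesis uc_ab : oriented_arc D u c s1 = oriented_arc D a b t1.
Hypothesis uc_az : oriented_arc D u c s2 = oriented_arc D a z t2.
Hypothesis ud_ab : oriented_arc D u d s3 = oriented_arc D a b t3.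
Hypothesis az_first : s2 < s1.
Hypothesis az_ud : edge_parity D a z u d = false.

Let lo := Num.min t1 t3.
Let hi := Num.max t1 t3.

Definition side_chain : seq (piece R) := [:: subarc D u c 0 s1; subarc D a b lo hi; subarc D u d 0 s3].

Let lo_hi : [/\ 0 < lo, lo <= hi & hi < 1].
Proof.
have [/andP[t10 t11] /andP[t30 t31]] := (t1I, t3I).
by rewrite /lo /hi lt_min gt_max t10 t11 t30 t31 ge_min !le_max !lexx.
Qed.

Let crossing_points : (lo = t1 /\ hi = t3) \/ (lo = t3 /\ hi = t1).
Proof. by rewrite /lo /hi; have [|] := leP t1 t3; [left|right]. Qed.

Let crossing_range : lo <= t1 <= hi /\ lo <= t3 <= hi.
Proof. by rewrite /lo /hi !ge_min !le_max !lexx !orbT. Qed.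

Let vertices : [/\ [/\ z != u, z != a, z != b, z != c & z != d], [/\ u != a, u != b, u != c & u != d],
  [/\ a != b, a != c & a != d] & [/\ b != c, b != d & c != d]].
Proof.
move: distinct; rewrite /= !inE !negb_or -!andbA.
by move=> /and5P[? ? ? ? /and5P[? ? ? ? /and5P[? ? ? ? /and4P[? ? ? _]]]].
Qed.

Lemma mem_side_chain q : q \in side_chain ->
  [\/ q = subarc D u c 0 s1, q = subarc D a b lo hi | q = subarc D u d 0 s3].
Proof. by rewrite !inE => /or3P[] /eqP ->; [constructor 1|constructor 2|constructor 3]. Qed.

Lemma valid_side_chain : valid_chain side_chain.
Proof.
have [lo0 lohi hi1] := lo_hi.
(* [lra] does not see section hypotheses. *)
have [s1J s3J] := (s1I, s3I).
by move=> q /mem_side_chain[] ->; apply: valid_subarc => //; lra.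
Qed.

Lemma closed_side_chain : closed_chain side_chain.
Proof.
apply: (@joins_closed _ _ (pos D u)) => phi.
have [[u0 _] [u0' _]] := (oriented_arc_ends D uc, oriented_arc_ends D ud).
rewrite !big_cons big_nil /source /target /= u0 u0' uc_ab ud_ab.
by case: crossing_points => -[-> ->]; xor_ring.
Qed.

Lemma side_chain_support : chain_support side_chain =
  piece_image (subarc D u c 0 s1) `|` piece_image (subarc D a b lo hi) `|`
  piece_image (subarc D u d 0 s3).
Proof.
by rewrite /chain_support bigcup_seq !big_cons big_nil setU0 setUA.
Qed.

Lemma side_chain_connected : connected (chain_support side_chain).
Proof.
have valid q : q \in side_chain -> connected (piece_image q).
  by move=> /valid_side_chain; exact: piece_image_connected.
have [lo0 lohi hi1] := lo_hi.
have [s1J s3J] := (s1I, s3I).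
have [t1J _] := crossing_range.
rewrite side_chain_support; apply: connectedU; [|apply: connectedU|].
- have [[u0 _] [u0' _]] := (oriented_arc_ends D uc, oriented_arc_ends D ud).
  exists (pos D u); split; first by left; rewrite -u0; apply: mem_piece_image => /=; lra.
  by rewrite -u0'; apply: mem_piece_image => /=; lra.
- exists (oriented_arc D u c s1); split; first by apply: mem_piece_image => /=; lra.
  by rewrite uc_ab; exact: mem_piece_image.
- by apply: valid; rewrite !inE eqxx.
- by apply: valid; rewrite !inE eqxx orbT.
- by apply: valid; rewrite !inE eqxx !orbT.
Qed.

Lemma apex_in_side_chain : chain_support side_chain (pos D u).
Proof.
rewrite side_chain_support; left; left; have [<- _] := oriented_arc_ends D uc.
have s1J := s1I.
by apply: mem_piece_image => /=; lra.
Qed.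

Lemma side_chain_sub_curves :
  chain_support side_chain `<=` edge_curve u c `|` edge_curve a b `|` edge_curve u d.
Proof.
have [lo0 lohi hi1] := lo_hi; have [s1J s3J] := (s1I, s3I); rewrite side_chain_support.
by apply: setUSS; [apply: setUSS|]; apply: subarc_on_curve; lra.
Qed.

Let indep_uc_ab : uniq [:: u; c; a; b].
Proof. exact: (@uniq_map_nth _ z _ [:: 1; 4; 2; 3]%N distinct). Qed.

Let indep_ud_ab : uniq [:: u; d; a; b].
Proof. exact: (@uniq_map_nth _ z _ [:: 1; 5; 2; 3]%N distinct). Qed.

Let indep_az_uc : uniq [:: a; z; u; c].
Proof. exact: (@uniq_map_nth _ z _ [:: 2; 0; 1; 4]%N distinct). Qed.

Let indep_az_ud : uniq [:: a; z; u; d].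
Proof. exact: (@uniq_map_nth _ z _ [:: 2; 0; 1; 5]%N distinct). Qed.

Lemma side_chain_winding_lmid : chain_winding side_chain (pos D a) = false.
Proof.
have [lo0 lohi hi1] := lo_hi; have [_ [ua _ _ _] [ab_neq ac ad] [_ _ cd]] := vertices.
have [s1J s3J t1J t3J] := And4 s1I s3I t1I t3I.
have [[u0 _] [u0' _]] := (oriented_arc_ends D uc, oriented_arc_ends D ud).
pose Z := closed_curve D (edge a b) (edge u c) (edge u d) u
  (oriented_arc D u c s1) (oriented_arc D u d s3).
have support_Z : chain_support side_chain `<=` Z.
  rewrite side_chain_support /Z /closed_curve; apply: setUSS; [apply: setUSS|].
  - by rewrite -u0; apply: part_of_subarc => //; lra.
  - rewrite uc_ab ud_ab; have := part_of_subarc ab (ltW lo0) lohi (ltW hi1).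
    by case: crossing_points => -[-> ->]; rewrite // partC.
  - by rewrite -u0' partC; apply: part_of_subarc => //; lra.
have a_off : ~ Z (pos D a).
  move=> [[/part_sub_curve/(vertex_on_edge_curve uc)|]|/part_sub_curve/(vertex_on_edge_curve ud)].
  - by rewrite (eq_sym a) (negPf ua) (negPf ac).
  - by rewrite uc_ab ud_ab; apply: start_notin_part => //; lra.
  - by rewrite (eq_sym a) (negPf ua) (negPf ad).
apply: (chain_winding_unbounded valid_side_chain closed_side_chain support_Z a_off) => bounded.
have cross_uc : crosses_at D (edge u c) (edge a b) (oriented_arc D u c s1).
  split; [exact: adj_is_edge..|exact: uniq_edge_neq|].
  apply: independent_arcs_cross => //; first by apply: oriented_arc_on_curve; lra.
  by rewrite uc_ab; apply: oriented_arc_on_curve; lra.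
have cross_ud : crosses_at D (edge u d) (edge a b) (oriented_arc D u d s3).
  split; [exact: adj_is_edge..|exact: uniq_edge_neq|].
  apply: independent_arcs_cross => //; first by apply: oriented_arc_on_curve; lra.
  by rewrite ud_ab; apply: oriented_arc_on_curve; lra.
apply: (strongly_fan_planar_outside (v := a) strong cross_uc cross_ud) => //.
- apply: contraNneq cd => E; have : c \in edge u d by rewrite -E !inE eqxx orbT.
  by rewrite !inE (eq_sym c) (negPf (adj_neq uc)).
- exact: set21.
- exact: set21.
- exact: set21.
- by split.
Qed.

Lemma side_chain_winding_center : chain_winding side_chain (pos D z) = true.
Proof.
have [lo0 lohi hi1] := lo_hi; have [[zu za zb _ _] [ua _ _ _] _ _] := vertices.
have [s1J s2J s3J t2J] := And4 s1I s2I s3I t2I.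
have first := az_first.
pose p := subarc D a z 0 1; have vp : valid_piece p by exact: valid_subarc.
have [a0 z1] := oriented_arc_ends D az.
have off_ab r : lo <= r <= hi -> ~ piece_image p (oriented_arc D a b r).
  move=> rI /piece_imageP[r' /= r'I E].
  have : r = 0 by apply: (adjacent_arcs_meet ab az _ _ _ r'I E);
    [exact: mem_head|rewrite !inE negb_or eq_sym (adj_neq ab) eq_sym|lra].
  by lra.
have off_u : ~ piece_image p (pos D u) by apply: vertex_notin_subarc; rewrite // eq_sym.
have [[u0 _] [u0' _]] := (oriented_arc_ends D uc, oriented_arc_ends D ud).
have [t1R t3R] := crossing_range; have loJ : lo <= lo <= hi by rewrite lexx.
have hiJ : lo <= hi <= hi by rewrite lexx lohi.
have avoid : avoids_ends [:: p] side_chain.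
  move=> q q'; rewrite mem_seq1 => /eqP -> /mem_side_chain[] ->; rewrite /source /target /= ?u0 ?u0'.
  - by split; [|rewrite uc_ab; exact: off_ab].
  - by split; exact: off_ab.
  - by split; [|rewrite ud_ab; exact: off_ab].
have valid_p : valid_chain [:: p] by move=> q; rewrite mem_seq1 => /eqP ->.
have := chain_parity_closed valid_p avoid (@joins_piece _ p) closed_side_chain.
rewrite /source /target /= a0 z1 side_chain_winding_lmid addFb => <-.
have cross : crossing_parity p (subarc D u c 0 s1).
  by apply: (subarc_parity_crossing (s := t2) (t := s2)) => //; rewrite ?lexx ?ler01 //; lra.
have uncross : crossing_parity p (subarc D u d 0 s3) = false.
  by apply: subarc_parity_uncrossed => //; lra.
have disjoint_ab : crossing_parity p (subarc D a b lo hi) = false.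
  apply: crossing_parity_disjoint => //; first by apply: valid_subarc => //; lra.
  by move=> w pw /piece_imageP[r rI wE]; apply: (off_ab r rI); rewrite -[oriented_arc _ _ _ _]wE.
by rewrite /chain_parity big_seq1 !big_cons big_nil cross uncross disjoint_ab.
Qed.

End SideCurve.

Section FirstCrossing.
Variables (R : realType) (G : sgraph) (D : drawing R G).
Hypothesis noI : forall e e1 e2, ~ pattern_I D e e1 e2.
Variables (z u a b c : G) (M N ps qs : seq G).
Hypotheses (uc : adj u c) (ab : adj a b) (az : adj a z) (indep : uniq [:: u; c; a; z]).
Hypotheses (thick_zu : thick D M z ps) (last_u : last z ps = u).
Hypotheses (thick_ba : thick D N b qs) (last_a : last b qs = a).
Hypotheses (disjoint : ~~ has (mem M) N) (cN : c \notin N).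
Variables s1 t1 s2 t2 : R.
Hypotheses (s1I : 0 < s1 < 1) (t1I : 0 < t1 < 1) (s2I : 0 < s2 < 1) (t2I : 0 < t2 < 1).
Hypothesis uc_ab : oriented_arc D u c s1 = oriented_arc D a b t1.
Hypothesis uc_az : oriented_arc D u c s2 = oriented_arc D a z t2.

Let near_loop := subarc D u c 0 s2 :: subarc D a z t2 1 :: walk D z ps.
Let far_loop := walk D a (b :: qs).

Let far_path : path (@adj G) a (b :: qs).
Proof. by have [+ _ _] := thick_ba; rewrite /= ab. Qed.

Let far_vertex w : w \in a :: b :: qs -> w \in N.
Proof.
have [_ /allP qsN _] := thick_ba; rewrite inE => /orP[/eqP ->|/qsN //].
by rewrite -last_a; apply: qsN; exact: mem_last.
Qed.

Let far_notin w : w \in N -> [/\ w \notin M, w != u, w != c & w != z].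
Proof.
have [_ /allP psM _] := thick_zu; move=> wN; have wM := hasPn disjoint w wN.
split=> //; [|by apply: contraNneq cN => <-|]; apply: contraNneq wM => ->; apply: psM.
  by rewrite -last_u mem_last.
exact: mem_head.
Qed.

Let far_edge k : k \in far_loop ->
  exists x y, [/\ x \in N, y \in N, adj x y & k = subarc D x y 0 1].
Proof.
by move=> /(walkP far_path)[x [y [/mem_steps[/far_vertex xN /far_vertex yN] xy ->]]]; exists x, y.
Qed.

Let near_path : path (@adj G) z ps.
Proof. by have [] := thick_zu. Qed.

Lemma valid_near_loop : valid_chain near_loop.
Proof.
have [s2J t2J] := (s2I, t2I).
move=> k; rewrite !inE => /or3P[/eqP ->|/eqP ->|]; [apply: valid_subarc => //; lra..|].
exact: valid_walk.
Qed.

Lemma closed_near_loop : closed_chain near_loop.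
Proof.
have [[u0 _] [_ z1]] := (oriented_arc_ends D uc, oriented_arc_ends D az).
apply: (@joins_closed _ _ (pos D u)) => phi; rewrite !big_cons (joins_walk D near_path phi) last_u.
by rewrite /source /target /= u0 z1 uc_az; xor_ring.
Qed.

Lemma closed_far_loop : closed_chain far_loop.
Proof. by have := joins_walk D far_path; rewrite [last _ _]last_a => /joins_closed. Qed.

Lemma near_loop_avoids_ends : avoids_ends near_loop far_loop.
Proof.
have [s2J t2J] := (s2I, t2I).
apply: avoids_ends_walk far_path _ => k kL w /far_vertex/far_notin[wM wu wc wz].
move: kL; rewrite !inE => /or3P[/eqP ->|/eqP ->|kw].
- by apply: vertex_notin_subarc => //; lra.
- have [->|wa] := eqVneq w a; first by apply: start_notin_subarc => //; lra.
  by apply: vertex_notin_subarc => //; lra.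
have [x [y [xys xy ->]]] := walkP near_path kw; have [_ xM yM _] := thick_step thick_zu xys.
by apply: vertex_notin_subarc => //; [apply: contraNneq wM => -> ..].
Qed.

Lemma center_arc_uncrossed : {in far_loop, forall k, crossing_parity (subarc D a z t2 1) k = false}.
Proof.
have [s2J t2J] := (s2I, t2I).
move=> k /far_edge[x [y [xN yN xy ->]]].
have [[_ xu xc xz] [_ yu yc yz]] := (far_notin xN, far_notin yN).
have zxy : z \notin [:: x; y] by rewrite !inE !(eq_sym z) negb_or xz.
have [axy|axy] := boolP (a \in [:: x; y]).
  apply: crossing_parity_disjoint; [apply: valid_subarc => //; lra..|].
  move=> w /piece_imageP[r /= rI ->] /piece_imageP[r' /= r'I E].
  have : r = 0 by apply: (adjacent_arcs_meet az xy axy zxy _ _ E); lra.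
  lra.
have azxy : uniq [:: a; z; x; y].
  by move: axy zxy; rewrite /= !inE !negb_or (adj_neq az) (adj_neq xy) => /andP[-> ->] /andP[-> ->].
apply: subarc_parity_uncrossed => //; [|lra..].
have [xyaz _] := uniq4_symmetry azxy; apply/negP; rewrite edge_parityC // => xy_az.
have uc_crosses_az : edge_parity D u c a z.
  apply/edge_parityP => //; exists (oriented_arc D u c s2).
  by split; [|rewrite uc_az]; apply: oriented_arc_on_curve; lra.
have /negP := crossing_edges_adjacent noI az uc xy indep xyaz uc_crosses_az xy_az; apply.
by rewrite /= !inE !negb_or (adj_neq uc) (adj_neq xy) !(eq_sym u) !(eq_sym c) xu yu xc yc.
Qed.

Lemma near_walk_uncrossed : {in walk D z ps & far_loop, forall k l, crossing_parity k l = false}.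
Proof.
move=> k l kw /far_edge[x [y [xN yN xy ->]]].
have [[xM _ _ _] [yM _ _ _]] := (far_notin xN, far_notin yN).
by have [] := thick_walk_uncrossed noI thick_zu xy xM yM (lexx _) ler01 (lexx _) kw.
Qed.

(* If [ab] came first, [uc] would cross the loop through [ab] once before it meets [az], which leads
   back to [u] without any further crossing. *)
Lemma first_crossing : s2 < s1.
Proof.
have [[s1J t1J] [s2J t2J]] := ((s1I, t1I), (s2I, t2I)).
have uN : u \notin N by apply/negP => /far_notin[_ /eqP].
have ucab : uniq [:: u; c; a; b].
  have [_ au ac _] := far_notin (far_vertex (mem_head _ _)).
  have bN : b \in N by apply: far_vertex; rewrite !inE eqxx orbT.
  have [_ bu bc _] := far_notin bN.
  by rewrite /= !inE !negb_or (adj_neq uc) (adj_neq ab) !(eq_sym u) !(eq_sym c) au ac bu bc.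
rewrite ltNge; apply/negP; rewrite le_eqVlt => /orP[/eqP s12|s12].
  have : t2 = 0; last by lra.
  apply: (@adjacent_arcs_meet _ _ D a z a b t2 t1 az ab); rewrite -?uc_ab -?uc_az ?s12 //; try lra.
    exact: mem_head.
  have [|_ _ _ az_neq] := far_notin (w := a); first exact/far_vertex/mem_head.
  have [|_ _ _ bz_neq] := far_notin (w := b); first by apply: far_vertex; rewrite !inE eqxx orbT.
  by rewrite !inE !(eq_sym z) negb_or az_neq.
have := closed_chain_parity valid_near_loop near_loop_avoids_ends closed_near_loop closed_far_loop.
have parity_cons k L :
    chain_parity (k :: L) far_loop = chain_parity [:: k] far_loop (+) chain_parity L far_loop.
  by rewrite /chain_parity big_cons big_seq1.
rewrite /near_loop parity_cons (parity_cons (subarc D a z t2 1)).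
rewrite [X in _ (+) (X (+) _)]chain_parity_eq0; last first.
  by move=> k l; rewrite mem_seq1 => /eqP ->; exact: center_arc_uncrossed.
rewrite [X in _ (+) (_ (+) X)]chain_parity_eq0; last exact: near_walk_uncrossed.
rewrite /chain_parity big_seq1 big_cons.
rewrite (subarc_parity_crossing (s := s1) (t := t1) uc ab ucab) ?lexx ?ler01 //; try lra.
rewrite big1_seq // => k /andP[_ kw].
have [s20 s21] : 0 <= s2 /\ s2 <= 1 by lra.
by have [_ ->] := thick_walk_uncrossed noI thick_ba uc uN cN (lexx _) s20 s21 kw.
Qed.

End FirstCrossing.

(* The vertices [o u a b c d] of a side, in this order. *)
Record side (T : Type) := Side { hub : T; apex : T; lmid : T; rmid : T; lbase : T; rbase : T }.

Definition mirror (T : Type) (s : side T) : side T :=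
  Side (hub s) (apex s) (rmid s) (lmid s) (rbase s) (lbase s).

Section Layout.
Variables (G : sgraph) (gad : G -> G -> seq G) (thick_edge : rel G) (z : G).
Implicit Types (x : G) (v ps qs : seq G) (s : side G) (i j : nat).

Definition route_support x ps : seq G := flatten [seq gad e.1 e.2 | e <- steps x ps].

Definition route v (detour : (nat * nat) * G) i j : seq G :=
  rcons (if (i, j) == detour.1 then [:: detour.2] else [::]) (nth z v j).

Definition K5_support v detour ps qs i j : seq G :=
  if (i, j) == (0, 1)%N then nth z v 0 :: ps
  else if (i, j) == (2, 3)%N then nth z v 2 :: qs
  else route_support (nth z v i) (route v detour i j).

(* A subdivided K5 on [v], given by the walks [ps] and [qs] for its edges 01 and 23 and by thick routes
   for the others, of which one takes a detour. *)
Definition K5_layout v detour ps qs : bool :=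
  [&& uniq (map (nth z v) (iota 0 5)),
      path (@adj G) (nth z v 0) ps && (last (nth z v 0) ps == nth z v 1),
      path (@adj G) (nth z v 2) qs && (last (nth z v 2) qs == nth z v 3),
      all (fun ij => path thick_edge (nth z v ij.1) (route v detour ij.1 ij.2))
        [:: (0, 2); (0, 3); (0, 4); (1, 2); (1, 3); (1, 4); (2, 4); (3, 4)]%N &
      all (fun ef => ~~ has (mem (K5_support v detour ps qs ef.1.1 ef.1.2))
                            (K5_support v detour ps qs ef.2.1 ef.2.2)) (K5_pairs 0 1 2 3 4)%N].

Definition rim s : seq G := [:: apex s; lmid s; rmid s; lbase s; rbase s].

(* The three K5s force [uc] to cross [ab], one of [az] and [zb], and [ad]. *)
Definition side_layout s : bool :=
  let: Side o u a b c d := s in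
  [&& K5_layout [:: u; c; a; b; o] ((1, 3)%N, d) [:: c] [:: b],
      K5_layout [:: u; c; a; b; o] ((1, 3)%N, d) [:: c] [:: z; b],
      K5_layout [:: u; c; a; d; o] ((0, 3)%N, b) [:: c] [:: d],
      uniq [:: z; u; a; b; c; d],
      adj a z && adj a b,
      thick_edge z u && path thick_edge b [:: o; a],
      ~~ has (mem (gad z u)) (route_support b [:: o; a]) &
      c \notin route_support b [:: o; a]].

Definition sides_apart s s' : bool :=
  ~~ has (mem (rim s)) (rim s') && ~~ has (mem (rim s)) (gad z (apex s')).

End Layout.

Section TwoSides.
Variables (R : realType) (G : sgraph) (D : drawing R G).
Hypothesis strong : strongly_fan_planar_drawing D.
Variables (gad : G -> G -> seq G) (thick_edge : rel G) (z : G).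
Hypothesis linked_gad : forall x y, thick_edge x y -> linked D (gad x y) x y.
Local Notation edge u v := [set u; v]%SET.
Local Notation edge_curve u v := (curve (arc D (edge u v))).
Local Notation side_layout := (side_layout gad thick_edge z).
Local Notation route_support := (route_support gad).
Implicit Types (s : side G) (x y : G) (ps qs v : seq G) (L : seq (piece R)).

Let noI e e1 e2 : ~ pattern_I D e e1 e2.
Proof. by have [] := strong e e1 e2. Qed.

Lemma linked_route x ps : ps != [::] -> path thick_edge x ps ->
  linked D (route_support x ps) x (last x ps).
Proof.
case: ps => // y ps _; elim: ps x y => [|y' ps IH] x y /andP[/linked_gad xy yps].
  by rewrite /route_support /= cats0.
exact: linked_cat xy (IH y y' yps).
Qed.

Lemma K5_layout_parity v detour ps qs : K5_layout gad thick_edge z v detour ps qs ->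
  walk_parity D (nth z v 0) ps (nth z v 2) qs.
Proof.
move=> /and5P[uv /andP[p01 /eqP l01] /andP[p23 /eqP l23] /allP routes disj].
apply: (linked_K5_parity noI (v := nth z v) (M := K5_support gad z v detour ps qs)) => //.
move=> i j ij thick_ij.
have /routes thick_path : (i, j) \in [:: (0, 2); (0, 3); (0, 4); (1, 2); (1, 3); (1, 4); (2, 4); (3, 4)]%N.
  by case/andP: ij; case: i j thick_ij => [|[|[|[|i]]]] [|[|[|[|[|j]]]]].
move: thick_ij; rewrite /K5_support !inE negb_or => /andP[/negPf -> /negPf ->].
have <- : last (nth z v i) (route z v detour i j) = nth z v j by rewrite last_rcons.
by apply: linked_route => //; rewrite /route; case: ifP.
Qed.

Section OneSide.
Variables o u a b c d : G.
Hypothesis layout : side_layout (Side o u a b c d).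

Lemma side_distinct : uniq [:: z; u; a; b; c; d].
Proof. by case/and5P: layout. Qed.

Lemma side_edges : [/\ adj u c, adj a b, adj a z, adj z b & adj a d].
Proof.
case/and5P: layout => _ /and5P[_ _ /andP[+ _] _ _] /and5P[_ /andP[+ _] /andP[+ _] _ _] _.
by move=> + + + /and4P[/andP[az ab] _ _ _]; rewrite /= !andbT => /andP[_ zb] uc ad.
Qed.

Lemma side_crossings :
  [/\ edge_parity D u c a b, edge_parity D u c a z & edge_parity D u c z b = false].
Proof.
have [uc ab az zb ad] := side_edges.
have indep t := @uniq_map_nth _ z _ t side_distinct.
case/and5P: layout => /K5_layout_parity + /K5_layout_parity + /K5_layout_parity + _ _.
rewrite !walk_parityE /= !big_cons !big_nil !addbF => uc_ab uc_azb uc_ad.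
have uc_zb : edge_parity D u c z b = false.
  apply/negP; rewrite edge_parityC //; last exact: (indep [:: 1; 4; 0; 3]%N).
  rewrite edge_parityC // in uc_ad; last exact: (indep [:: 1; 4; 2; 5]%N).
  have [zb_uc_indep ad_uc_indep] := (indep [:: 0; 3; 1; 4]%N isT isT, indep [:: 2; 5; 1; 4]%N isT isT).
  move=> zb_uc; have /negP := crossing_edges_adjacent noI uc zb ad zb_uc_indep ad_uc_indep zb_uc uc_ad.
  by apply; exact: (indep [:: 0; 3; 2; 5]%N).
by split=> //; move: uc_azb; rewrite uc_zb addbF.
Qed.

End OneSide.

(* The closed chain formed by [uc], [ab] and [ud] up to their crossings. *)
Definition side_loop s L : Prop :=
  [/\ valid_chain L, closed_chain L & connected (chain_support L)] /\
  [/\ chain_support L (pos D (apex s)),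
      chain_support L `<=` edge_curve (apex s) (lbase s) `|` edge_curve (lmid s) (rmid s) `|`
                           edge_curve (apex s) (rbase s) &
      chain_winding L (pos D z)].

Lemma side_loop_exists s : side_layout s -> side_layout (mirror s) -> exists L, side_loop s L.
Proof.
case: s => o u a b c d layout mirror_layout.
have layout' : side_layout (Side o u b a d c) := mirror_layout.
have [uc ab az _ _] := side_edges layout; have [ud ba _ za _] := side_edges layout'.
have indep t := @uniq_map_nth _ z _ t (side_distinct layout).
have [uc_ab uc_az _] := side_crossings layout; have [ud_ba _ ud_za] := side_crossings layout'.
have ud_ab : edge_parity D u d a b.
  rewrite edge_parityC //; last exact: (indep [:: 1; 5; 2; 3]%N).
  rewrite edge_parity_swap //; last exact: (indep [:: 2; 3; 1; 5]%N).
  by rewrite edge_parityC //; exact: (indep [:: 3; 2; 1; 5]%N).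
have az_ud : edge_parity D a z u d = false.
  rewrite edge_parity_swap //; last exact: (indep [:: 2; 0; 1; 5]%N).
  by rewrite edge_parityC //; exact: (indep [:: 0; 2; 1; 5]%N).
have [s1 [t1 [s1I t1I meet_ab]]] := edge_parity_meet uc ab (indep [:: 1; 4; 2; 3]%N isT isT) uc_ab.
have [s2 [t2 [s2I t2I meet_az]]] := edge_parity_meet uc az (indep [:: 1; 4; 2; 0]%N isT isT) uc_az.
have [s3 [t3 [s3I t3I meet_ud]]] := edge_parity_meet ud ab (indep [:: 1; 5; 2; 3]%N isT isT) ud_ab.
have s21 : s2 < s1.
  case/and5P: layout => _ _ _ _ /and4P[_ /andP[/linked_gad[ps thick_ps last_ps] ba_route] disj cN].
  have [qs thick_qs last_qs] := @linked_route b [:: o; a] isT ba_route.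
  exact: (first_crossing noI uc ab az (indep [:: 1; 4; 2; 0]%N isT isT) thick_ps last_ps thick_qs last_qs
            disj cN s1I t1I s2I t2I meet_ab meet_az).
exists (side_chain D u a b c d s1 t1 s3 t3).
have distinct := side_distinct layout.
split; split.
- exact: valid_side_chain.
- exact: closed_side_chain.
- exact: side_chain_connected.
- exact: apex_in_side_chain.
- exact: side_chain_sub_curves.
- exact: (side_chain_winding_center strong distinct uc ud ab az s1I t1I s2I t2I s3I t3I
            meet_ab meet_az meet_ud s21 az_ud).
Qed.

Lemma side_loop_uncrossed s L x y w : side_layout s -> side_layout (mirror s) -> side_loop s L ->
  adj x y -> x \notin rim s -> y \notin rim s -> edge_curve x y w -> ~ chain_support L w.
Proof.
case: s => o u a b c d layout mirror_layout [_ [_ sub _]] xy xs ys xyw /sub onL.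
have layout' : side_layout (Side o u b a d c) := mirror_layout.
have [uc ab az _ _] := side_edges layout; have [ud ba _ za _] := side_edges layout'.
have indep t := @uniq_map_nth _ z _ t (side_distinct layout).
have [uc_ab _ _] := side_crossings layout; have [ud_ba _ _] := side_crossings layout'.
have off p q p' q' : edge_parity D p q p' q' -> adj p q -> adj p' q' -> uniq [:: p; q; p'; q'] ->
    {subset [:: p; q; p'; q'] <= [:: u; a; b; c; d]} -> ~ edge_curve p q w.
  move=> cross pq p'q' pq_p'q' on_rim.
  have xy_indep i j : i \in [:: p; q; p'; q'] -> j \in [:: p; q; p'; q'] -> i != j -> uniq [:: x; y; i; j].
    move=> /on_rim ri /on_rim rj ij.
    by have [] := uniq4_symmetry (uniq4_notin ri rj xs ys ij (adj_neq xy)).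
  have xy_pq : uniq [:: x; y; p; q] by apply: xy_indep (adj_neq pq); rewrite !inE eqxx ?orbT.
  have xy_p'q' : uniq [:: x; y; p'; q'] by apply: xy_indep (adj_neq p'q'); rewrite !inE eqxx ?orbT.
  have [p'q'_pq _] := uniq4_symmetry pq_p'q'.
  apply: (uncrossed_edge_curves xy pq xy_pq _ xyw); apply/negP => cross_xy.
  rewrite edge_parityC // in cross.
  by have /negP := crossing_edges_adjacent noI pq xy p'q' xy_pq p'q'_pq cross_xy cross; apply.
have rim_sub t : all (gtn 5) t -> {subset map (nth z [:: u; a; b; c; d]) t <= [:: u; a; b; c; d]}.
  by move=> /allP t5 v /mapP[i /t5 i5 ->]; exact: mem_nth.
case: onL => [[|]|].
- exact: (off u c a b uc_ab uc ab (indep [:: 1; 4; 2; 3]%N isT isT) (rim_sub [:: 0; 3; 1; 2]%N isT)).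
- have ab_uc : edge_parity D a b u c.
    by rewrite edge_parityC //; exact: (indep [:: 2; 3; 1; 4]%N).
  exact: (off a b u c ab_uc ab uc (indep [:: 2; 3; 1; 4]%N isT isT) (rim_sub [:: 1; 2; 0; 3]%N isT)).
- exact: (off u d b a ud_ba ud ba (indep [:: 1; 5; 3; 2]%N isT isT) (rim_sub [:: 0; 4; 2; 1]%N isT)).
Qed.

Lemma side_loop_encloses s s' L L' :
  side_layout s -> side_layout (mirror s) -> side_layout s' -> side_layout (mirror s') ->
  sides_apart gad z s s' -> side_loop s L -> side_loop s' L' ->
  forall w, chain_support L' w -> chain_winding L w.
Proof.
move=> layout mirror_layout.
case: s' => o u a b c d layout' mirror_layout' /andP[/hasPn rims /hasPn gads] loop loop' w L'w.
have mirror_side : side_layout (Side o u b a d c) := mirror_layout'.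
have uncrossed x y p := side_loop_uncrossed (x := x) (y := y) (w := p) layout mirror_layout loop.
have [[_ _ connected_L'] [L'u L'_sub _]] := loop'.
have [[valid_L closed_L _] [_ _ wz]] := loop.
have disjoint p : chain_support L' p -> ~ chain_support L p.
  have [uc ab _ _ _] := side_edges layout'; have [ud _ _ _ _] := side_edges mirror_side.
  have off x : x \in rim (Side o u a b c d) -> x \notin rim s := rims x.
  by move=> /L'_sub[[|]|] on_edge; apply: uncrossed on_edge => //; apply: off; rewrite !inE eqxx ?orbT.
rewrite (chain_winding_connected valid_L closed_L connected_L' disjoint L'w L'u).
have /and5P[_ _ _ _ /and4P[_ /andP[/linked_gad[ps thick_ps <-] _] _ _]] := layout'.
rewrite -(chain_winding_walk valid_L closed_L) //; first by case: thick_ps.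
move=> x y xy p xyp; have [xy_adj xM yM _] := thick_step thick_ps xy.
by apply: uncrossed xyp => //; exact: gads.
Qed.

Lemma two_sides_not_strong s s' :
  side_layout s -> side_layout (mirror s) -> side_layout s' -> side_layout (mirror s') ->
  sides_apart gad z s s' -> sides_apart gad z s' s -> False.
Proof.
move=> layout mirror_layout layout' mirror_layout' apart apart'.
have [L loop] := side_loop_exists layout mirror_layout.
have [L' loop'] := side_loop_exists layout' mirror_layout'.
have [[valid_L _ _] [[p pL _] _ _]] := loop; have [[valid_L' _ _] _] := loop'.
have L0 : L != [::] by apply: contraTneq pL => ->.
apply: (chain_winding_not_nested valid_L valid_L' L0); split.
  exact: (side_loop_encloses layout' mirror_layout' layout mirror_layout apart' loop' loop).
exact: (side_loop_encloses layout mirror_layout layout' mirror_layout' apart loop loop').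
Qed.

End TwoSides.

(** * The graph *)

Local Open Scope nat_scope.

Definition map_side (T U : Type) (f : T -> U) (s : side T) : side U :=
  let: Side o u a b c d := s in Side (f o) (f u) (f a) (f b) (f c) (f d).

Definition left_side : side nat := Side 1 2 3 4 5 6.
Definition right_side : side nat := Side 7 8 9 10 11 12.

Definition thick_pairs (s : side nat) : seq (nat * nat) :=
  let: Side o u a b c d := s in
  [:: (o, u); (o, a); (o, b); (o, c); (o, d); (u, a); (a, c); (c, d); (d, b); (b, u); (u, 0)].

Definition thin_pairs (s : side nat) : seq (nat * nat) :=
  let: Side o u a b c d := s in [:: (u, c); (u, d); (a, b); (a, d); (b, c); (0, a); (0, b)].

Definition thick_edges : seq (nat * nat) := thick_pairs left_side ++ thick_pairs right_side.
Definition thin_edges : seq (nat * nat) := thin_pairs left_side ++ thin_pairs right_side.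

Definition gadget (i : nat) : seq nat :=
  let: (x, y) := nth (0, 0) thick_edges i in [:: x; y] ++ iota (13 + 5 * i) 5.

Definition gadgets : seq (seq nat) := map gadget (iota 0 22).

Definition thick_edge (i j : nat) : bool := has (fun M => (i \in M) && (j \in M)) gadgets.

Definition adjn (i j : nat) : bool :=
  (i != j) && [|| thick_edge i j, (i, j) \in thin_edges | (j, i) \in thin_edges].

Definition order : nat := 123.

Definition fan_adj (i j : 'I_order) : bool := adjn i j.

Lemma fan_adj_sym : symmetric fan_adj.
Proof.
move=> i j; rewrite /fan_adj /adjn eq_sym [((nat_of_ord i, nat_of_ord j) \in _) || _]orbC.
by congr (_ && (_ || _)); apply: eq_has => M; rewrite andbC.
Qed.

Lemma fan_adj_irrefl : irreflexive fan_adj.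
Proof. by move=> i; rewrite /fan_adj /adjn eqxx. Qed.

Definition fan_graph : sgraph := SGraph fan_adj_sym fan_adj_irrefl.

(* Reduction mod [order] is junk, chosen because it computes. *)
Definition vx (n : nat) : fan_graph := Ordinal (ltn_pmod n (isT : 0 < order)).

Definition code (v : fan_graph) : nat := (v : 'I_order).

Lemma vxK n : n < order -> code (vx n) = n.
Proof. exact: modn_small. Qed.

Lemma codeK : cancel code vx.
Proof. by move=> v; apply: val_inj; exact: modn_small (ltn_ord (v : 'I_order)). Qed.

Definition gadget_of (x y : fan_graph) : seq fan_graph :=
  map vx (head [::] [seq M <- gadgets | (code x \in M) && (code y \in M)]).

Lemma gadgets_are_K7 : all (fun M =>
  [&& uniq (map vx M), size M == 7 & all (fun u => all (fun v => (u == v) || adj u v) (map vx M)) (map vx M)])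
  gadgets.
Proof. by vm_compute. Qed.

Definition fan_side (s : side nat) : side fan_graph := map_side vx s.

Definition fan_side_layout (s : side nat) : bool :=
  side_layout gadget_of (fun x y => thick_edge (code x) (code y)) (vx 0) (fan_side s).

Lemma fan_side_layouts :
  [/\ fan_side_layout left_side, fan_side_layout (mirror left_side),
      fan_side_layout right_side & fan_side_layout (mirror right_side)].
Proof. by vm_compute. Qed.

Lemma fan_sides_apart :
  sides_apart gadget_of (vx 0) (fan_side left_side) (fan_side right_side) /\
  sides_apart gadget_of (vx 0) (fan_side right_side) (fan_side left_side).
Proof. by vm_compute. Qed.

Lemma gadget_of_linked (R : realType) (D : drawing R fan_graph) x y :
  (forall e e1 e2, ~ pattern_I D e e1 e2) -> thick_edge (code x) (code y) ->
  linked D (gadget_of x y) x y.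
Proof.
move=> noI thick_xy.
have [M [Mg xM yM ->]] : exists M, [/\ M \in gadgets, code x \in M, code y \in M & gadget_of x y = map vx M].
  rewrite /gadget_of; set Ms := [seq M <- gadgets | _]; exists (head [::] Ms).
  have : head [::] Ms \in Ms.
    by move: thick_xy; rewrite /thick_edge has_filter -/Ms; case: Ms => // M Ms _; exact: mem_head.
  by rewrite mem_filter => /andP[/andP[-> ->] ->].
have /and3P[uM /eqP sM /allP clique] := allP gadgets_are_K7 M Mg.
apply: (K7_linked noI uM); rewrite ?size_map //.
- by move=> u v /clique/allP u_adj /u_adj /orP[/eqP ->|//]; rewrite eqxx.
- by rewrite -(codeK x) map_f.
- by rewrite -(codeK y) map_f.
Qed.

Lemma fan_graph_not_strong (R : realType) : ~ strongly_fan_planar R fan_graph.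
Proof.
move=> [D strong].
have noI e e1 e2 : ~ pattern_I D e e1 e2 by have [] := strong e e1 e2.
have linked_gad x y := @gadget_of_linked R D x y noI.
have [left left' right right'] := fan_side_layouts; have [lr rl] := fan_sides_apart.
exact: (two_sides_not_strong strong linked_gad left left' right right' lr rl).
Qed.

Local Close Scope nat_scope.

(** * Segments and affine crossings *)

Section CrossingSegments.
Variable R : realType.
Local Notation plane := (plane R).
Local Notation segment_curve p q := (curve (lerp p q)).
Implicit Types (p q r s x z : plane) (t e : R).

Definition orient p q z : R := (q.1 - p.1) * (z.2 - p.2) - (q.2 - p.2) * (z.1 - p.1).

Lemma orient_lerp p q r s t : orient p q (lerp r s t) = (1 - t) * orient p q r + t * orient p q s.
Proof. by rewrite /orient /lerp /=; ring. Qed.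

Lemma orient_on_line p q t : orient p q (lerp p q t) = 0.
Proof. by rewrite /orient /lerp /=; ring. Qed.

Lemma orient_start p q : orient p q p = 0.
Proof. by rewrite /orient; ring. Qed.

Lemma segment_curveP p q z : segment_curve p q z <-> exists2 t, 0 <= t <= 1 & z = lerp p q t.
Proof. by split=> [] [t tI]; exists t. Qed.

Lemma mem_segment_curve p q t : 0 <= t <= 1 -> segment_curve p q (lerp p q t).
Proof. by exists t. Qed.

Lemma segment_curve_start p q : segment_curve p q p.
Proof. by rewrite -{2}(lerp0 p q); apply: mem_segment_curve; rewrite lexx ler01. Qed.

Lemma lerp_rev p q t : lerp p q t = lerp q p (1 - t).
Proof. by congr pair => /=; ring. Qed.

Lemma segment_curveC p q : segment_curve p q = segment_curve q p.
Proof.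
suff sub p' q' : segment_curve p' q' `<=` segment_curve q' p' by apply/seteqP; split; exact: sub.
by move=> z /segment_curveP[t tI ->]; rewrite lerp_rev; apply: mem_segment_curve; lra.
Qed.

Lemma lerp_inj p q : p != q -> injective (lerp p q).
Proof.
move=> pq t t' [/addrI E1 /addrI E2]; apply/eqP; apply: contraT => tt'; move: pq; apply: contraNT => _.
have same (x y : R) : t * (y - x) = t' * (y - x) -> x = y.
  move/eqP; rewrite -subr_eq0 -mulrBl mulf_eq0 subr_eq0 (negPf tt') subr_eq0 /=.
  by move/eqP.
by rewrite [p]surjective_pairing [q]surjective_pairing (same _ _ E1) (same _ _ E2).
Qed.

Lemma convex_gt0 (a b t : R) : 0 < a -> 0 < b -> 0 <= t <= 1 -> 0 < (1 - t) * a + t * b.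
Proof.
move=> a0 b0 /andP[t0 t1]; have [->|tn1] := eqVneq t 1; first by rewrite subrr mul0r add0r mul1r.
by rewrite ltr_wpDr ?mulr_ge0 ?(ltW b0) // mulr_gt0 // subr_gt0 lt_neqAle tn1.
Qed.

Lemma segments_same_side_disjoint p q r s z : 0 < orient p q r * orient p q s ->
  segment_curve p q z -> ~ segment_curve r s z.
Proof.
move=> rs /segment_curveP[a _ ->] /segment_curveP[b bI E].
have := orient_on_line p q a; rewrite E orient_lerp => E0.
have rr : 0 < orient p q r * orient p q r.
  by rewrite -expr2 exprn_even_gt0 //=; apply: contraTneq rs => ->; rewrite mul0r ltxx.
have := convex_gt0 rr rs bI.
by rewrite mulrCA [X in _ + X]mulrCA -mulrDr E0 mulr0 ltxx.
Qed.

Lemma segments_from_meet_at_start p q r z : orient p q r != 0 ->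
  segment_curve p q z -> segment_curve p r z -> z = p.
Proof.
move=> o0 /segment_curveP[a _ ->] /segment_curveP[b _ E]; have := orient_on_line p q a.
rewrite E orient_lerp orient_start mulr0 add0r => /eqP.
by rewrite mulf_eq0 (negPf o0) orbF => /eqP ->; rewrite lerp0.
Qed.

Lemma opposite_sides_crossing_param p q r s t : orient p q r * orient p q s < 0 ->
  orient p q (lerp r s t) = 0 -> t = orient p q r / (orient p q r - orient p q s) /\ 0 < t < 1.
Proof.
rewrite orient_lerp; move: (orient p q r) (orient p q s) => X Y XY E.
have XY0 : X - Y != 0.
  by apply: contraTneq XY => /eqP; rewrite subr_eq0 => /eqP ->; rewrite -leNgt -expr2 sqr_ge0.
have Et : t = X / (X - Y) by apply: (mulIf XY0); rewrite divfK //; lra.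
split=> //; rewrite Et.
have [X0|X0|X0] := ltrgtP X 0; last by rewrite X0 mul0r ltxx in XY.
  have Y0 : 0 < Y by move: XY; rewrite nmulr_rlt0.
  have -> : X / (X - Y) = (- X) / (Y - X) by rewrite -[Y - X]opprB invrN mulrNN.
  by rewrite divr_gt0 ?ltr_pdivrMr //=; lra.
have Y0 : Y < 0 by move: XY; rewrite pmulr_rlt0.
by rewrite divr_gt0 ?ltr_pdivrMr //=; lra.
Qed.

Lemma segments_meet_once p q r s z z' : orient p q r * orient p q s < 0 ->
  segment_curve p q z -> segment_curve r s z ->
  segment_curve p q z' -> segment_curve r s z' -> z = z'.
Proof.
move=> rs /segment_curveP[a _ Ea] /segment_curveP[b _ Eb] /segment_curveP[a' _ Ea'] /segment_curveP[b' _ Eb'].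
have [|E _] := @opposite_sides_crossing_param p q r s b rs; first by rewrite -Eb Ea orient_on_line.
have [|E' _] := @opposite_sides_crossing_param p q r s b' rs; first by rewrite -Eb' Ea' orient_on_line.
by rewrite Eb Eb' E' E.
Qed.

Lemma segment_curve_closed p q : closed (segment_curve p q).
Proof.
apply: compact_closed; first exact: norm_hausdorff.
exact: (piece_image_compact (valid_segment p q)).
Qed.

Lemma coordinates_continuous (U : set plane) :
  {within U, continuous (fun z : plane => z.1)} /\ {within U, continuous (fun z : plane => z.2)}.
Proof.
by split; [apply: within_continuous_fst|apply: within_continuous_snd]; exact: within_continuous_id.
Qed.

Section AffineChart.
Variables (p q r s x : plane) (a b e : R).
Hypotheses (xa : x = lerp p q a) (xb : x = lerp r s b) (e0 : 0 < e).
Let A := (q.1 - p.1, q.2 - p.2).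
Let B := (s.1 - r.1, s.2 - r.2).
Let det := A.1 * B.2 - A.2 * B.1.
Hypothesis det0 : det != 0.

(* The affine map that sends [x] to the origin and [x + e A], [x + e B] to the unit vectors. *)
Definition affine_chart z : plane :=
  (((z.1 - x.1) * B.2 - (z.2 - x.2) * B.1) / (e * det), (A.1 * (z.2 - x.2) - A.2 * (z.1 - x.1)) / (e * det)).

Definition affine_chart_inv (w : plane) : plane :=
  (x.1 + e * (w.1 * A.1 + w.2 * B.1), x.2 + e * (w.1 * A.2 + w.2 * B.2)).

Lemma affine_chartK : cancel affine_chart affine_chart_inv.
Proof.
move=> z; have := det0; rewrite /det /A /B /= => D0.
rewrite [RHS]surjective_pairing /affine_chart /affine_chart_inv /det /A /B /=.
by congr pair; field; rewrite D0 (gt_eqF e0).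
Qed.

Lemma affine_chart_invK : cancel affine_chart_inv affine_chart.
Proof.
move=> z; have := det0; rewrite /det /A /B /= => D0.
rewrite [RHS]surjective_pairing /affine_chart /affine_chart_inv /det /A /B /=.
by congr pair; field; rewrite D0 (gt_eqF e0).
Qed.

Lemma affine_chart_continuous (U : set plane) : {within U, continuous affine_chart}.
Proof.
have [c1 c2] := coordinates_continuous U.
apply: within_continuous_pair; apply: within_continuousM; try exact: within_continuous_cst.
all: apply: within_continuousD; try apply: within_continuousN.
all: apply: within_continuousM; try exact: within_continuous_cst.
all: by apply: within_continuousD => //; exact: within_continuous_cst.
Qed.

Lemma affine_chart_inv_continuous (U : set plane) : {within U, continuous affine_chart_inv}.
Proof.
have [c1 c2] := coordinates_continuous U.
apply: within_continuous_pair; apply: within_continuousD; try exact: within_continuous_cst.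
all: apply: within_continuousM; try exact: within_continuous_cst; apply: within_continuousD.
all: by apply: within_continuousM => //; exact: within_continuous_cst.
Qed.

Lemma affine_chart_crossing (S T : set plane) :
  (forall z, ball (0 : plane) 1 (affine_chart z) -> S z <-> (affine_chart z).2 = 0) ->
  (forall z, ball (0 : plane) 1 (affine_chart z) -> T z <-> (affine_chart z).1 = 0) -> proper_crossing S T x.
Proof.
move=> HS HT.
have cx : affine_chart x = 0 by rewrite /affine_chart !subrr !mul0r !mulr0 subrr !mul0r.
exists (affine_chart @^-1` ball (0 : plane) 1), affine_chart, affine_chart_inv; split => //.
- apply: open_comp; last exact: ball_open.
  move=> z _ V HV.
  have := within_continuous_near (@affine_chart_continuous setT) (I : setT z) HV.
  by apply: filterS => w /=; exact.
- by rewrite /= cx; exact: ballxx.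
- split.
  + by move=> z Uz; split => //; exact: affine_chartK.
  + by move=> w Vw; rewrite /= affine_chart_invK.
  + exact: affine_chart_continuous.
  + exact: affine_chart_inv_continuous.
- by move=> z Uz; split; [exact: HS|exact: HT].
Qed.

Lemma affine_chart_first_axis t : (affine_chart (lerp p q t)).2 = 0.
Proof.
by rewrite /affine_chart /= xa /lerp /=; apply/eqP; rewrite mulf_eq0; apply/orP; left; apply/eqP; ring.
Qed.

Lemma affine_chart_second_axis t : (affine_chart (lerp r s t)).1 = 0.
Proof.
by rewrite /affine_chart /= xb /lerp /=; apply/eqP; rewrite mulf_eq0; apply/orP; left; apply/eqP; ring.
Qed.

Lemma first_axis_lerp z : (affine_chart z).2 = 0 -> z = lerp p q (a + e * (affine_chart z).1).
Proof.
move=> h; rewrite -{1}(affine_chartK z) /affine_chart_inv h xa /lerp /=.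
by congr pair; rewrite /A /=; ring.
Qed.

Lemma second_axis_lerp z : (affine_chart z).1 = 0 -> z = lerp r s (b + e * (affine_chart z).2).
Proof.
move=> h; rewrite -{1}(affine_chartK z) /affine_chart_inv h xb /lerp /=.
by congr pair; rewrite /B /=; ring.
Qed.

Lemma affine_chart_ball d z : e * (`|A.1| + `|A.2| + `|B.1| + `|B.2|) < d ->
  ball (0 : plane) 1 (affine_chart z) -> ball x d z.
Proof.
move=> small [/=]; rewrite /ball /= !sub0r !normrN => w1 w2.
have comb (u v c c' : R) : `|u| < 1 -> `|v| < 1 -> `|u * c + v * c'| <= `|c| + `|c'|.
  move=> u1 v1; apply: (le_trans (ler_normD _ _)); rewrite !normrM.
  by apply: lerD; rewrite ler_piMl // ltW.
have C1 := comb _ _ A.1 B.1 w1 w2; have C2 := comb _ _ A.2 B.2 w1 w2.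
have [A1 A2 B1 B2] := And4 (normr_ge0 A.1) (normr_ge0 A.2) (normr_ge0 B.1) (normr_ge0 B.2).
rewrite -(affine_chartK z) /affine_chart_inv; split; rewrite /ball /=;
  rewrite opprD addrA subrr sub0r normrN normrM (gtr0_norm e0);
  apply: le_lt_trans small; rewrite ler_pM2l //; move: A1 A2 B1 B2 C1 C2; lra.
Qed.

End AffineChart.

Lemma small_scale (a b d N : R) : 0 < a < 1 -> 0 < b < 1 -> 0 < d -> 0 <= N ->
  exists2 e, 0 < e & [/\ e * N < d, forall u, ball (0 : R) 1 u -> 0 <= a + e * u <= 1 &
                         forall u, ball (0 : R) 1 u -> 0 <= b + e * u <= 1].
Proof.
move=> /andP[a0 a1] /andP[b0 b1] d0 N0.
pose m := Num.min (Num.min (Num.min a (1 - a)) (Num.min b (1 - b))) d.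
have m0 : 0 < m by rewrite !lt_min a0 b0 d0 !subr_gt0 a1 b1.
have [ma ma' mb mb' md] : [/\ m <= a, m <= 1 - a, m <= b, m <= 1 - b & m <= d].
  by split; rewrite ?ge_min ?lexx ?orbT.
pose e := m / (N + 1).
have N1 : 0 < N + 1 by lra.
have e0 : 0 < e by apply: divr_gt0.
have em : e <= m by rewrite ler_pdivrMr // ler_peMr ?(ltW m0) // lerDr.
have range c u : ball (0 : R) 1 u -> m <= c -> m <= 1 - c -> 0 <= c + e * u <= 1.
  rewrite /ball /= sub0r normrN => u1 c0 c1; have : `|e * u| <= m.
    by rewrite normrM (gtr0_norm e0); apply: le_trans em; rewrite ler_piMr ?ltW.
  by rewrite ler_norml => /andP[? ?]; lra.
exists e => //; split=> [|u u1|u u1]; [|exact: range..].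
by rewrite (lt_le_trans _ md) // /e mulrAC ltr_pdivrMr // ltr_pM2l // ltrDl ltr01.
Qed.

Lemma segments_cross_properly p q r s x d (S T : set plane) :
  orient p q r * orient p q s < 0 -> orient r s p * orient r s q < 0 ->
  segment_curve p q x -> segment_curve r s x -> 0 < d ->
  (forall z, ball x d z -> S z <-> segment_curve p q z) ->
  (forall z, ball x d z -> T z <-> segment_curve r s z) -> proper_crossing S T x.
Proof.
move=> rs pq /segment_curveP[a _ xa] /segment_curveP[b _ xb] d0 HS HT.
have [|_ /andP[b0 b1]] := @opposite_sides_crossing_param p q r s b rs; first by rewrite -xb xa orient_on_line.
have [|_ /andP[a0 a1]] := @opposite_sides_crossing_param r s p q a pq; first by rewrite -xa xb orient_on_line.
have det0 : (q.1 - p.1) * (s.2 - r.2) - (q.2 - p.2) * (s.1 - r.1) != 0.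
  have -> : (q.1 - p.1) * (s.2 - r.2) - (q.2 - p.2) * (s.1 - r.1) = orient p q s - orient p q r.
    by rewrite /orient; ring.
  by rewrite subr_eq0; apply: contraTneq rs => ->; rewrite -leNgt -expr2 sqr_ge0.
pose N := `|q.1 - p.1| + `|q.2 - p.2| + `|s.1 - r.1| + `|s.2 - r.2|.
have N0 : 0 <= N by rewrite !addr_ge0.
have [||e e0 [eN aI bI]] := @small_scale a b d N _ _ d0 N0; [by rewrite a0|by rewrite b0|].
have near z : ball (0 : plane) 1 (affine_chart p q r s x e z) -> ball x d z.
  exact: affine_chart_ball eN.
apply: (affine_chart_crossing (p := p) (q := q) (r := r) (s := s) (e := e)) => // z bz; split.
- by move=> /(HS z (near z bz))/segment_curveP[t _ ->]; exact: affine_chart_first_axis xa t.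
- move=> axis; apply/(HS z (near z bz)); rewrite (first_axis_lerp xa e0 det0 axis).
  by apply: mem_segment_curve; apply: aI; case: bz.
- by move=> /(HT z (near z bz))/segment_curveP[t _ ->]; exact: affine_chart_second_axis xb t.
move=> axis; apply/(HT z (near z bz)); rewrite (second_axis_lerp xb e0 det0 axis).
by apply: mem_segment_curve; apply: bI; case: bz.
Qed.

Lemma proper_crossing_arc (A B U : set plane) p : proper_crossing A B p -> open U -> U p ->
  exists (f : R -> plane) (a b : R), [/\ a < 0 < b, f 0 = p, {within `[a, b], continuous f},
    {in `[a, b] &, injective f} & forall t, a <= t <= b -> U (f t) /\ A (f t)].
Proof.
move=> [V [h [k [_ Vp hp [hk kh ch ck] HAB]]]] oU Up.
have disk (t : R) : -1 < t < 1 -> ball (0 : plane) 1 (t, 0).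
  by move=> tI; split; rewrite /ball /= sub0r normrN ?normr0 ?ltr01 // ltr_norml.
pose f t := k (t, 0); have fp : f 0 = p by rewrite /f -(hk _ Vp).2 hp.
have hf (t : R) : -1 < t < 1 -> V (f t) /\ h (f t) = (t, 0) by move=> /disk/kh.
have valid_f : valid_piece (Piece f (- (1 / 2)) (1 / 2)).
  split=> /=; first by lra.
  apply: (within_continuous_compose (E := ball (0 : plane) 1)) ck => [t|].
    by rewrite /= in_itv /= => tI; apply: disk; lra.
  by apply: within_continuous_pair; [exact: within_continuous_id|exact: within_continuous_cst].
have zeroI : tmin (Piece f (- (1 / 2)) (1 / 2)) < 0 < tmax (Piece f (- (1 / 2)) (1 / 2)) by move=> /=; lra.
have Uf0 : U (f 0) by rewrite fp.
have [a [b [/= a0 ab b0 inU]]] := subinterval_into_open valid_f zeroI oU Uf0.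
have small t : a <= t <= b -> -1 < t < 1 by lra.
exists f, a, b; split=> //.
- case: valid_f => _; apply: continuous_subspaceW => t; rewrite /= !in_itv /=; lra.
- move=> t t'; rewrite !in_itv /= => /small tI /small t'I E.
  by have := (hf _ tI).2; rewrite E (hf _ t'I).2 => -[].
move=> t tI; split; first exact: inU.
by have [Vf hft] := hf _ (small t tI); apply/(HAB _ Vf).1; rewrite hft.
Qed.

(* Along an arc of [S] through [p], the position along the segment would change sign at [p]. *)
Lemma segment_end_not_crossing p q d (S T : set plane) : p != q -> 0 < d ->
  (forall z, ball p d z -> S z -> segment_curve p q z) -> ~ proper_crossing S T p.
Proof.
move=> pq d0 Sseg /proper_crossing_arc/(_ (ball_open p d) (ballxx p d0))[f [a [b [ab f0 cf inj fS]]]].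
pose along z := (z.1 - p.1) * (q.1 - p.1) + (z.2 - p.2) * (q.2 - p.2).
pose n := (q.1 - p.1) ^+ 2 + (q.2 - p.2) ^+ 2.
have n0 : 0 < n.
  rewrite lt_neqAle addr_ge0 ?sqr_ge0 // andbT eq_sym paddr_eq0 ?sqr_ge0 // !sqrf_eq0 !subr_eq0.
  apply: contra pq => /andP[/eqP E1 /eqP E2].
  by rewrite [p]surjective_pairing [q]surjective_pairing E1 E2.
have along_f t : a <= t <= b -> exists2 c, 0 <= c <= 1 & f t = lerp p q c /\ along (f t) = c * n.
  move=> /fS[bf Sf]; have /segment_curveP[c cI ->] := Sseg _ bf Sf.
  by exists c => //; split=> //; rewrite /along /lerp /n /=; ring.
have : along (f a) * along (f b) < 0.
  apply: (@injective_sign_change _ (fun t => along (f t)) a 0 b ab) => [|t t'|].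
  - apply: within_continuousD; apply: within_continuousM; try exact: within_continuous_cst.
      by apply: within_continuousD; [exact: within_continuous_fst|exact: within_continuous_cst].
    by apply: within_continuousD; [exact: within_continuous_snd|exact: within_continuous_cst].
  - move=> tI t'I E; apply: inj => //; move: tI t'I E; rewrite !in_itv /= => /along_f[c _ [-> ->]].
    by move=> /along_f[c' _ [-> ->]] /(mulIf (lt0r_neq0 n0)) ->.
  by rewrite f0 /along !subrr !mul0r addr0.
have [|c /andP[c0 _] [_ ->]] := along_f a; first by rewrite lexx; lra.
have [|c' /andP[c'0 _] [_ ->]] := along_f b; first by rewrite lexx andbT; lra.
by rewrite ltNge !mulr_ge0 // ltW.
Qed.

End CrossingSegments.

Section Polylines.
Variable R : realType.
Local Notation plane := (plane R).
Local Notation segment_curve p q := (curve (lerp p q)).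
Implicit Types (p q x z : plane) (s : seq plane) (t : R) (f g : R -> plane).

Definition concat f g t : plane := if t <= 1 / 2 then f (2 * t) else g (2 * t - 1).

Lemma concat0 f g : concat f g 0 = f 0.
Proof. by rewrite /concat mulr0; have -> : (0 : R) <= 1 / 2 by lra. Qed.

Lemma concat1 f g : concat f g 1 = g 1.
Proof.
rewrite /concat; have -> : ((1 : R) <= 1 / 2) = false by apply/negbTE; rewrite -ltNge; lra.
by congr g; ring.
Qed.

Lemma concat_right f g t : f 1 = g 0 -> 1 / 2 <= t -> concat f g t = g (2 * t - 1).
Proof.
move=> fg t2; rewrite /concat; case: leP => // t2'.
have -> : t = 1 / 2 by lra.
by rewrite (_ : 2 * (1 / 2) = 1 :> R) ?subrr //; lra.
Qed.

Lemma concat_continuous f g : {within `[0, 1], continuous f} -> {within `[0, 1], continuous g} ->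
  f 1 = g 0 -> {within `[0, 1], continuous (concat f g)}.
Proof.
move=> cf cg fg.
have -> : `[0, 1]%classic = `[0, 1 / 2]%classic `|` `[1 / 2, 1]%classic :> set R.
  apply/seteqP; split=> t /=; rewrite !in_itv /=.
    by move=> /andP[-> ->]; rewrite andbT; case: (leP t); [left|right; rewrite ltW].
  by case=> ?; lra.
have double (a b : R) : {within `[a, b], continuous (fun t : R => 2 * t)}.
  by apply: within_continuousM; [exact: within_continuous_cst|exact: within_continuous_id].
have left_half : {within `[0, 1 / 2], continuous (fun t : R => f (2 * t))}.
  by apply: within_continuous_compose (double 0 (1 / 2)) cf => t; rewrite /= !in_itv /= => ?; lra.
have right_half : {within `[1 / 2, 1], continuous (fun t : R => g (2 * t - 1))}.
  have shifted : {within `[1 / 2, 1], continuous (fun t : R => 2 * t - 1)}.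
    by apply: within_continuousD; [exact: double|exact: within_continuous_cst].
  by apply: within_continuous_compose shifted cg => t; rewrite /= !in_itv /= => ?; lra.
apply: withinU_continuous; try exact: interval_closed.
  apply: subspace_eq_continuous left_half => t; rewrite inE /= in_itv /= => /andP[_ t2].
  by rewrite /from_subspace /concat t2.
apply: subspace_eq_continuous right_half => t; rewrite inE /= in_itv /= => /andP[t2 _].
by rewrite /from_subspace concat_right.
Qed.

Lemma curve_concat f g : f 1 = g 0 -> curve (concat f g) = curve f `|` curve g.
Proof.
move=> fg; apply/seteqP; split=> z.
  move=> [t]; rewrite /= in_itv /= => tI <-; rewrite /concat; case: leP => t2.
    by left; exists (2 * t); rewrite //= in_itv /=; lra.
  by right; exists (2 * t - 1); rewrite //= in_itv /=; lra.
case=> [] [t]; rewrite /= in_itv /= => tI <-.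
  exists (t / 2); first by rewrite /= in_itv /=; lra.
  have t2 : t / 2 <= 1 / 2 by lra.
  by rewrite /concat t2; congr f; field.
exists ((t + 1) / 2); first by rewrite /= in_itv /=; lra.
by rewrite concat_right //; [congr g; field|lra].
Qed.

Lemma concat_jordan f g : jordan_arc f -> jordan_arc g -> f 1 = g 0 ->
  curve f `&` curve g `<=` [set f 1] -> jordan_arc (concat f g).
Proof.
move=> [cf jf] [cg jg] fg meet; split; first exact: concat_continuous.
have crossed t t' : 0 <= t <= 1 / 2 -> 1 / 2 < t' <= 1 -> concat f g t <> concat f g t'.
  rewrite /concat => tI t'I; have -> : t <= 1 / 2 by lra.
  have -> : (t' <= 1 / 2) = false by apply/negbTE; rewrite -ltNge; lra.
  move=> E; have [tJ t'J] : 2 * t \in `[0, 1] /\ 2 * t' - 1 \in `[0, 1] by rewrite !in_itv /=; lra.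
  have g0 : g (2 * t' - 1) = g 0.
    by rewrite -fg; apply: meet; split; [exists (2 * t)|exists (2 * t' - 1)].
  have : 2 * t' - 1 = 0 by apply: jg => //; rewrite in_itv /= lexx ler01.
  lra.
move=> t t'; rewrite !in_itv /= => tI t'I.
have [t2|t2] := leP t (1 / 2); have [t2'|t2'] := leP t' (1 / 2) => E.
- move: E; rewrite /concat t2 t2' => /jf; rewrite !in_itv /= => E.
  by have := E _ _; lra.
- by case: (crossed t t') => //; lra.
- by case: (crossed t' t) => //; lra.
rewrite !concat_right // in E; try by lra.
move: E => /jg; rewrite !in_itv /= => E.
have : 2 * t - 1 = 2 * t' - 1 by apply: E; lra.
lra.
Qed.

Lemma lerp_jordan p q : p != q -> jordan_arc (lerp p q).
Proof. by move=> pq; split=> [|t t' _ _]; [exact: lerp_continuous|exact: lerp_inj]. Qed.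

Fixpoint polyline p s : R -> plane :=
  match s with
  | [::] => fun=> p
  | [:: q] => lerp p q
  | q :: s' => concat (lerp p q) (polyline q s')
  end.

Lemma polyline_cons p q r s : polyline p [:: q, r & s] = concat (lerp p q) (polyline q (r :: s)).
Proof. by []. Qed.

Lemma polyline_start p s : polyline p s 0 = p.
Proof. by case: s => [//|q [|r s]]; rewrite /= ?concat0 lerp0. Qed.

Lemma polyline_end p s : polyline p s 1 = last p s.
Proof.
elim: s p => [//|q [|r s] IH] p; first exact: lerp1.
by rewrite polyline_cons concat1 IH.
Qed.

Lemma curve_polyline p s : s != [::] ->
  curve (polyline p s) = \bigcup_(a in [set` steps p s]) segment_curve a.1 a.2.
Proof.
elim: s p => [//|q [|r s] IH] p _; first by rewrite bigcup_seq big_seq1.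
rewrite polyline_cons curve_concat; last by rewrite lerp1 polyline_start.
by rewrite IH // !bigcup_seq [in RHS]big_cons.
Qed.

Lemma polyline_continuous p s : {within `[0, 1], continuous (polyline p s)}.
Proof.
elim: s p => [|q [|r s] IH] p; [exact: within_continuous_cst|exact: lerp_continuous|].
apply: (@concat_continuous _ (polyline q (r :: s))); [exact: lerp_continuous|exact: IH|].
by rewrite lerp1 polyline_start.
Qed.

Lemma curve_polyline_connected p s : connected (curve (polyline p s)).
Proof.
have valid : valid_piece (Piece (polyline p s) 0 1) by split; [exact: ler01|exact: polyline_continuous].
exact: piece_image_connected valid.
Qed.

Fixpoint simple_polyline p s : Prop :=
  match s with
  | [::] => False
  | [:: q] => p != q
  | q :: s' => [/\ p != q, segment_curve p q `&` curve (polyline q s') `<=` [set q] & simple_polyline q s']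
  end.

Lemma simple_polyline_jordan p s : simple_polyline p s -> jordan_arc (polyline p s).
Proof.
elim: s p => [//|q [|r s] IH] p; first exact: lerp_jordan.
move=> [pq meet simple_tail].
apply: (@concat_jordan _ (polyline q (r :: s))); [exact: lerp_jordan|exact: IH| |].
  by rewrite lerp1 polyline_start.
by rewrite lerp1.
Qed.

End Polylines.

Lemma cover_near (R : realType) (T : choiceType) (F : T -> set (plane R)) (L : seq T) a x :
  (forall b, closed (F b)) -> a \in L -> {in L, forall b, F b x -> b = a} ->
  exists2 e : R, 0 < e & forall z, ball x e z -> (\bigcup_(b in [set` L]) F b) z <-> F a z.
Proof.
move=> closedF aL only; pose others := [seq b <- L | b != a].
have open_off : open (~` \big[setU/set0]_(b <- others) F b) by apply: closed_openC; exact: closed_bigsetU.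
have off_x : (~` \big[setU/set0]_(b <- others) F b) x.
  by rewrite -bigcup_seq => -[b /=]; rewrite mem_filter => /andP[/eqP ba bL] /(only b bL).
have /nbhs_ballP[e e0 eoff] := open_nbhs_nbhs (conj open_off off_x).
exists e => // z bz; split=> [[b /= bL Fbz]|Faz]; last by exists a.
have [<- //|ba] := eqVneq b a.
have : (\bigcup_(b in [set` others]) F b) z by exists b => //=; rewrite mem_filter ba.
by rewrite bigcup_seq => /(eoff z bz).
Qed.

(** * Polylines with integer vertices *)

Definition Zpoint := (Z * Z)%type.

Definition orientZ (p q r : Zpoint) : Z :=
  Z.sub (Z.mul (Z.sub q.1 p.1) (Z.sub r.2 p.2)) (Z.mul (Z.sub q.2 p.2) (Z.sub r.1 p.1)).

(* Positive when the line of [a] leaves [b] on one side, negative when it separates the ends of [b]. *)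
Definition sides_sign (a b : Zpoint * Zpoint) : Z :=
  Z.mul (Z.sgn (orientZ a.1 a.2 b.1)) (Z.sgn (orientZ a.1 a.2 b.2)).

Definition precedes (coord : Zpoint -> Z) (a b : Zpoint * Zpoint) : bool :=
  Z.ltb (Z.max (coord a.1) (coord a.2)) (Z.min (coord b.1) (coord b.2)).

(* Conditionals rather than [||] keep [vm_compute] lazy. *)
Definition separated (a b : Zpoint * Zpoint) : bool :=
  if precedes fst a b then true else if precedes fst b a then true else
  if precedes snd a b then true else if precedes snd b a then true else
  if Z.ltb Z0 (sides_sign a b) then true else Z.ltb Z0 (sides_sign b a).

Definition crossing (a b : Zpoint * Zpoint) : bool :=
  if Z.ltb (sides_sign a b) Z0 then Z.ltb (sides_sign b a) Z0 else false.

Definition has_end (a : Zpoint * Zpoint) (w : Zpoint) : bool := (a.1 == w) || (a.2 == w).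
Definition other_end (a : Zpoint * Zpoint) (w : Zpoint) : Zpoint := if a.1 == w then a.2 else a.1.

Definition touching (a b : Zpoint * Zpoint) (w : Zpoint) : bool :=
  [&& has_end a w, has_end b w & orientZ w (other_end a w) (other_end b w) != Z0].

Fixpoint simple (p : Zpoint) (s : seq Zpoint) : bool :=
  match s with
  | [::] => false
  | [:: q] => p != q
  | q :: (r :: s'') as s' => [&& orientZ q p r != Z0, all (separated (p, q)) (steps r s'') & simple q s']
  end.

Lemma crossingC a b : crossing a b = crossing b a.
Proof. by rewrite /crossing; case: (Z.ltb _ _); case: (Z.ltb _ _). Qed.

Lemma steps_map (T U : Type) (f : T -> U) x s :
  steps (f x) (map f s) = [seq (f e.1, f e.2) | e <- steps x s].
Proof. by elim: s x => //= y s IH x; rewrite -IH. Qed.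

Section IntegerPoints.
Variable R : realType.
Local Notation plane := (plane R).
Implicit Types (m n : Z) (p q r w : Zpoint) (s : seq Zpoint) (a b : Zpoint * Zpoint).
Implicit Types (L M : seq (Zpoint * Zpoint)) (x z : plane) (t : R).

Definition real_of_Z n : R := (int_of_Z n)%:~R.

Lemma real_of_ZB m n : real_of_Z (Z.sub m n) = real_of_Z m - real_of_Z n.
Proof. by rewrite /real_of_Z -intrB; congr intr; lia. Qed.

Lemma real_of_ZM m n : real_of_Z (Z.mul m n) = real_of_Z m * real_of_Z n.
Proof. by rewrite /real_of_Z -intrM; congr intr; lia. Qed.

Lemma real_of_Z_lt m n : (real_of_Z m < real_of_Z n) = Z.ltb m n.
Proof. by rewrite /real_of_Z ltr_int; lia. Qed.

Lemma real_of_Z_inj : injective real_of_Z.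
Proof. by move=> m n /eqP; rewrite eqr_int => /eqP; lia. Qed.

Definition plane_of_Z p : plane := (real_of_Z p.1, real_of_Z p.2).

Lemma plane_of_Z_inj : injective plane_of_Z.
Proof. by move=> [a b] [c d] [/real_of_Z_inj -> /real_of_Z_inj ->]. Qed.

Lemma orient_plane_of_Z p q r :
  orient (plane_of_Z p) (plane_of_Z q) (plane_of_Z r) = real_of_Z (orientZ p q r).
Proof. by rewrite /orientZ !(real_of_ZB, real_of_ZM). Qed.

Lemma orientZ_neq0 p q r : orientZ p q r != Z0 ->
  orient (plane_of_Z p) (plane_of_Z q) (plane_of_Z r) != 0.
Proof. by apply: contraNneq; rewrite orient_plane_of_Z -[0]/(real_of_Z Z0) => /real_of_Z_inj ->. Qed.

Definition edge_segment a : set plane := curve (lerp (plane_of_Z a.1) (plane_of_Z a.2)).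
Definition cover L : set plane := \bigcup_(a in [set` L]) edge_segment a.

Lemma sides_sign_orient a b :
  let o := orient (plane_of_Z a.1) (plane_of_Z a.2) in
  (0 < o (plane_of_Z b.1) * o (plane_of_Z b.2)) = Z.ltb Z0 (sides_sign a b) /\
  (o (plane_of_Z b.1) * o (plane_of_Z b.2) < 0) = Z.ltb (sides_sign a b) Z0.
Proof.
rewrite /sides_sign -Z.sgn_mul !orient_plane_of_Z -real_of_ZM -[0]/(real_of_Z Z0) !real_of_Z_lt.
by split; lia.
Qed.

Lemma precedes_disjoint a b z (coord : Zpoint -> Z) (proj : plane -> R) :
  (forall p q t, proj (lerp (plane_of_Z p) (plane_of_Z q) t) =
     real_of_Z (coord p) + t * (real_of_Z (coord q) - real_of_Z (coord p))) ->
  precedes coord a b -> edge_segment a z -> ~ edge_segment b z.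
Proof.
move=> projE /Z.ltb_spec0 ab /segment_curveP[t tI ->] /segment_curveP[t' t'I].
move=> /(congr1 proj); rewrite !projE.
have [lt11 lt12 lt21 lt22] : [/\ real_of_Z (coord a.1) < real_of_Z (coord b.1),
    real_of_Z (coord a.1) < real_of_Z (coord b.2), real_of_Z (coord a.2) < real_of_Z (coord b.1) &
    real_of_Z (coord a.2) < real_of_Z (coord b.2)].
  by rewrite !real_of_Z_lt; split; lia.
pose m := Num.max (real_of_Z (coord a.1)) (real_of_Z (coord a.2)).
have [a1m a2m] : real_of_Z (coord a.1) <= m /\ real_of_Z (coord a.2) <= m by rewrite !le_max !lexx orbT.
have [mb1 mb2] : 0 < real_of_Z (coord b.1) - m /\ 0 < real_of_Z (coord b.2) - m.
  by rewrite !subr_gt0 !gt_max lt11 lt12 lt21 lt22.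
have below : 0 <= (1 - t) * (m - real_of_Z (coord a.1)) + t * (m - real_of_Z (coord a.2)).
  by apply: addr_ge0; apply: mulr_ge0; lra.
have above := convex_gt0 mb1 mb2 t'I.
lra.
Qed.

Lemma separated_disjoint a b z : separated a b -> edge_segment a z -> ~ edge_segment b z.
Proof.
have disjointC c d : (edge_segment c z -> ~ edge_segment d z) -> edge_segment d z -> ~ edge_segment c z.
  by move=> cd dz /cd.
have fst_affine p q t : (lerp (plane_of_Z p) (plane_of_Z q) t).1 =
  real_of_Z p.1 + t * (real_of_Z q.1 - real_of_Z p.1) by [].
have snd_affine p q t : (lerp (plane_of_Z p) (plane_of_Z q) t).2 =
  real_of_Z p.2 + t * (real_of_Z q.2 - real_of_Z p.2) by [].
rewrite /separated; case: ifP => [|_]; first by move=> /(precedes_disjoint fst_affine) + _; apply.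
case: ifP => [|_]; first by move=> /(precedes_disjoint fst_affine) ba _; apply: disjointC; exact: ba.
case: ifP => [|_]; first by move=> /(precedes_disjoint snd_affine) + _; apply.
case: ifP => [|_]; first by move=> /(precedes_disjoint snd_affine) ba _; apply: disjointC; exact: ba.
have [<- _] := sides_sign_orient a b; have [<- _] := sides_sign_orient b a.
case: ifP => [ab _|_ ba]; first exact: segments_same_side_disjoint ab.
by apply: disjointC; exact: segments_same_side_disjoint ba.
Qed.

Lemma edge_segment_other_end a w : has_end a w ->
  edge_segment a = curve (lerp (plane_of_Z w) (plane_of_Z (other_end a w))).
Proof.
rewrite /edge_segment /has_end /other_end; case: eqP => [<- //|_] /= /eqP <-.
exact: segment_curveC.
Qed.

Lemma touching_meet a b w z : touching a b w -> edge_segment a z -> edge_segment b z -> z = plane_of_Z w.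
Proof.
move=> /and3P[/edge_segment_other_end -> /edge_segment_other_end -> /orientZ_neq0].
exact: segments_from_meet_at_start.
Qed.

Lemma crossing_meet_once a b z z' : crossing a b ->
  edge_segment a z -> edge_segment b z -> edge_segment a z' -> edge_segment b z' -> z = z'.
Proof.
by rewrite /crossing; have [_ <-] := sides_sign_orient a b; case: ifP => // ab _; exact: segments_meet_once.
Qed.

Lemma edge_segment_closed a : closed (edge_segment a).
Proof. exact: segment_curve_closed. Qed.

Lemma crossing_proper L M a b x : a \in L -> b \in M -> crossing a b ->
  edge_segment a x -> edge_segment b x ->
  {in L, forall c, edge_segment c x -> c = a} -> {in M, forall c, edge_segment c x -> c = b} ->
  proper_crossing (cover L) (cover M) x.
Proof.
rewrite /crossing; have [_ <-] := sides_sign_orient a b; have [_ <-] := sides_sign_orient b a.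
move=> aL bM; case: ifP => // ab ba ax bx only_a only_b.
have [e1 e10 near_a] := cover_near edge_segment_closed aL only_a.
have [e2 e20 near_b] := cover_near edge_segment_closed bM only_b.
have e0 : 0 < Num.min e1 e2 by rewrite lt_min e10.
apply: (segments_cross_properly ab ba ax bx e0) => z bz; [apply: near_a|apply: near_b];
  by apply: le_ball bz; rewrite ge_min lexx ?orbT.
Qed.

Lemma end_not_crossing L a w (B : set plane) : a \in L -> has_end a w -> a.1 != a.2 ->
  {in L, forall b, edge_segment b (plane_of_Z w) -> b = a} -> ~ proper_crossing (cover L) B (plane_of_Z w).
Proof.
move=> aL aw a12 only_a; have [e e0 near] := cover_near edge_segment_closed aL only_a.
apply: (segment_end_not_crossing (q := plane_of_Z (other_end a w)) _ e0) => [|z /near aE].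
  rewrite (inj_eq plane_of_Z_inj); move: a12 aw; rewrite /has_end /other_end.
  by have [<- //|_ a12 /= /eqP <-] := eqVneq a.1 w; rewrite eq_sym.
by rewrite -(edge_segment_other_end aw) => /aE.
Qed.

Definition polyline_of_Z p s : R -> plane := polyline (plane_of_Z p) (map plane_of_Z s).

Lemma polyline_of_Z_start p s : polyline_of_Z p s 0 = plane_of_Z p.
Proof. exact: polyline_start. Qed.

Lemma polyline_of_Z_end p s : polyline_of_Z p s 1 = plane_of_Z (last p s).
Proof. by rewrite /polyline_of_Z polyline_end last_map. Qed.

Lemma curve_polyline_of_Z p s : s != [::] -> curve (polyline_of_Z p s) = cover (steps p s).
Proof.
move=> s0; rewrite /polyline_of_Z curve_polyline; last by case: s s0.
by rewrite steps_map /cover !bigcup_seq big_map.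
Qed.

Lemma simple_of_Z p s : simple p s -> simple_polyline (plane_of_Z p) (map plane_of_Z s).
Proof.
elim: s p => [//|q [|r s] IH] p; first by rewrite /= (inj_eq plane_of_Z_inj).
move=> /and3P[qpr /allP pq_separated /IH simple_tail]; split=> //.
  rewrite (inj_eq plane_of_Z_inj); apply: contraNneq qpr => ->.
  by rewrite /orientZ !Z.sub_diag.
rewrite -/(polyline_of_Z q (r :: s)) curve_polyline_of_Z // => z [pqz [a /=]].
rewrite inE => /orP[/eqP ->|/pq_separated/separated_disjoint sep] az; last by case: (sep z pqz).
apply: (segments_from_meet_at_start (orientZ_neq0 qpr)) => //.
by rewrite segment_curveC.
Qed.

End IntegerPoints.

(** * The weak drawing *)

Local Open Scope Z_scope.

Definition side_points (m : Z) : seq Zpoint :=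
  [:: (m * 71, 3); (m * 40, 1); (m * 60, 31); (m * 62, -30); (m * 90, 20); (m * 91, -21)].

Definition base_points : seq Zpoint := (0, 7) :: side_points 1 ++ side_points (-1).
Definition base_point (n : nat) : Zpoint := nth (0, 0) base_points n.

(* In the affine frame where the ends of the thick edge are (0, 0) and (58, 0), these five points complete a
   straight-line fan-planar K7; dividing their height by [flatness] puts them in a thin lens around the edge. *)
Definition lens : seq Zpoint := [:: (13, 20); (4, 2054); (23, 138); (23, 428); (56, -2274)].
Definition flatness : Z := 16000.

Definition scale (p : Zpoint) : Zpoint := (58 * flatness * p.1, 58 * flatness * p.2).

Definition point (n : nat) : Zpoint :=
  if (n < 13)%N then scale (base_point n) else
  let: (x, y) := nth (0%N, 0%N) thick_edges ((n - 13) %/ 5) in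
  let: (s, h) := nth (0, 0) lens ((n - 13) %% 5) in
  let: (p, q) := (base_point x, base_point y) in
  let: (dx, dy) := (q.1 - p.1, q.2 - p.2) in
  ((scale p).1 + s * flatness * dx - h * dy, (scale p).2 + s * flatness * dy + h * dx).

Definition side_bends (m : Z) : seq (seq Zpoint) :=
  [:: [:: (m * 38, 52); (m * 100, 49)]; [:: (m * 39, -51); (m * 101, -50)]; [:: (m * 112, 42); (m * 113, -41)];
      [:: (m * 101, 29)]; [:: (m * 102, -28)]; [::]; [::]].

Local Close Scope Z_scope.
Local Open Scope nat_scope.

Definition bends (e : nat * nat) : seq Zpoint :=
  map scale (nth [::] (side_bends 1 ++ side_bends (Z.opp 1)) (index e thin_edges)).

Definition edge_tail (e : nat * nat) : seq Zpoint := rcons (bends e) (point e.2).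
Definition edge_steps (e : nat * nat) : seq (Zpoint * Zpoint) := steps (point e.1) (edge_tail e).

Definition edges : seq (nat * nat) :=
  flatten [seq [seq e <- [seq (i, j) | i <- M, j <- M] | e.1 < e.2] | M <- gadgets] ++ thin_edges.

Definition drawn_edges : seq ((nat * nat) * seq (Zpoint * Zpoint)) := [seq (e, edge_steps e) | e <- edges].

Definition ends_at (e : nat * nat) (i : nat) : bool := (i == e.1) || (i == e.2).

Definition common_end (e f : nat * nat) : option nat :=
  if ends_at f e.1 then Some e.1 else if ends_at f e.2 then Some e.2 else None.

Definition misses (a : Zpoint * Zpoint) (w : Zpoint) : bool := separated a (w, w).

Definition lone_end (w : Zpoint) (L : seq (Zpoint * Zpoint)) : bool :=
  if [seq a <- L | has_end a w] is [:: a]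
  then (a.1 != a.2) && all (fun b => has_end b w || misses b w) L else false.

Definition edge_check (e : nat * nat) (L : seq (Zpoint * Zpoint)) : bool :=
  [&& e.1 < e.2, e.2 < order, simple (point e.1) (edge_tail e) &
   [&& lone_end (point e.1) L, lone_end (point e.2) L &
       all (fun v => ends_at e v || all (fun b => misses b (point v)) L) (iota 0 order)]].

Definition unseparated (L M : seq (Zpoint * Zpoint)) : seq ((Zpoint * Zpoint) * (Zpoint * Zpoint)) :=
  [seq ab <- [seq (a, b) | a <- L, b <- M] | ~~ separated ab.1 ab.2].

Definition K7_crossings : seq ((nat * nat) * (nat * nat)) :=
  [:: ((0, 1), (2, 6)); ((0, 1), (3, 6)); ((0, 1), (4, 6)); ((0, 1), (5, 6)); ((0, 4), (2, 3));
      ((0, 4), (2, 5)); ((0, 5), (2, 3)); ((0, 5), (3, 4)); ((1, 2), (3, 6)); ((1, 2), (4, 6));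
      ((1, 2), (5, 6)); ((1, 4), (3, 6)); ((1, 4), (5, 6)); ((1, 5), (3, 6)); ((2, 5), (3, 4))].

(* Indices into [thin_pairs]. *)
Definition thin_crossings : seq (nat * nat) := [:: (0, 2); (0, 3); (0, 5); (1, 2); (1, 4); (1, 6); (3, 4)].

Definition upward (i j : nat) : nat * nat := if i < j then (i, j) else (j, i).

Definition crossings : seq ((nat * nat) * (nat * nat)) :=
  [seq (upward (nth 0 M c.1.1) (nth 0 M c.1.2), upward (nth 0 M c.2.1) (nth 0 M c.2.2)) |
     M <- gadgets, c <- K7_crossings] ++
  [seq (nth (0, 0) (thin_pairs s) c.1, nth (0, 0) (thin_pairs s) c.2) |
     s <- [:: left_side; right_side], c <- thin_crossings].

Definition crossed_by (e : nat * nat) : seq (nat * nat) :=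
  [seq c.2 | c <- crossings & c.1 == e] ++ [seq c.1 | c <- crossings & c.2 == e].

Definition pair_check (e : nat * nat) L (f : nat * nat) M : bool :=
  if common_end e f is Some w then all (fun ab => touching ab.1 ab.2 (point w)) (unseparated L M) else
  match unseparated L M with
  | [::] => true
  | [:: (a, b)] => if crossing a b then ((e, f) \in crossings) || ((f, e) \in crossings) else false
  | _ => false
  end.

Definition bypass (e f g : nat * nat) (s : seq Zpoint) : bool :=
  all (fun a => [&& all (separated a) (edge_steps f), all (separated a) (edge_steps g) &
         all (fun b => [|| separated a b, touching a b (point e.1) | touching a b (point e.2)]) (edge_steps e)])
    (steps (point e.1) s).

(* Along a triangle with centroid [u], or along a chord of the pentagon, one passes from one end of [e] to
   the other without meeting the edges through [u] that cross [e]. *)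
Definition fan_check (e f g : nat * nat) : bool :=
  if common_end f g is Some u then
    let: (p, q, r) := (point e.1, point e.2, point u) in
    let apex := (Z.sub (Z.mul 3 r.1) (Z.add p.1 q.1), Z.sub (Z.mul 3 r.2) (Z.add p.2 q.2)) in
    if bypass e f g [:: q] then true else bypass e f g [:: apex; q]
  else false.

Lemma points_uniq : uniq [seq point i | i <- iota 0 order].
Proof. by vm_compute. Qed.

Lemma edges_checked : all (fun x => edge_check x.1 x.2) drawn_edges.
Proof. by vm_compute. Qed.

Lemma pairs_checked : pairwise (fun x y => pair_check x.1 x.2 y.1 y.2) drawn_edges.
Proof. by vm_compute. Qed.

Lemma fans_checked : all (fun e => let C := crossed_by e in
  all (fun f => all (fun g => if f == g then true else fan_check e f g) C) C) edges.
Proof. by vm_compute. Qed.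

Local Close Scope nat_scope.

Section EdgeData.
Implicit Types (e f g : nat * nat) (i j w : nat).

Lemma last_edge_tail p e : last p (edge_tail e) = point e.2.
Proof. by rewrite /edge_tail last_rcons. Qed.

Lemma edge_tail_neq0 e : edge_tail e != [::].
Proof. by rewrite /edge_tail; case: bends. Qed.

Lemma adjn_edges i j : adjn i j -> ((i, j) \in edges) || ((j, i) \in edges).
Proof.
move=> /andP[ij /orP[/hasP[M Mg /andP[iM jM]]|/orP[thin|thin]]].
- have gadget_edge k l : k \in M -> l \in M -> (k < l)%N -> (k, l) \in edges.
    move=> kM lM kl; rewrite mem_cat; apply/orP; left; apply/flattenP.
    exists [seq e <- [seq (i, j) | i <- M, j <- M] | (e.1 < e.2)%N].
      exact: (map_f (fun M => [seq e <- [seq (i, j) | i <- M, j <- M] | (e.1 < e.2)%N])).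
    by rewrite mem_filter kl; apply: allpairs_f.
  move: ij; rewrite neq_ltn => /orP[ij|ji]; first by rewrite (gadget_edge i j).
  by rewrite (gadget_edge j i) ?orbT.
- by rewrite /edges [X in X || _]mem_cat thin orbT.
- by rewrite /edges [X in _ || X]mem_cat thin !orbT.
Qed.

Lemma mem_drawn_edges e : e \in edges -> (e, edge_steps e) \in drawn_edges.
Proof. exact: (map_f (fun e => (e, edge_steps e))). Qed.

Lemma edge_checkP e : e \in edges -> edge_check e (edge_steps e).
Proof. by move=> /mem_drawn_edges/(allP edges_checked). Qed.

Lemma edge_order e : e \in edges -> (e.1 < e.2 < order)%N.
Proof. by move=> /edge_checkP/and4P[-> ->]. Qed.

Lemma end_lt_order e i : e \in edges -> ends_at e i -> (i < order)%N.
Proof. by move=> /edge_order/andP[lt12 lt2] /orP[] /eqP -> //; exact: ltn_trans lt2. Qed.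

Lemma pairwise_mem (T : eqType) (r : rel T) (s : seq T) x y :
  pairwise r s -> x \in s -> y \in s -> x != y -> r x y || r y x.
Proof.
elim: s => [//|z s IH] /= /andP[/allP rz ps]; rewrite !inE.
case/predU1P => [->|xs]; case/predU1P => [->|ys]; rewrite ?eqxx //.
- by rewrite rz.
- by rewrite rz // orbT.
- exact: IH.
Qed.

Lemma pair_checkP e f : e \in edges -> f \in edges -> e != f ->
  pair_check e (edge_steps e) f (edge_steps f) || pair_check f (edge_steps f) e (edge_steps e).
Proof.
move=> /mem_drawn_edges ee /mem_drawn_edges ff ef.
by apply: (pairwise_mem pairs_checked ee ff); rewrite xpair_eqE (negPf ef).
Qed.

Lemma fan_checkP e f g : e \in edges -> f \in crossed_by e -> g \in crossed_by e -> f != g ->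
  fan_check e f g.
Proof.
move=> ee fe ge fg; have /allP/(_ f fe)/allP/(_ g ge) := allP fans_checked e ee.
by rewrite (negPf fg).
Qed.

Lemma common_endC e f : common_end e f = None -> common_end f e = None.
Proof. by rewrite /common_end /ends_at !(eq_sym f.1) !(eq_sym f.2); do 4 case: eqP => //=. Qed.

Lemma common_endP e f w : common_end e f = Some w -> ends_at e w /\ ends_at f w.
Proof.
rewrite /common_end; case: ifP => [f1 [<-]|_]; first by rewrite /ends_at eqxx.
by case: ifP => // f2 [<-]; rewrite /ends_at eqxx orbT.
Qed.

Lemma common_end_exists e f w : ends_at e w -> ends_at f w -> common_end e f <> None.
Proof. by rewrite /common_end => /orP[] /eqP -> fw; rewrite fw //; case: ifP. Qed.

Lemma common_ends_eq e f w w' : e \in edges -> f \in edges -> e != f ->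
  ends_at e w -> ends_at f w -> ends_at e w' -> ends_at f w' -> w = w'.
Proof.
move=> /edge_order e_lt /edge_order f_lt; move: e_lt f_lt; rewrite /ends_at.
by case: e f => [i j] [k l] /=; rewrite xpair_eqE; lia.
Qed.

Lemma crossed_byP e f : ((e, f) \in crossings) || ((f, e) \in crossings) -> f \in crossed_by e.
Proof.
rewrite /crossed_by [f \in _]mem_cat => /orP[ef|fe]; apply/orP; [left|right].
  by apply/mapP; exists (e, f); rewrite // mem_filter eqxx.
by apply/mapP; exists (f, e); rewrite // mem_filter eqxx.
Qed.

Lemma point_inj i j : (i < order)%N -> (j < order)%N -> point i = point j -> i = j.
Proof.
move=> i_lt j_lt E; have size_points : size [seq point i | i <- iota 0 order] = order.
  by rewrite size_map size_iota.
apply: (uniqP (point 0) points_uniq); rewrite ?inE ?size_points //.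
by rewrite !(nth_map 0%N) ?size_iota // !nth_iota.
Qed.

Section CodedEdges.
Variable R : realType.
Local Notation plane := (plane R).
Local Notation cover := (@cover R).
Implicit Types (z : plane) (L M : seq (Zpoint * Zpoint)).

Lemma unseparatedP L M a b z : a \in L -> b \in M -> edge_segment a z -> edge_segment b z ->
  (a, b) \in unseparated L M.
Proof.
move=> aL bM az bz; rewrite mem_filter /=; apply/andP; split; last exact: allpairs_f.
by apply/negP => sep; exact: separated_disjoint sep az bz.
Qed.

Lemma missesP a (w : Zpoint) : misses a w -> ~ edge_segment a (plane_of_Z R w).
Proof. by move=> sep /(separated_disjoint sep); apply; exact: segment_curve_start. Qed.

Lemma lone_endP (w : Zpoint) L : lone_end w L ->
  exists a, [/\ a \in L, has_end a w, a.1 != a.2 &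
                {in L, forall b, edge_segment b (plane_of_Z R w) -> b = a}].
Proof.
rewrite /lone_end; case E : [seq a <- L | has_end a w] => [//|a [|//]] /andP[a12 /allP others].
have : a \in [seq a <- L | has_end a w] by rewrite E mem_head.
rewrite mem_filter => /andP[aw aL]; exists a; split=> // b bL bw.
have : b \in [seq a <- L | has_end a w].
  by rewrite mem_filter bL andbT; have /orP[//|/missesP] := others b bL.
by rewrite E inE => /eqP.
Qed.

Lemma meet_at_common_end e f w z : e \in edges -> f \in edges -> e != f -> common_end e f = Some w ->
  cover (edge_steps e) z -> cover (edge_steps f) z ->
  exists v, [/\ ends_at e v, ends_at f v & z = plane_of_Z R (point v)].
Proof.
have touch e' f' a b v : pair_check e' (edge_steps e') f' (edge_steps f') -> common_end e' f' = Some v ->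
    a \in edge_steps e' -> b \in edge_steps f' -> edge_segment a z -> edge_segment b z ->
    z = plane_of_Z R (point v).
  rewrite /pair_check => + ev; rewrite ev => /allP touchings aL bM az bz.
  exact: touching_meet (touchings _ (unseparatedP aL bM az bz)) az bz.
move=> ee ff ef ew [a /= aL az] [b /= bM bz].
have /orP[check|check] := pair_checkP ee ff ef.
  by have [v1 v2] := common_endP ew; exists w; split=> //; exact: touch check ew aL bM az bz.
case fv : (common_end f e) => [v|]; last by rewrite (common_endC fv) in ew.
by have [v1 v2] := common_endP fv; exists v; split=> //; exact: touch check fv bM aL bz az.
Qed.

Definition cross_once L M : Prop := exists a b,
  [/\ a \in L, b \in M, crossing a b & forall a' b' z, a' \in L -> b' \in M ->
      edge_segment a' z -> edge_segment b' z -> a' = a /\ b' = b].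

Lemma cross_onceC L M : cross_once L M -> cross_once M L.
Proof.
move=> [a [b [aL bM ab only]]]; exists b, a; split=> //; first by rewrite crossingC.
by move=> b' a' z bM' aL' bz az; have [-> ->] := only a' b' z aL' bM' az bz.
Qed.

Lemma pair_check_crossing e f z : pair_check e (edge_steps e) f (edge_steps f) -> common_end e f = None ->
  cover (edge_steps e) z -> cover (edge_steps f) z ->
  ((e, f) \in crossings) || ((f, e) \in crossings) /\ cross_once (edge_steps e) (edge_steps f).
Proof.
rewrite /pair_check => + ef [a0 /= a0L a0z] [b0 /= b0M b0z]; rewrite ef.
have := unseparatedP a0L b0M a0z b0z.
case E : (unseparated _ _) => [//|[a b] [|//]] _; case: ifP => // ab listed.
have : (a, b) \in unseparated (edge_steps e) (edge_steps f) by rewrite E mem_head.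
rewrite mem_filter => /andP[_ /allpairsP[[a1 b1] /= [aL bM [Ea Eb]]]].
rewrite -{}Ea in aL; rewrite -{}Eb in bM.
split=> //; exists a, b; split=> // a' b' z' aL' bM' az' bz'.
by have := unseparatedP aL' bM' az' bz'; rewrite E inE => /eqP[-> ->].
Qed.

Lemma meet_at_crossing e f z : e \in edges -> f \in edges -> e != f -> common_end e f = None ->
  cover (edge_steps e) z -> cover (edge_steps f) z ->
  f \in crossed_by e /\ cross_once (edge_steps e) (edge_steps f).
Proof.
move=> ee ff ef no_end ze zf; have /orP[check|check] := pair_checkP ee ff ef.
  by have [/crossed_byP] := pair_check_crossing check no_end ze zf.
have [listed once] := pair_check_crossing check (common_endC no_end) zf ze.
by split; [apply: crossed_byP; rewrite orbC|exact: cross_onceC].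
Qed.

End CodedEdges.

(* Locking [edges] keeps conversion from evaluating the coordinates when it compares two edges. *)
Definition edge_code (E : {set fan_graph}) : nat * nat :=
  let s := locked edges in nth (0, 0)%N s (find (fun e => E == [set vx e.1; vx e.2]%SET) s).

Lemma edge_codeP E : is_edge E -> edge_code E \in edges /\ E = [set vx (edge_code E).1; vx (edge_code E).2]%SET.
Proof.
move=> [u [v [uv ->]]].
have coded : has (fun e => [set u; v]%SET == [set vx e.1; vx e.2]%SET) edges.
  have /orP[listed|listed] := adjn_edges uv; apply/hasP.
    by exists (code u, code v) => //=; rewrite !codeK.
  by exists (code v, code u) => //=; rewrite !codeK finset.setUC.
rewrite /edge_code -lock; split; first by rewrite mem_nth // -has_find.
by apply/eqP; exact: (nth_find (0, 0)%N coded).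
Qed.

Lemma edge_code_neq E F : is_edge E -> is_edge F -> E != F -> edge_code E != edge_code F.
Proof. by move=> /edge_codeP[_ EE] /edge_codeP[_ FF]; apply: contraNneq => EF; rewrite EE FF EF. Qed.

Lemma mem_edge E v : is_edge E -> (v \in E) = ends_at (edge_code E) (code v).
Proof.
move=> /edge_codeP[ee EE]; rewrite {1}EE !inE /ends_at.
have vxE i : (i < order)%N -> (v == vx i) = (code v == i).
  by move=> i_lt; rewrite -(inj_eq (can_inj codeK)) vxK.
by rewrite !vxE // (end_lt_order ee) // /ends_at eqxx ?orbT.
Qed.

Lemma vx_mem_edge E i : is_edge E -> ends_at (edge_code E) i -> vx i \in E.
Proof. by move=> EE iE; rewrite mem_edge // vxK // (end_lt_order (edge_codeP EE).1). Qed.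

End EdgeData.

Section Drawing.
Variable R : realType.
Local Notation plane := (plane R).
Local Notation cover := (@cover R).
Implicit Types (E F H : {set fan_graph}) (x y z : plane) (i : nat).

Definition fan_pos (v : fan_graph) : plane := plane_of_Z R (point (code v)).
Definition fan_arc E : R -> plane := @polyline_of_Z R (point (edge_code E).1) (edge_tail (edge_code E)).

Lemma fan_pos_vx i : (i < order)%N -> fan_pos (vx i) = plane_of_Z R (point i).
Proof. by move=> i_lt; rewrite /fan_pos vxK. Qed.

Lemma fan_pos_inj : injective fan_pos.
Proof.
move=> u v /plane_of_Z_inj/(point_inj (ltn_ord (u : 'I_order)) (ltn_ord (v : 'I_order))).
by move/(can_inj codeK).
Qed.

Lemma curve_fan_arc E : curve (fan_arc E) = cover (edge_steps (edge_code E)).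
Proof. by rewrite curve_polyline_of_Z // edge_tail_neq0. Qed.

Lemma fan_arc_start E : fan_arc E 0 = plane_of_Z R (point (edge_code E).1).
Proof. exact: polyline_of_Z_start. Qed.

Lemma fan_arc_end E : fan_arc E 1 = plane_of_Z R (point (edge_code E).2).
Proof. by rewrite /fan_arc polyline_of_Z_end last_edge_tail. Qed.

Lemma fan_arc_jordan E : is_edge E -> jordan_arc (fan_arc E).
Proof.
move=> /edge_codeP[/edge_checkP/and4P[_ _ simple_E _] _].
exact/simple_polyline_jordan/simple_of_Z.
Qed.

Lemma fan_arc_ends E : is_edge E ->
  exists u v, [/\ E = [set u; v]%SET, fan_arc E 0 = fan_pos u & fan_arc E 1 = fan_pos v].
Proof.
move=> /edge_codeP[ee EE]; exists (vx (edge_code E).1), (vx (edge_code E).2).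
by rewrite !fan_pos_vx ?(end_lt_order ee) /ends_at ?eqxx ?orbT // fan_arc_start fan_arc_end.
Qed.

Lemma fan_arc_vertex E : is_edge E -> forall v, curve (fan_arc E) (fan_pos v) -> v \in E.
Proof.
move=> EE v; rewrite curve_fan_arc => -[b /= bL bv]; rewrite mem_edge //.
have /and4P[_ _ _ /and3P[_ _ /allP off]] := edge_checkP (edge_codeP EE).1.
have := off (code v); rewrite mem_iota /= add0n => /(_ (ltn_ord (v : 'I_order)))/orP[//|/allP missed].
by have := missesP (missed b bL) bv.
Qed.

Lemma fan_arcs_meet E F z : is_edge E -> is_edge F -> E != F -> (curve (fan_arc E) `&` curve (fan_arc F)) z ->
  (exists2 v, v \in E /\ v \in F & z = fan_pos v) \/
  [/\ ~ share_endpoint E F, edge_code F \in crossed_by (edge_code E) &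
      @cross_once R (edge_steps (edge_code E)) (edge_steps (edge_code F))].
Proof.
move=> EE FF EF; rewrite !curve_fan_arc => -[zE zF].
have [[ee _] [ff _]] := (edge_codeP EE, edge_codeP FF); have ef := edge_code_neq EE FF EF.
case common : (common_end (edge_code E) (edge_code F)) => [w|].
  have [v [ve vf ->]] := meet_at_common_end ee ff ef common zE zF; left; exists (vx v).
    by split; exact: vx_mem_edge.
  by rewrite fan_pos_vx // (end_lt_order ee).
right; have [listed once] := meet_at_crossing ee ff ef common zE zF; split=> // -[u []].
rewrite !mem_edge // => uE uF; exact: common_end_exists uE uF common.
Qed.

Lemma cross_once_unique (L M : seq (Zpoint * Zpoint)) z z' : @cross_once R L M ->
  (cover L `&` cover M) z -> (cover L `&` cover M) z' -> z = z'.
Proof.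
move=> [a [b [aL bM ab only]]].
have on_ab y : (cover L `&` cover M) y -> edge_segment a y /\ edge_segment b y.
  by move=> [[a' /= aL' ay] [b' /= bM' bY]]; have [<- <-] := only a' b' y aL' bM' ay bY.
by move=> /on_ab[az bz] /on_ab[az' bz']; exact: crossing_meet_once ab az bz az' bz'.
Qed.

Lemma cross_once_proper (L M : seq (Zpoint * Zpoint)) z : @cross_once R L M ->
  (cover L `&` cover M) z -> proper_crossing (cover L) (cover M) z.
Proof.
move=> [a [b [aL bM ab only]]] [[a' /= aL' az] [b' /= bM' bz]].
have [aE bE] := only a' b' z aL' bM' az bz; subst a' b'.
apply: (crossing_proper aL bM ab az bz) => c cL cz.
  by have [] := only c b z cL bM cz bz.
by have [] := only a c z aL cL az cz.
Qed.

Lemma fan_arcs_meet_once E F : is_edge E -> is_edge F -> E != F ->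
  forall x y, (curve (fan_arc E) `&` curve (fan_arc F)) x ->
              (curve (fan_arc E) `&` curve (fan_arc F)) y -> x = y.
Proof.
move=> EE FF EF x y xEF yEF.
have [[u [uE uF] ->]|[indep _ once]] := fan_arcs_meet EE FF EF xEF.
  have [[v [vE vF] ->]|[independent _ _]] := fan_arcs_meet EE FF EF yEF;
    last by case: independent; exists u.
  congr fan_pos; apply: (can_inj codeK); move: uE uF vE vF; rewrite !mem_edge //.
  by apply: common_ends_eq (edge_code_neq EE FF EF); case: (edge_codeP EE) (edge_codeP FF) => ? _ [].
by apply: (cross_once_unique once); rewrite -!curve_fan_arc.
Qed.

Lemma fan_arcs_cross E F : is_edge E -> is_edge F -> E != F ->
  forall z, (curve (fan_arc E) `&` curve (fan_arc F)) z ->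
  (exists v, [/\ v \in E, v \in F & z = fan_pos v]) \/
  proper_crossing (curve (fan_arc E)) (curve (fan_arc F)) z.
Proof.
move=> EE FF EF z zEF; have [[v [vE vF] ->]|[_ _ once]] := fan_arcs_meet EE FF EF zEF.
  by left; exists v.
by right; rewrite !curve_fan_arc; apply: cross_once_proper => //; rewrite -!curve_fan_arc.
Qed.

Lemma fan_arcs_adjacent E F : is_edge E -> is_edge F -> E != F -> share_endpoint E F ->
  forall z, ~ proper_crossing (curve (fan_arc E)) (curve (fan_arc F)) z.
Proof.
move=> EE FF EF shared z cross.
have [[v [vE _] zv]|[]//] := fan_arcs_meet EE FF EF (crossing_on_curves cross).
have [ee _] := edge_codeP EE; have /and4P[_ _ _ /and3P[lone1 lone2 _]] := edge_checkP ee.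
have /(@lone_endP R)[a [aL aw a12 only]] : lone_end (point (code v)) (edge_steps (edge_code E)).
  by move: vE; rewrite mem_edge // => /orP[] /eqP ->.
by move: cross; rewrite zv curve_fan_arc; exact: end_not_crossing aL aw a12 only.
Qed.

Definition fan_drawing : drawing R fan_graph :=
  Drawing fan_pos_inj fan_arc_jordan fan_arc_ends fan_arc_vertex
    fan_arcs_meet_once fan_arcs_cross fan_arcs_adjacent.

Lemma crosses_at_crossed_by E F z : crosses_at fan_drawing F E z ->
  [/\ edge_code F \in crossed_by (edge_code E), curve (fan_arc F) z & curve (fan_arc E) z].
Proof.
move=> [FF EE FE cross]; have [zF zE] := crossing_on_curves cross; split=> //.
have EF : E != F by rewrite eq_sym.
have [[v [vE vF] _]|[_ listed _] //] := fan_arcs_meet EE FF EF (conj zE zF).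
by case: (fan_arcs_adjacent FF EE FE _ cross); exists v.
Qed.

Lemma crosses_at_fan_check E F H x y : crosses_at fan_drawing F E x -> crosses_at fan_drawing H E y -> F != H ->
  fan_check (edge_code E) (edge_code F) (edge_code H).
Proof.
move=> cF cH FH; have [FF EE _ _] := cF; have [HH _ _ _] := cH.
have [[listedF _ _] [listedH _ _]] := (crosses_at_crossed_by cF, crosses_at_crossed_by cH).
by apply: fan_checkP => //; [exact: (edge_codeP EE).1|exact: edge_code_neq].
Qed.

Lemma no_pattern_I E F H : ~ pattern_I fan_drawing E F H.
Proof.
move=> [[x cF] [y cH] indep]; have [FF _ _ _] := cF; have [HH _ _ _] := cH.
have [FH|FH] := eqVneq F H.
  by case: FF => u [v [_ FE]]; apply: indep; exists u; rewrite -FH FE !inE eqxx.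
have := crosses_at_fan_check cF cH FH; rewrite /fan_check.
case common : (common_end _ _) => [w|//] _; have [wF wH] := common_endP common.
by apply: indep; exists (vx w); split; exact: vx_mem_edge.
Qed.

Lemma bounded_region_connected (Z P : set plane) x y : connected P -> P `<=` ~` Z -> P x -> P y ->
  bounded_region Z x -> bounded_region Z y.
Proof.
move=> cP PZ Px Py [_ bx]; split; first exact: PZ.
suff <- : connected_component (~` Z) x = connected_component (~` Z) y by [].
by apply: same_connected_component; exact: (connected_component_max Px PZ cP).
Qed.

Lemma bypass_avoids_closed_curve E F H x y u s :
  crosses_at fan_drawing F E x -> crosses_at fan_drawing H E y ->
  bypass (edge_code E) (edge_code F) (edge_code H) s ->
  cover (steps (point (edge_code E).1) s) `<=` ~` closed_curve fan_drawing E F H u x y.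
Proof.
move=> cF cH /allP checked z [a /checked/and3P[/allP aF /allP aH /allP aE] az].
have [_ EE _ _] := cF; have [[_ xF _] [_ yH _]] := (crosses_at_crossed_by cF, crosses_at_crossed_by cH).
have off K : {in edge_steps (edge_code K), forall b, separated a b} -> ~ curve (fan_arc K) z.
  by rewrite curve_fan_arc => sep [b bK bz]; exact: separated_disjoint (sep b bK) az bz.
move=> [[/part_sub_curve zF|zE]|/part_sub_curve zH]; [exact: off aF zF| |exact: off aH zH].
have [c c01 zc] : exists2 c, c = 0 \/ c = 1 & z = fan_arc E c.
  have := part_sub_curve zE; rewrite /= curve_fan_arc => -[b bE bz].
  have /or3P[sep|touch|touch] := aE b bE; first by case: (separated_disjoint sep az bz).
    by exists 0; [left|rewrite fan_arc_start; exact: touching_meet touch az bz].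
  by exists 1; [right|rewrite fan_arc_end; exact: touching_meet touch az bz].
move: zE; rewrite zc => /(part_end (fan_arc_jordan EE) c01); rewrite -zc => -[zx|zy].
  by apply: (off F aF); rewrite zx.
by apply: (off H aH); rewrite zy.
Qed.

Lemma bypass_connects_ends E F H x y u s v w :
  crosses_at fan_drawing F E x -> crosses_at fan_drawing H E y ->
  bypass (edge_code E) (edge_code F) (edge_code H) s -> s != [::] ->
  last (point (edge_code E).1) s = point (edge_code E).2 -> v \in E -> w \in E ->
  bounded_region (closed_curve fan_drawing E F H u x y) (fan_pos v) ->
  bounded_region (closed_curve fan_drawing E F H u x y) (fan_pos w).
Proof.
move=> cF cH checked s0 last_s vE wE; have [_ EE _ _] := cF.
pose P := @polyline_of_Z R (point (edge_code E).1) s.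
have on_P v' : v' \in E -> curve P (fan_pos v').
  rewrite mem_edge // => /orP[] /eqP code_v; rewrite /fan_pos code_v.
    by exists 0; [rewrite /= in_itv /= lexx ler01|exact: polyline_of_Z_start].
  by exists 1; [rewrite /= in_itv /= lexx ler01|rewrite /P polyline_of_Z_end last_s].
apply: (@bounded_region_connected _ (curve P)); [exact: curve_polyline_connected| |exact: on_P..].
by rewrite curve_polyline_of_Z //; exact: bypass_avoids_closed_curve.
Qed.

Lemma no_pattern_II E F H : ~ pattern_II fan_drawing E F H.
Proof.
move=> [u [x [y [FH cF cH _ [v [[vE bv] only]]]]]]; have [_ EE _ _] := cF.
have both w : w \in E -> bounded_region (closed_curve fan_drawing E F H u x y) (fan_pos w).
  move=> wE; have := crosses_at_fan_check cF cH FH; rewrite /fan_check; case: (common_end _ _) => [c|//].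
  by case: ifP => [checked _|_ checked]; apply: (bypass_connects_ends cF cH checked) bv.
case: EE vE => p [q [pq EE]] _; move: (both p) (both q); rewrite EE set21 set22 => bp bq.
have [vp vq] : v = p /\ v = q by split; apply: only; rewrite EE ?set21 ?set22 /=; split; auto.
by move: (adj_neq pq); rewrite -vp -vq eqxx.
Qed.

Lemma fan_graph_weak : weakly_fan_planar R fan_graph.
Proof. by exists fan_drawing => E F H; split; [exact: no_pattern_I|exact: no_pattern_II]. Qed.

End Drawing.

Theorem theorem1 (R : realType) :
  exists G : sgraph, weakly_fan_planar R G /\ ~ strongly_fan_planar R G.
Proof.
by exists fan_graph; split; [exact: fan_graph_weak|exact: fan_graph_not_strong].
Qed.
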